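(* Let $R$ be a Noetherian commutative ring and let $I\subset R$ be an ideal generated by a regular sequence of length $2$. For $k\ge 0$ let $G_k(R/I)=H_k\,N\,\mathrm{Sym}^3\,\Gamma(P_\bullet(R/I))$, where $P_\bullet(R/I)$ is a projective resolution of the $R$-module $R/I$. Then $G_k(R/I)$ is a free $R/I$-module of rank $1$ for $k=0,2,4$, and of rank $0$ for every other $k$.
   Context: $\Gamma$ and $N$ denote the mutually inverse equivalences of the Dold-Kan correspondence: $\Gamma$ sends a non-negatively graded chain complex of $R$-modules to a simplicial $R$-module, and $N$ sends a simplicial $R$-module to its normalized chain complex. $\mathrm{Sym}^3$ (the third symmetric power over $R$) is applied degreewise to a simplicial $R$-module. Since every functor preserves simplicial homotopies, $H_k N\mathrm{Sym}^3\Gamma(P_\bullet(V))$ is independent, up to canonical isomorphism, of the choice of the projective resolution $P_\bullet(V)$ of an $R$-module $V$ (derived functors of the non-additive functor $\mathrm{Sym}^3$ in the sense of Dold-Puppe). *)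

(* Defs.v *)
From HB Require Import structures.
From mathcomp Require Import all_boot all_order all_algebra.
From mathcomp Require Import perm generic_quotient zify boolp.
From mathcomp Require Import freeg.

Set Implicit Arguments.
Unset Strict Implicit.
Unset Printing Implicit Defensive.

Import GRing.Theory.
Local Open Scope ring_scope.
Local Open Scope quotient_scope.

Record submodule (R : comNzRingType) (V : lmodType R) := Submodule {
  submodule_pred :> {pred V};
  submodule_closed : submod_closed submodule_pred
}.

HB.instance Definition _ (R : comNzRingType) (V : lmodType R)
    (N : submodule V) :=
  GRing.isSubmodClosed.Build R V (submodule_pred N) (submodule_closed N).

Section SubmoduleType.
Variables (R : comNzRingType) (V : lmodType R) (N : submodule V).

Definition submod_type := {x : V | x \in submodule_pred N}.

HB.instance Definition _ := SubChoice.on submod_type.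
HB.instance Definition _ :=
  [SubChoice_isSubLmodule of submod_type by <:].
End SubmoduleType.

Section QuotientModule.
Variables (R : comNzRingType) (V : lmodType R) (N : submodule V).

Definition quot_mod := Quotient.quot (submodule_pred N).
HB.instance Definition _ := GRing.Zmodule.on quot_mod.

Definition quot_pi (x : V) : quot_mod := \pi_(quot_mod) x.

Lemma quot_pi_eq x y : (quot_pi x = quot_pi y) <-> (x - y \in N).
Proof.
split=> [h|h].
  by rewrite (Quotient.idealrBE (submodule_pred N)); apply/eqP.
by apply/eqP; rewrite -(Quotient.idealrBE (submodule_pred N)).
Qed.

Lemma quot_piK (q : quot_mod) : quot_pi (repr q) = q.
Proof. exact: reprK. Qed.

Lemma quot_piB : zmod_morphism quot_pi.
Proof. exact: (raddfB \pi_(quot_mod)). Qed.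

HB.instance Definition _ :=
  GRing.isZmodMorphism.Build V quot_mod quot_pi quot_piB.

Definition quot_scale (a : R) (q : quot_mod) : quot_mod :=
  quot_pi (a *: repr q).

Lemma quot_scaleE a x : quot_scale a (quot_pi x) = quot_pi (a *: x).
Proof.
apply/quot_pi_eq; rewrite -scalerBr; apply: rpredZ.
by apply/quot_pi_eq; rewrite quot_piK.
Qed.

Lemma quot_scaleA a b q : quot_scale a (quot_scale b q) = quot_scale (a * b) q.
Proof. by rewrite -[q]quot_piK !quot_scaleE scalerA. Qed.

Lemma quot_scale1 : left_id 1 quot_scale.
Proof. by move=> q; rewrite -[q]quot_piK quot_scaleE scale1r. Qed.

Lemma quot_scaleDr : right_distributive quot_scale +%R.
Proof.
move=> a p q; rewrite -[p]quot_piK -[q]quot_piK.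
by rewrite -raddfD !quot_scaleE scalerDr raddfD.
Qed.

Lemma quot_scaleDl q : {morph quot_scale^~ q : a b / a + b}.
Proof.
by move=> a b; rewrite -[q]quot_piK !quot_scaleE scalerDl raddfD.
Qed.

HB.instance Definition _ := GRing.Zmodule_isLmodule.Build R quot_mod
  quot_scaleA quot_scale1 quot_scaleDr quot_scaleDl.

Lemma quot_piZ : scalable quot_pi.
Proof. by move=> a x; rewrite -quot_scaleE. Qed.

HB.instance Definition _ :=
  GRing.isScalable.Build R V quot_mod *:%R quot_pi quot_piZ.
End QuotientModule.

Section Span.
Variables (R : comNzRingType) (V : lmodType R) (S : V -> Prop).

Definition span_pred : {pred V} := fun x =>
  `[< exists r : seq (R * V),
        (forall p, p \in r -> S p.2) /\ x = \sum_(p <- r) p.1 *: p.2 >].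

Lemma span_closed : submod_closed span_pred.
Proof.
split; first by apply/asboolP; exists [::]; rewrite big_nil.
move=> a x y /asboolP[r [hr ->]] /asboolP[r' [hr' ->]].
apply/asboolP; exists ([seq (a * p.1, p.2) | p <- r] ++ r'); split.
  by move=> p; rewrite mem_cat => /orP[/mapP[q /hr hq ->]|/hr'].
rewrite big_cat big_map scaler_sumr /=; congr (_ + _).
by apply: eq_bigr => p _; rewrite scalerA.
Qed.

Definition span : submodule V := Submodule span_closed.
End Span.

Definition ideal_gen (R : comNzRingType) (s : seq R) : submodule R^o :=
  span (fun x : R^o => x \in s).

Definition noetherian (R : comNzRingType) : Prop :=
  forall J : submodule R^o, exists s : seq R, J =i ideal_gen s.

(* Each term is a nonzerodivisor modulo the ideal generated by the previous
   ones, and the whole sequence generates a proper ideal. *)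
Definition regular_sequence (R : comNzRingType) (s : seq R) : Prop :=
  (forall i, (i < size s)%N -> forall x : R,
     s`_i * x \in ideal_gen (take i s) -> x \in ideal_gen (take i s))
  /\ 1 \notin ideal_gen s.

Section QuotientRing.
Variables (R : comNzRingType) (I : idealr R).

(* R/I as an R-module; the quotient ring itself is {ideal_quot I}. *)
Definition ideal_quot_mod := Quotient.quot I.
HB.instance Definition _ := GRing.Zmodule.on ideal_quot_mod.

Definition ideal_quot_scale (a : R) (q : ideal_quot_mod) : ideal_quot_mod :=
  (\pi_{ideal_quot I} a * (q : {ideal_quot I})).

Lemma ideal_quot_scaleA a b q :
  ideal_quot_scale a (ideal_quot_scale b q) = ideal_quot_scale (a * b) q.
Proof. by rewrite /ideal_quot_scale rmorphM mulrA. Qed.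

Lemma ideal_quot_scale1 : left_id 1 ideal_quot_scale.
Proof. by move=> q; rewrite /ideal_quot_scale rmorph1 mul1r. Qed.

Lemma ideal_quot_scaleDr : right_distributive ideal_quot_scale +%R.
Proof. by move=> a p q; rewrite /ideal_quot_scale mulrDr. Qed.

Lemma ideal_quot_scaleDl q : {morph ideal_quot_scale^~ q : a b / a + b}.
Proof. by move=> a b; rewrite /ideal_quot_scale rmorphD mulrDl. Qed.

HB.instance Definition _ := GRing.Zmodule_isLmodule.Build R ideal_quot_mod
  ideal_quot_scaleA ideal_quot_scale1 ideal_quot_scaleDr ideal_quot_scaleDl.

Definition annihilated (M : lmodType R) : Prop :=
  forall (a : R) (x : M), a \in (I : {pred R}) -> a *: x = 0.

Section AnnihilatedModule.
Variables (M : lmodType R) (IM : annihilated M).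

(* M with the R/I-module structure through which its R-module structure
   factors. *)
Definition over_quot of annihilated M : Type := M.
Local Notation M' := (over_quot IM).
HB.instance Definition _ := GRing.Zmodule.copy M' M.

Definition over_quot_scale (q : {ideal_quot I}) (x : M') : M' :=
  repr q *: (x : M).

Lemma over_quot_scaleE (a : R) (x : M) :
  over_quot_scale (\pi_{ideal_quot I} a) x = a *: x.
Proof.
apply/eqP; rewrite -subr_eq0 /over_quot_scale -scalerBl; apply/eqP/IM.
by rewrite Quotient.idealrBE; apply/eqP; rewrite reprK.
Qed.

Lemma over_quot_scaleA a b x :
  over_quot_scale a (over_quot_scale b x) = over_quot_scale (a * b) x.
Proof.
by rewrite -[a]reprK -[b]reprK -rmorphM !over_quot_scaleE scalerA.
Qed.

Lemma over_quot_scale1 : left_id 1 over_quot_scale.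
Proof.
by move=> x; rewrite -(rmorph1 \pi_{ideal_quot I}) over_quot_scaleE scale1r.
Qed.

Lemma over_quot_scaleDr : right_distributive over_quot_scale +%R.
Proof. by move=> a x y; rewrite /over_quot_scale; exact: scalerDr. Qed.

Lemma over_quot_scaleDl x : {morph over_quot_scale^~ x : a b / a + b}.
Proof.
move=> a b; rewrite -[a]reprK -[b]reprK -rmorphD !over_quot_scaleE.
exact: scalerDl.
Qed.

HB.instance Definition _ := GRing.Zmodule_isLmodule.Build {ideal_quot I} M'
  over_quot_scaleA over_quot_scale1 over_quot_scaleDr over_quot_scaleDl.
End AnnihilatedModule.
End QuotientRing.

Definition free_of_rank (S : comNzRingType) (M : lmodType S) (r : nat) : Prop :=
  exists f : {linear M -> 'rV[S]_r}, bijective f.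

Record chain_complex (R : comNzRingType) := ChainComplex {
  cc_obj :> nat -> lmodType R;
  cc_d : forall n, {linear cc_obj n.+1 -> cc_obj n};
  cc_dd : forall n (x : cc_obj n.+2), cc_d n (cc_d n.+1 x) = 0
}.

Section Homology.
Variables (R : comNzRingType) (C : chain_complex R).

Definition cycle_pred (n : nat) : {pred C n} :=
  match n return {pred C n} with
  | 0 => predT
  | m.+1 => [pred x | cc_d C m x == 0]
  end.

Lemma cycle_closed n : submod_closed (@cycle_pred n).
Proof.
case: n => [|n]; first by split.
split; first by rewrite inE raddf0.
by move=> a x y; rewrite !inE linearP => /eqP-> /eqP->; rewrite scaler0 addr0.
Qed.

Definition cycles n : submodule (C n) := Submodule (@cycle_closed n).

Definition boundary_pred n : {pred submod_type (cycles n)} :=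
  fun z => `[< exists y : C n.+1, cc_d C n y = val z >].

Lemma boundary_closed n : submod_closed (@boundary_pred n).
Proof.
split; first by apply/asboolP; exists 0; rewrite raddf0.
move=> a x y /asboolP[u hu] /asboolP[v hv].
by apply/asboolP; exists (a *: u + v); rewrite linearP hu hv.
Qed.

Definition boundaries n : submodule (submod_type (cycles n)) :=
  Submodule (@boundary_closed n).

Definition homology n : lmodType R := quot_mod (boundaries n).
End Homology.

Definition projective (R : comNzRingType) (P : lmodType R) : Prop :=
  forall (A B : lmodType R) (f : {linear A -> B}) (g : {linear P -> B}),
    (forall b, exists a, f a = b) ->
    exists h : {linear P -> A}, forall x, f (h x) = g x.

Definition projective_resolution (R : comNzRingType) (V : lmodType R)
    (P : chain_complex R) (e : {linear P 0 -> V}) : Prop :=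
  [/\ forall n, projective (P n),
      forall v, exists x, e x = v,
      forall x, e x = 0 <-> exists y, cc_d P 0 y = x
    & forall n x, cc_d P n x = 0 <-> exists y, cc_d P n.+1 y = x].

Definition simp (m n : nat) :=
  {f : {ffun 'I_m.+1 -> 'I_n.+1} |
     [forall i : 'I_m.+1, forall j : 'I_m.+1, (i <= j)%N ==> (f i <= f j)%N]}.

Definition simp_fun m n (f : simp m n) : 'I_m.+1 -> 'I_n.+1 := val f.
Coercion simp_fun : simp >-> Funclass.

Lemma simpP m n (f g : simp m n) : f =1 g -> f = g.
Proof. by move=> h; apply/val_inj/ffunP. Qed.

Lemma simp_mono m n (f : simp m n) (i j : 'I_m.+1) :
  (i <= j)%N -> (f i <= f j)%N.
Proof. by move: (valP f) => /forallP/(_ i)/forallP/(_ j)/implyP; apply. Qed.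

Section MkSimp.
Variables (m n : nat) (f : 'I_m.+1 -> 'I_n.+1).
Hypothesis f_mono : forall i j : 'I_m.+1, (i <= j)%N -> (f i <= f j)%N.

Lemma mk_simp_subproof :
  [forall i : 'I_m.+1, forall j : 'I_m.+1, (i <= j)%N ==> ([ffun x => f x] i <= [ffun x => f x] j)%N].
Proof.
by apply/forallP=> i; apply/forallP=> j; apply/implyP; rewrite !ffunE; exact: f_mono.
Qed.

Definition mk_simp : simp m n := Sub [ffun x => f x] mk_simp_subproof.

Lemma mk_simpE : mk_simp =1 f.
Proof. by move=> i; rewrite /simp_fun SubK ffunE. Qed.
End MkSimp.

Definition simp_id n : simp n n := @mk_simp n n id (fun i j h => h).

Definition simp_comp l m n (f : simp m n) (g : simp l m) : simp l n :=
  @mk_simp l n (fun i => f (g i)) (fun i j h => simp_mono f (simp_mono g h)).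

Lemma coface_subproof n (i : 'I_n.+2) (j k : 'I_n.+1) :
  (j <= k)%N -> (fintype.lift i j <= fintype.lift i k)%N.
Proof. by rewrite /= leq_bump2. Qed.

Definition coface n (i : 'I_n.+2) : simp n n.+1 :=
  mk_simp (@coface_subproof n i).

Lemma simp_idE n : simp_id n =1 id.
Proof. exact: mk_simpE. Qed.

Lemma simp_compE l m n (f : simp m n) (g : simp l m) i :
  simp_comp f g i = f (g i).
Proof. exact: mk_simpE. Qed.

Lemma cofaceE n (i : 'I_n.+2) : coface i =1 fintype.lift i.
Proof. exact: mk_simpE. Qed.

Lemma simp_compA k l m n (f : simp m n) (g : simp l m) (h : simp k l) :
  simp_comp f (simp_comp g h) = simp_comp (simp_comp f g) h.
Proof. by apply: simpP => i; rewrite !simp_compE. Qed.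

Lemma simp_comp1 m n (f : simp m n) : simp_comp f (simp_id m) = f.
Proof. by apply: simpP => i; rewrite simp_compE simp_idE. Qed.

Lemma simp_1comp m n (f : simp m n) : simp_comp (simp_id n) f = f.
Proof. by apply: simpP => i; rewrite simp_compE simp_idE. Qed.

Lemma coface_comm n (i : 'I_n.+3) (j : 'I_n.+2) (i' : 'I_n.+2) (j' : 'I_n.+3) :
  (i <= j)%N -> i' = i :> nat -> j' = j.+1 :> nat ->
  simp_comp (coface j') (coface i') = simp_comp (coface i) (coface j).
Proof.
move=> leij ei ej; apply: simpP => x; rewrite !simp_compE !cofaceE.
apply: val_inj; rewrite /= ei ej /bump.
by do 4!case: leqP => /= ? //; lia.
Qed.

Record simplicial_module (R : comNzRingType) := SimplicialModule {
  sm_obj :> nat -> lmodType R;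
  sm_map : forall m n, simp m n -> {linear sm_obj n -> sm_obj m};
  sm_id : forall n (x : sm_obj n), sm_map (simp_id n) x = x;
  sm_comp : forall l m n (f : simp m n) (g : simp l m) (x : sm_obj n),
    sm_map (simp_comp f g) x = sm_map g (sm_map f x)
}.

Section NormalizedComplex.
Variables (R : comNzRingType) (A : simplicial_module R).

Definition face n (i : 'I_n.+2) : {linear A n.+1 -> A n} := sm_map A (coface i).

(* N(A)_n is the intersection of the kernels of the faces d_i, i > 0, and the
   differential of N(A) is d_0. *)
Definition normalized_pred (n : nat) : {pred A n} :=
  match n return {pred A n} with
  | 0 => predT
  | m.+1 => [pred x | [forall i : 'I_m.+2, (0 < i)%N ==> (face i x == 0)]]
  end.

Lemma normalizedP n (x : A n.+1) :
  reflect (forall i : 'I_n.+2, (0 < i)%N -> face i x = 0)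
          (x \in @normalized_pred n.+1).
Proof.
apply: (iffP forallP) => h i; first by move=> i0; apply/eqP/(implyP (h i)).
by apply/implyP => i0; apply/eqP/h.
Qed.

Lemma normalized_closed n : submod_closed (@normalized_pred n).
Proof.
case: n => [|n]; first by split.
split; first by apply/normalizedP => i _; rewrite raddf0.
move=> a x y /normalizedP hx /normalizedP hy; apply/normalizedP => i i0.
by rewrite linearP hx // hy // scaler0 addr0.
Qed.

Definition normalized_sub n : submodule (A n) :=
  Submodule (@normalized_closed n).

Lemma face_face n (i j : 'I_n.+2) (i' : 'I_n.+2) (j' : 'I_n.+3) x :
  (i <= j)%N -> i' = i :> nat -> j' = j.+1 :> nat ->
  face i' (face j' x) = face j (face (inord i) x).
Proof.
move=> leij ei ej; rewrite /face -!sm_comp.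
by rewrite (@coface_comm _ (inord i) j i' j') // inordK // ltnS ltnW.
Qed.

Lemma normalized_face0 n (x : A n.+1) :
  x \in normalized_sub n.+1 -> face ord0 x \in normalized_sub n.
Proof.
case: n x => [//|n] x /normalizedP hx; apply/normalizedP => i i0.
have := @face_face n ord0 i ord0 (fintype.lift ord0 i) x isT erefl erefl.
rewrite (hx (fintype.lift ord0 i)) // raddf0.
by have -> : inord (@ord0 n.+1) = ord0 :> 'I_n.+3
  by apply: val_inj; rewrite /= inordK.
Qed.

Definition normalized_d n (x : submod_type (normalized_sub n.+1)) :
    submod_type (normalized_sub n) :=
  Sub (face ord0 (val x)) (normalized_face0 (valP x)).

Lemma normalized_d_linear n : linear (@normalized_d n).
Proof. by move=> a x y; apply: val_inj; rewrite /= linearP. Qed.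

HB.instance Definition _ n :=
  GRing.isLinear.Build R _ _ *:%R (@normalized_d n) (@normalized_d_linear n).

Lemma normalized_dd n (x : submod_type (normalized_sub n.+2)) :
  normalized_d (normalized_d x) = 0.
Proof.
apply: val_inj => /=.
have := @face_face n ord0 ord0 ord0 (fintype.lift ord0 ord0) (val x) isT erefl erefl.
have /normalizedP -> // := valP x; rewrite raddf0.
by have -> : inord (@ord0 n.+1) = ord0 :> 'I_n.+3
  by apply: val_inj; rewrite /= inordK.
Qed.

Definition normalized_complex : chain_complex R :=
  @ChainComplex R (fun n => submod_type (normalized_sub n))
    (fun n => @normalized_d n) normalized_dd.
End NormalizedComplex.

(* Gamma(C)_n is the module of chain maps N(R[Delta^n]) -> C, on which maps
   [m] -> [n] act by precomposition: by the Yoneda lemma this is the only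
   possible value of an inverse of the equivalence N.
   N(R[Delta^n]) is, in degree p, the free module on the p-simplices [p] -> [n]
   modulo the degenerate (that is, non-injective) ones, with the alternating
   sum of the faces as differential; under the isomorphism of the normalized
   complex with the quotient by degenerate simplices this differential is the
   d_0 used in normalized_complex.  So a chain map N(R[Delta^n]) -> C is a
   family of elements of C indexed by simplices which vanishes on the degenerate
   ones and is compatible with the differentials. *)
Section Gamma.
Variables (R : comNzRingType) (C : chain_complex R).

Definition simplex_family n := forall p, simp p n -> C p.

HB.instance Definition _ n := gen_eqMixin (simplex_family n).
HB.instance Definition _ n := gen_choiceMixin (simplex_family n).

Section Family.
Variable n : nat.
Implicit Types (c e : simplex_family n).

Definition family0 : simplex_family n := fun p s => 0.
Definition familyN c : simplex_family n := fun p s => - c p s.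
Definition familyD c e : simplex_family n := fun p s => c p s + e p s.
Definition familyZ (a : R) c : simplex_family n := fun p s => a *: c p s.

Lemma familyP c e : (forall p s, c p s = e p s) -> c = e.
Proof. by move=> h; apply: functional_extensionality_dep => p; apply: funext. Qed.

Lemma familyDA : associative familyD.
Proof. by move=> c e g; apply: familyP => p s; exact: addrA. Qed.
Lemma familyDC : commutative familyD.
Proof. by move=> c e; apply: familyP => p s; exact: addrC. Qed.
Lemma family0D : left_id family0 familyD.
Proof. by move=> c; apply: familyP => p s; exact: add0r. Qed.
Lemma familyND : left_inverse family0 familyN familyD.
Proof. by move=> c; apply: familyP => p s; exact: addNr. Qed.

HB.instance Definition _ := GRing.isZmodule.Build (simplex_family n)
  familyDA familyDC family0D familyND.

Lemma familyZA a b c : familyZ a (familyZ b c) = familyZ (a * b) c.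
Proof. by apply: familyP => p s; exact: scalerA. Qed.
Lemma familyZ1 : left_id 1 familyZ.
Proof. by move=> c; apply: familyP => p s; exact: scale1r. Qed.
Lemma familyZDr : right_distributive familyZ +%R.
Proof. by move=> a c e; apply: familyP => p s; exact: scalerDr. Qed.
Lemma familyZDl c : {morph familyZ^~ c : a b / a + b}.
Proof. by move=> a b; apply: familyP => p s; exact: scalerDl. Qed.

HB.instance Definition _ := GRing.Zmodule_isLmodule.Build R (simplex_family n)
  familyZA familyZ1 familyZDr familyZDl.

Definition is_chain_map c : Prop :=
  (forall p (s : simp p n), ~~ injectiveb s -> c p s = 0) /\
  (forall p (s : simp p.+1 n),
     cc_d C p (c p.+1 s) =
       \sum_(i < p.+2) (-1) ^+ i *: c p (simp_comp s (coface i))).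

Definition Gamma_pred : {pred simplex_family n} := fun c => `[< is_chain_map c >].

Lemma Gamma_closed : submod_closed Gamma_pred.
Proof.
split.
  apply/asboolP; split=> [//|p s]; rewrite raddf0 big1 // => i _.
  exact: scaler0.
move=> a c e /asboolP[c0 cd] /asboolP[e0 ed]; apply/asboolP.
have E p s : (a *: c + e) p s = a *: c p s + e p s by [].
split=> [p s ns|p s]; first by rewrite E c0 // e0 // scaler0 addr0.
rewrite E linearP cd ed scaler_sumr -big_split; apply: eq_bigr => i _ /=.
by rewrite E scalerDr !scalerA mulrC.
Qed.

Definition Gamma_sub : submodule (simplex_family n) := Submodule Gamma_closed.
End Family.

Definition Gamma_obj n : lmodType R := submod_type (Gamma_sub n).

Section GammaMap.
Variables (m n : nat) (f : simp m n).

Lemma Gamma_map_subproof (c : Gamma_obj n) :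
  ((fun p s => val c p (simp_comp f s)) : simplex_family m) \in Gamma_sub m.
Proof.
have /asboolP[c0 cd] := valP c; apply/asboolP; split=> p s.
  move=> ns; apply: c0; apply: contra ns => /injectiveP inj; apply/injectiveP.
  by move=> i j e; apply: inj; rewrite !simp_compE e.
by rewrite cd; apply: eq_bigr => i _; rewrite simp_compA.
Qed.

Definition Gamma_map (c : Gamma_obj n) : Gamma_obj m :=
  exist (fun c => c \in Gamma_sub m) _ (Gamma_map_subproof c).

Lemma Gamma_map_linear : linear Gamma_map.
Proof. by move=> a c e; apply: val_inj; apply: familyP. Qed.

HB.instance Definition _ :=
  GRing.isLinear.Build R _ _ *:%R Gamma_map Gamma_map_linear.
End GammaMap.

Lemma Gamma_map_id n (c : Gamma_obj n) : Gamma_map (simp_id n) c = c.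
Proof.
by apply: val_inj; apply: familyP => p s /=; rewrite simp_1comp.
Qed.

Lemma Gamma_map_comp l m n (f : simp m n) (g : simp l m) (c : Gamma_obj n) :
  Gamma_map (simp_comp f g) c = Gamma_map g (Gamma_map f c).
Proof.
by apply: val_inj; apply: familyP => p s /=; rewrite simp_compA.
Qed.

Definition Gamma : simplicial_module R :=
  @SimplicialModule R Gamma_obj (fun m n f => @Gamma_map m n f)
    Gamma_map_id Gamma_map_comp.
End Gamma.

Section SymmetricPower.
Variables (R : comNzRingType) (n : nat).

Section Object.
Variable M : lmodType R.

Definition subst_at (x : {ffun 'I_n -> M}) (i : 'I_n) (u : M) :
    {ffun 'I_n -> M} :=
  [ffun j => if j == i then u else x j].

Definition tensor_gen (x : {ffun 'I_n -> M}) : {freeg {ffun 'I_n -> M} / R} :=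
  << x >>.

Inductive Sym_relation : {freeg {ffun 'I_n -> M} / R} -> Prop :=
| Sym_relation_linear (x : {ffun 'I_n -> M}) i a u v :
    Sym_relation (tensor_gen (subst_at x i (a *: u + v))
                  - (a *: tensor_gen (subst_at x i u)
                     + tensor_gen (subst_at x i v)))
| Sym_relation_perm (x : {ffun 'I_n -> M}) (s : 'S_n) :
    Sym_relation (tensor_gen [ffun j => x (s j)] - tensor_gen x).

Definition Sym : lmodType R := quot_mod (span Sym_relation).
End Object.

Section Map.
Variables (M M' : lmodType R) (f : {linear M -> M'}).

Definition tensor_map (t : {freeg {ffun 'I_n -> M} / R}) :
    {freeg {ffun 'I_n -> M'} / R} :=
  fglift (fun x : {ffun 'I_n -> M} => tensor_gen [ffun i => f (x i)]) t.

Lemma tensor_map_gen (x : {ffun 'I_n -> M}) : tensor_map (tensor_gen x) = tensor_gen [ffun i => f (x i)].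
Proof. by rewrite /tensor_map liftU scale1r. Qed.

Lemma tensor_mapE t :
  tensor_map t = \sum_(x <- dom t) coeff x t *: tensor_gen [ffun i => f (x i)].
Proof.
rewrite -{1}(Freeg_dom t) /tensor_map fglift_Freeg /prelift big_map.
by apply: eq_bigr.
Qed.

Lemma tensor_map_linear : linear tensor_map.
Proof.
have hB : zmod_morphism tensor_map.
  by move=> u v; apply: (lift_is_additive (fun x : {ffun 'I_n -> M} => tensor_gen [ffun i => f (x i)])).
pose g : {additive _ -> _} :=
  HB.pack tensor_map (GRing.isZmodMorphism.Build _ _ tensor_map hB).
have gZ a t : g (a *: t) = a *: g t.
  rewrite -[t]freeg_sumE scaler_sumr !raddf_sum.
  apply: eq_bigr => x _.
  have -> : a *: << coeff x t *g x >> = << a * coeff x t *g x >>.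
    by apply/eqP/freeg_eqP => y; rewrite coeffZ !coeffU mulrA.
  by rewrite /= /tensor_map !liftU scalerA.
move=> a u v; rewrite -[tensor_map]/(g : _ -> _).
by rewrite raddfD gZ.
Qed.

HB.instance Definition _ :=
  GRing.isLinear.Build R _ _ *:%R tensor_map tensor_map_linear.

Lemma Sym_relation_map t : Sym_relation t -> Sym_relation (tensor_map t).
Proof.
have E x i u : [ffun j => f (subst_at x i u j)] =
               subst_at [ffun j => f (x j)] i (f u).
  by apply/ffunP => j; rewrite !ffunE; case: ifP.
case=> [x i a u v|x s].
  rewrite raddfB /= tensor_map_linear !tensor_map_gen.
  by rewrite !E linearP; constructor.
rewrite raddfB /= !tensor_map_gen.
have -> : [ffun i => f ([ffun j => x (s j)] i)] =
          [ffun j => [ffun i => f (x i)] (s j)].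
  by apply/ffunP => j; rewrite !ffunE.
by constructor.
Qed.

Lemma tensor_map_span t :
  t \in span (@Sym_relation M) -> tensor_map t \in span (@Sym_relation M').
Proof.
move=> /asboolP[r [hr ->]]; apply/asboolP.
exists [seq (p.1, tensor_map p.2) | p <- r]; split.
  by move=> p /mapP[q /hr hq ->] /=; apply: Sym_relation_map.
by rewrite big_map raddf_sum; apply: eq_bigr => p _; rewrite /= (linearZ_LR (tensor_map : {linear _ -> _})).
Qed.

Definition Sym_map (q : Sym M) : Sym M' :=
  quot_pi (span (@Sym_relation M')) (tensor_map (repr (q : quot_mod _))).

Lemma Sym_map_pi t :
  Sym_map (quot_pi (span (@Sym_relation M)) t) =
  quot_pi (span (@Sym_relation M')) (tensor_map t).
Proof.
apply/quot_pi_eq; rewrite -raddfB; apply: tensor_map_span.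
by apply/quot_pi_eq; rewrite quot_piK.
Qed.

Lemma Sym_map_linear : linear Sym_map.
Proof.
move=> a p q; rewrite -[p]quot_piK -[q]quot_piK -linearP !Sym_map_pi.
by rewrite !linearP.
Qed.

HB.instance Definition _ :=
  GRing.isLinear.Build R _ _ *:%R Sym_map Sym_map_linear.
End Map.

Definition sym_prod (M : lmodType R) (x : {ffun 'I_n -> M}) : Sym M :=
  quot_pi (span (@Sym_relation M)) (tensor_gen x).

Lemma Sym_map_prod (M M' : lmodType R) (f : {linear M -> M'})
    (x : {ffun 'I_n -> M}) :
  Sym_map f (sym_prod x) = sym_prod [ffun i => f (x i)].
Proof. by rewrite [LHS]Sym_map_pi tensor_map_gen. Qed.

Lemma Sym_gen (M : lmodType R) (q : Sym M) :
  exists t : {freeg {ffun 'I_n -> M} / R},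
    q = \sum_(x <- dom t) coeff x t *: sym_prod x.
Proof.
exists (repr (q : quot_mod _)); set t := repr _.
rewrite -{1}[q]quot_piK -/t -{1}(freeg_sumE t) raddf_sum.
apply: eq_bigr => x _; rewrite -quot_piZ; congr (quot_pi _ _).
by apply/eqP/freeg_eqP => y; rewrite coeffZ !coeffU mul1r.
Qed.

Lemma Sym_ext (M W : lmodType R) (g h : {linear Sym M -> W}) :
  (forall x, g (sym_prod x) = h (sym_prod x)) -> g =1 h.
Proof.
move=> gh q; have [t ->] := Sym_gen q; rewrite !raddf_sum.
by apply: eq_bigr => x _; rewrite /= !linearZ_LR gh.
Qed.

Section Simplicial.
Variable A : simplicial_module R.

Lemma Sym_simplicial_id k (x : Sym (A k)) : Sym_map (sm_map A (simp_id k)) x = x.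
Proof.
apply: (Sym_ext (g := Sym_map (sm_map A (simp_id k))) (h := idfun)) => y /=.
rewrite Sym_map_prod; congr (sym_prod _).
by apply/ffunP => i; rewrite ffunE sm_id.
Qed.

Lemma Sym_simplicial_comp l m k (f : simp m k) (g : simp l m) (x : Sym (A k)) :
  Sym_map (sm_map A (simp_comp f g)) x =
  Sym_map (sm_map A g) (Sym_map (sm_map A f) x).
Proof.
apply: (Sym_ext (g := Sym_map (sm_map A (simp_comp f g)))
  (h := Sym_map (sm_map A g) \o Sym_map (sm_map A f))) => y /=.
rewrite !Sym_map_prod; congr (sym_prod _).
by apply/ffunP => i; rewrite !ffunE sm_comp.
Qed.

Definition Sym_simplicial : simplicial_module R :=
  @SimplicialModule R (fun k => Sym (A k)) (fun l m f => Sym_map (sm_map A f))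
    Sym_simplicial_id Sym_simplicial_comp.
End Simplicial.
End SymmetricPower.

Definition derived_Sym3 (R : comNzRingType) (P : chain_complex R) (k : nat) :
    lmodType R :=
  homology (normalized_complex (Sym_simplicial 3 (Gamma P))) k.

(* Main.v *)
(* Up to homotopy one may replace P by the Koszul complex K of the regular
   sequence f, g: chain homotopies become simplicial homotopies under Gamma, any
   functor preserves these, and N turns them into chain homotopies again.
   The degeneracies carry a basis of Gamma(K)_n into one of Gamma(K)_(n+1), so N Sym^3 Gamma(K)
   is free on the nondegenerate cubic monomials in this basis; there are 1, 9,
   37, 81, 97, 60 and 15 of them in degrees 0 to 6 and none above.  An acyclic
   matching of these monomials, defined over Z[f, g], contracts the complex onto
   K + K[2] + K[4], whose homology is R/(f, g) in degrees 0, 2 and 4. *)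
From HB Require Import structures.
From mathcomp Require Import all_boot all_order all_algebra.
From mathcomp Require Import perm generic_quotient boolp zify ring.
From mathcomp Require Import freeg.
Require Import Defs.

Set Implicit Arguments.
Unset Strict Implicit.
Unset Printing Implicit Defensive.

Import GRing.Theory.
Local Open Scope ring_scope.
Local Open Scope quotient_scope.

(** The derived functor is built from intersections of kernels and from quotients of free modules on
    triples, so no basis is at hand; much of the work supplies one that can be computed with.
    Pulling back the generators of [koszul] along surjections onto [1] and [2] gives a basis of
    Gamma(K)_n on which faces and degeneracies merely shift thresholds, up to reductions at the
    extreme thresholds. The projector [normalize] identifies the complex of kernels with the
    quotient by degenerate monomials. The contraction then consists of tables with coefficients in
    Z[f, g]. The matching only produces these tables: its acyclicity is not argued, and instead the
    identities of the contraction are checked by computation in degrees 0 to 6 and then evaluated in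
    R. Regularity of f, g enters at the two ends: it makes [koszul] a resolution, and it gives the
    homology of K + K[2] + K[4]. *)

Definition linear_of (R : comNzRingType) (U V : lmodType R) (f : U -> V)
    (fL : linear f) : {linear U -> V} :=
  HB.pack f (GRing.isLinear.Build R U V *:%R f fL).

(** * Homotopies of chain maps *)

Record chain_map (R : comNzRingType) (C D : chain_complex R) := ChainMap {
  cm_fun :> forall n, {linear C n -> D n};
  cm_d : forall n x, cm_fun n (cc_d C n x) = cc_d D n (cm_fun n.+1 x)
}.

Section ChainHomotopy.
Variable R : comNzRingType.
Implicit Types C D E : chain_complex R.

Definition cm_id C : chain_map C C :=
  @ChainMap R C C (fun n => idfun) (fun n x => erefl).

Lemma cm_comp_subproof C D E (g : chain_map D E) (f : chain_map C D) n x :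
  (g n \o f n) (cc_d C n x) = cc_d E n ((g n.+1 \o f n.+1) x).
Proof. by rewrite /= !cm_d. Qed.

Definition cm_comp C D E (g : chain_map D E) (f : chain_map C D) :
    chain_map C E :=
  @ChainMap R C E (fun n => g n \o f n) (cm_comp_subproof g f).

Definition homotopy C D (f g : chain_map C D)
    (h : forall n, {linear C n -> D n.+1}) : Prop :=
  (forall x, g 0 x - f 0 x = cc_d D 0 (h 0 x)) /\
  (forall n x, g n.+1 x - f n.+1 x = cc_d D n.+1 (h n.+1 x) + h n (cc_d C n x)).

Definition homotopic C D (f g : chain_map C D) : Prop :=
  exists h, homotopy f g h.

Definition homotopy_equivalent C D : Prop :=
  exists (f : chain_map C D) (g : chain_map D C),
    homotopic (cm_id C) (cm_comp g f) /\ homotopic (cm_id D) (cm_comp f g).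

Lemma cycleS C n (x : C n.+1) : (x \in cycles C n.+1) = (cc_d C n x == 0).
Proof. by []. Qed.

Lemma homotopic_boundary C D (f g : chain_map C D) n (x : C n) :
  homotopic f g -> x \in cycles C n ->
  exists y, cc_d D n y = g n x - f n x.
Proof.
move=> [h [h0 hS]]; case: n x => [|n] x; first by exists (h 0 x); rewrite h0.
by rewrite cycleS => /eqP dx; exists (h n.+1 x); rewrite hS dx raddf0 addr0.
Qed.

Lemma cm_cycle C D (f : chain_map C D) n (x : C n) :
  x \in cycles C n -> f n x \in cycles D n.
Proof.
by case: n x => [//|n] x; rewrite !cycleS -cm_d => /eqP->; rewrite raddf0.
Qed.

Definition hclass C n (x : C n) (xc : x \in cycles C n) : homology C n :=
  quot_pi (boundaries C n) (Sub x xc).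

Lemma hclass_repr C n (q : homology C n) :
  exists (x : C n) (xc : x \in cycles C n), q = hclass xc.
Proof.
exists (val (repr (q : quot_mod _))), (valP (repr (q : quot_mod _))).
by rewrite -[LHS]quot_piK; congr (quot_pi _ _); apply: val_inj.
Qed.

Lemma hclass_eq C n (x y : C n) (xc : x \in cycles C n) (yc : y \in cycles C n) :
  (hclass xc = hclass yc) <-> exists z, cc_d C n z = x - y.
Proof.
split=> [/quot_pi_eq/asboolP//|h].
by apply/quot_pi_eq/asboolP.
Qed.

Lemma hclass_linear C n a (x y : C n) (xc : x \in cycles C n)
    (yc : y \in cycles C n) (c : a *: x + y \in cycles C n) :
  a *: hclass xc + hclass yc = hclass c.
Proof. by rewrite -linearP; congr (quot_pi _ _); apply: val_inj. Qed.

Section LinearOnHomology.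
Variables (C : chain_complex R) (n : nat) (W : lmodType R).
Variable f : forall x : C n, x \in cycles C n -> W.
Hypothesis f_lin : forall a x y xc yc c,
  @f (a *: x + y) c = a *: @f x xc + @f y yc.
Hypothesis f_boundary : forall x xc, (exists y, cc_d C n y = x) -> @f x xc = 0.

(** The function [f] takes the proof that its argument is a cycle, so a formula valid on cycles
    descends to homology without an intermediate map on the subtype. *)
Definition homology_lift (q : homology C n) : W :=
  f (valP (repr (q : quot_mod (boundaries C n)))).

Lemma homology_liftE x (xc : x \in cycles C n) :
  homology_lift (hclass xc) = f xc.
Proof.
rewrite /homology_lift; set z := repr _.
have zE : hclass (valP z) = hclass xc.
  by rewrite -[RHS]quot_piK; congr (quot_pi _ _); apply: val_inj.
have [y yE] := (hclass_eq _ _).1 zE.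
have dc : val z - x \in cycles C n by rewrite rpredB ?(valP z).
have c : 1 *: (val z - x) + x \in cycles C n by rewrite scale1r subrK (valP z).
have := f_lin dc xc c; rewrite (f_boundary dc) ?scaler0 ?add0r; last by exists y.
move=> <-; have E : 1 *: (val z - x) + x = val z by rewrite scale1r subrK.
by move: (valP z) c; rewrite E => c c'; rewrite (bool_irrelevance c c').
Qed.

Lemma homology_lift_linear : linear homology_lift.
Proof.
move=> a p q; have [x [xc ->]] := hclass_repr p; have [y [yc ->]] := hclass_repr q.
have c : a *: x + y \in cycles C n by rewrite rpredD // rpredZ.
by rewrite (hclass_linear _ _ c) !homology_liftE.
Qed.
End LinearOnHomology.

(** On cycles the term hd vanishes, so homotopic maps differ by boundaries, and the two composites
    become identities on homology. *)
Lemma homotopy_equivalent_homology C D n : homotopy_equivalent C D ->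
  exists f : {linear homology C n -> homology D n}, bijective f.
Proof.
have mapP (A B : chain_complex R) (f : chain_map A B) : exists hf : {linear
  homology A n -> homology B n},
    forall x (xc : x \in cycles A n), hf (hclass xc) = hclass (cm_cycle f xc).
  pose F x (xc : x \in cycles A n) : homology B n := hclass (cm_cycle f xc).
  have F_lin a x y xc yc c : F (a *: x + y) c = a *: F x xc + F y yc.
    have c' : a *: f n x + f n y \in cycles B n by rewrite -linearP cm_cycle.
    by rewrite (hclass_linear _ _ c'); apply/hclass_eq; exists 0;
      rewrite raddf0 linearP subrr.
  have F_bd x xc : (exists y, cc_d A n y = x) -> F x xc = 0.
    move=> [y yE]; have c0 : 0 \in cycles B n by apply: rpred0.
    have -> : (0 : homology B n) = hclass c0.
      by rewrite -[LHS](raddf0 (quot_pi (boundaries B n))); congr (quot_pi _ _);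
        apply: val_inj.
    by apply/hclass_eq; exists (f n.+1 y); rewrite -cm_d yE subr0.
  exists (linear_of (homology_lift_linear F_lin F_bd)) => x xc.
  exact: (homology_liftE F_lin F_bd).
move=> [f [g [gf fg]]]; have [hf hfE] := mapP _ _ f; have [hg hgE] := mapP _ _ g.
exists hf; exists hg => q; have [x [xc ->]] := hclass_repr q.
  by rewrite hfE hgE; apply/hclass_eq; apply: homotopic_boundary gf xc.
by rewrite hgE hfE; apply/hclass_eq; apply: homotopic_boundary fg xc.
Qed.

End ChainHomotopy.

(** * Comparison of projective resolutions *)

Section ProjectiveLift.
Variables (R : comNzRingType) (P A B : lmodType R).
Variables (f : {linear A -> B}) (g : {linear P -> B}).

Definition image_pred : {pred B} := fun b => `[< exists a, f a = b >].

Lemma image_closed : submod_closed image_pred.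
Proof.
split; first by apply/asboolP; exists 0; rewrite raddf0.
move=> c x y /asboolP[u <-] /asboolP[v <-]; apply/asboolP.
by exists (c *: u + v); rewrite linearP.
Qed.

Definition image_sub : submodule B := Submodule image_closed.

(** Projectivity is stated for surjections; corestricting both maps to the image of [f] reduces to
    that case. *)
Lemma projective_lift : projective P -> (forall x, exists a, f a = g x) ->
  exists h : {linear P -> A}, forall x, f (h x) = g x.
Proof.
move=> projP fg.
have f_im a : f a \in image_sub by apply/asboolP; exists a.
have g_im x : g x \in image_sub by apply/asboolP; apply: fg.
pose f1 a : submod_type image_sub := Sub (f a) (f_im a).
pose g1 x : submod_type image_sub := Sub (g x) (g_im x).
have f1L : linear f1 by move=> c x y; apply: val_inj; rewrite /= linearP.
have g1L : linear g1 by move=> c x y; apply: val_inj; rewrite /= linearP.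
have [|h hE] := projP _ _ (linear_of f1L) (linear_of g1L).
  by move=> b; have /asboolP[a aE] := valP b; exists a; apply: val_inj.
by exists h => x; have := congr1 val (hE x).
Qed.
End ProjectiveLift.

(** Serves to build chain maps and homotopies degree by degree: the type [S n] stores the invariant
    that makes the next step possible, and [rel] the compatibility of consecutive steps. *)
Lemma dependent_choice (S : nat -> Type) (rel : forall n, S n -> S n.+1 -> Prop)
    (s0 : S 0%N) : (forall n s, exists s', rel n s s') ->
  exists u : forall n, S n, u 0%N = s0 /\ forall n, rel n (u n) (u n.+1).
Proof.
move=> step; pose next n s := projT1 (cid (step n s)).
pose u := nat_rect S s0 next.
by exists u; split=> // n; exact: (projT2 (cid (step n (u n)))).
Qed.

Section Comparison.
Variables (R : comNzRingType) (V : lmodType R) (P Q : chain_complex R).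
Variables (e : {linear P 0%N -> V}) (e' : {linear Q 0%N -> V}).
Hypotheses (resP : projective_resolution e) (resQ : projective_resolution e').

(** In degree 0 the augmentation plays the role of the differential, which makes exactness uniform
    in the degree. *)
Definition augmented_cycle (C : chain_complex R) (a : {linear C 0%N -> V}) n :
    C n -> Prop :=
  match n return C n -> Prop with
  | 0 => fun x => a x = 0
  | m.+1 => fun x => cc_d C m x = 0
  end.

Lemma augmented_cycleP (C : chain_complex R) (a : {linear C 0%N -> V}) n (x : C n) :
  projective_resolution a -> augmented_cycle a x <-> exists y, cc_d C n y = x.
Proof. by case: n x => [|n] x [_ _ h0 hS]; [apply: h0 | apply: hS]. Qed.

Lemma comparison_map : exists f : chain_map P Q, forall x, e' (f 0%N x) = e x.
Proof.
have [projP _ _ _] := resP; have [_ e'_surj _ _] := resQ.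
have [f0 f0E] := projective_lift (projP 0%N) (fun x => e'_surj (e x)).
(* Invariant: cycles go to cycles. By exactness of [Q] it puts f (d x) in the image of the next
   differential, so the next lift exists. *)
pose good n (f : {linear P n -> Q n}) :=
  forall x, augmented_cycle e x -> augmented_cycle e' (f x).
have good0 : good 0%N f0 by move=> x /= ex; rewrite f0E.
pose S n := {f : {linear P n -> Q n} | good n f}.
pose rel n (s : S n) (s' : S n.+1) :=
  forall x, sval s (cc_d P n x) = cc_d Q n (sval s' x).
have [n [f gf]|u [u0 uS]] := @dependent_choice S rel (exist _ f0 good0).
  have [x|f' f'E] := @projective_lift _ _ _ _ (cc_d Q n) (f \o cc_d P n) (projP
    n.+1).
    by apply/(augmented_cycleP _ resQ)/gf/(augmented_cycleP _ resP); exists x.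
  have gf' : good n.+1 f' by move=> x /= dx; rewrite f'E /= dx raddf0.
  by exists (exist _ f' gf') => x; rewrite [RHS]f'E.
exists (@ChainMap R P Q (fun n => sval (u n)) uS) => x /=.
by rewrite u0 f0E.
Qed.

Lemma comparison_homotopic (f g : chain_map P Q) :
  (forall x, e' (f 0%N x) = e' (g 0%N x)) -> homotopic f g.
Proof.
move=> fg; have [projP _ _ _] := resP.
have [x|h0 h0E] := @projective_lift _ _ _ _ (cc_d Q 0) (g 0%N \- f 0%N) (projP 0%N).
  by apply/(augmented_cycleP _ resQ); rewrite /= raddfB /= fg subrr.
(* The defect g - f - hd has to be a cycle, hence a boundary, for [h] to extend by one degree. *)
pose good n (h : {linear P n -> Q n.+1}) :=
  forall x, cc_d Q n (g n.+1 x - f n.+1 x - h (cc_d P n x)) = 0.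
have good0 : good 0%N h0.
  by move=> x; rewrite !raddfB /= h0E -!cm_d subrr.
pose S n := {h : {linear P n -> Q n.+1} | good n h}.
pose rel n (s : S n) (s' : S n.+1) :=
  forall x, g n.+1 x - f n.+1 x = cc_d Q n.+1 (sval s' x) + sval s (cc_d P n x).
have [n [h gh]|u [u0 uS]] := @dependent_choice S rel (exist _ h0 good0).
  have [x|h' h'E] := @projective_lift _ _ _ _ (cc_d Q n.+1)
      ((g n.+1 \- f n.+1) \- (h \o cc_d P n)) (projP n.+1).
    exact/(augmented_cycleP (n := n.+1) _ resQ)/gh.
  have gh' : good n.+1 h'.
    by move=> x; rewrite !raddfB /= h'E -!cm_d /= cc_dd raddf0 subr0 subrr.
  by exists (exist _ h' gh') => x; rewrite /= h'E /= subrK.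
exists (fun n => sval (u n)); split=> //.
by move=> x; rewrite u0 h0E.
Qed.
End Comparison.

Lemma resolution_homotopy_equivalent (R : comNzRingType) (V : lmodType R)
    (P Q : chain_complex R) (e : {linear P 0%N -> V}) (e' : {linear Q 0%N -> V}) :
  projective_resolution e -> projective_resolution e' -> homotopy_equivalent P Q.
Proof.
move=> resP resQ; have [f fE] := comparison_map resP resQ.
have [g gE] := comparison_map resQ resP; exists f, g; split.
  by apply: (comparison_homotopic resP resP) => x; rewrite /= gE fE.
by apply: (comparison_homotopic resQ resQ) => x; rewrite /= fE gE.
Qed.

(** * Simplicial homotopies *)

Record simplicial_map (R : comNzRingType) (A B : simplicial_module R) :=
  SimplicialMap {
    sl_fun :> forall n, {linear A n -> B n};
    sl_nat : forall m n (t : simp m n) x,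
      sl_fun m (sm_map A t x) = sm_map B t (sl_fun n x)
  }.

(* A map A x Delta^1 -> B, given as a family of maps indexed by the simplices
   of Delta^1. *)
Definition simplicial_homotopy (R : comNzRingType) (A B : simplicial_module R)
    (H : forall n, simp n 1 -> {linear A n -> B n}) : Prop :=
  forall m n (t : simp m n) (u : simp n 1) x,
    sm_map B t (H n u x) = H m (simp_comp u t) (sm_map A t x).

Definition simplicially_homotopic (R : comNzRingType) (A B : simplicial_module R)
    (f g : simplicial_map A B) : Prop :=
  exists H, [/\ @simplicial_homotopy R A B H,
    forall n (u : simp n 1) x, (forall i, u i = 0%N :> nat) -> H n u x = f n x &
    forall n (u : simp n 1) x, (forall i, u i = 1%N :> nat) -> H n u x = g n x].

Lemma codegen_subproof n (i : 'I_n.+1) (j k : 'I_n.+2) : (j <= k)%N ->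
  ((inord (unbump i j) : 'I_n.+1) <= (inord (unbump i k) : 'I_n.+1))%N.
Proof.
move=> jk; have ? := ltn_ord i; have ? := ltn_ord j; have ? := ltn_ord k.
by rewrite !inordK /unbump; do 2?case: ltnP => /=; lia.
Qed.

Definition codegen n (i : 'I_n.+1) : simp n.+1 n := mk_simp (@codegen_subproof n i).

Lemma codegenE n (i : 'I_n.+1) (k : 'I_n.+2) :
  codegen i k = (k - (i < k))%N :> nat.
Proof.
rewrite mk_simpE inordK // /unbump.
by have ? := ltn_ord i; have ? := ltn_ord k; case: ltnP => /=; lia.
Qed.

Lemma cut_subproof n (k : nat) (i j : 'I_n.+1) : (i <= j)%N ->
  ((inord (k <= i)%N : 'I_2) <= (inord (k <= j)%N : 'I_2))%N.
Proof. by move=> ij; rewrite !inordK; do 2?case: leqP => /=; lia. Qed.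

(** Every n-simplex of Delta^1 has this form; k = 0 and k > n give the two constant ones. *)
Definition cut n (k : nat) : simp n 1 := mk_simp (@cut_subproof n k).

Lemma cutE n k (i : 'I_n.+1) : cut n k i = (k <= i)%N :> nat.
Proof. by rewrite mk_simpE inordK //; case: (k <= i)%N. Qed.

Lemma codegen_cofaceK n (i : 'I_n.+1) (j : 'I_n.+2) :
  (j == i :> nat) || (j == i.+1 :> nat) ->
  simp_comp (codegen i) (coface j) = simp_id n.
Proof.
move=> h; apply: simpP => k; apply: ord_inj.
rewrite simp_compE codegenE cofaceE simp_idE /= /bump; move: h.
by case: (leqP j k) => ? /=; case: ltnP => ? /=; lia.
Qed.

Lemma codegen_coface_lt n (i : 'I_n.+2) (j : 'I_n.+3) (i' : 'I_n.+1) (j' :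
  'I_n.+2) :
  (j < i)%N -> i = i'.+1 :> nat -> j' = j :> nat ->
  simp_comp (codegen i) (coface j) = simp_comp (coface j') (codegen i').
Proof.
move=> ji ei ej; apply: simpP => k; apply: ord_inj.
rewrite !simp_compE codegenE !cofaceE /= codegenE /bump ei ej.
by case: (leqP j k) => ? /=; do 2!case: ltnP => ? /=; try case: leqP => ? /=; lia.
Qed.

Lemma codegen_coface_gt n (i : 'I_n.+2) (j : 'I_n.+3) (i' : 'I_n.+1) (j' :
  'I_n.+2) :
  (i.+1 < j)%N -> i' = i :> nat -> j = j'.+1 :> nat ->
  simp_comp (codegen i) (coface j) = simp_comp (coface j') (codegen i').
Proof.
move=> ji ei ej; apply: simpP => k; apply: ord_inj.
rewrite !simp_compE codegenE !cofaceE /= codegenE /bump ei ej.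
by case: (leqP j'.+1 k) => /=; do 2!case: ltnP => /=; try case: leqP => /=; lia.
Qed.

Lemma cut_coface_le n (k : nat) (j : 'I_n.+2) : (j <= k)%N ->
  simp_comp (cut n.+1 k.+1) (coface j) = cut n k.
Proof.
move=> jk; apply: simpP => i; apply: ord_inj.
rewrite simp_compE !cutE cofaceE /= /bump.
by case: (leqP j i) => /=; do 2!case: leqP => /=; lia.
Qed.

Lemma cut_coface_gt n (k : nat) (j : 'I_n.+2) : (k <= j)%N ->
  simp_comp (cut n.+1 k) (coface j) = cut n k.
Proof.
move=> jk; apply: simpP => i; apply: ord_inj.
rewrite simp_compE !cutE cofaceE /= /bump.
by case: (leqP j i) => /=; do 2!case: leqP => /=; lia.
Qed.

Section Normalization.
Variables (R : comNzRingType) (A B : simplicial_module R).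

Definition sdeg (C : simplicial_module R) n (i : 'I_n.+1) : {linear C n -> C
  n.+1} :=
  sm_map C (codegen i).

Lemma sl_normalized (f : simplicial_map A B) n (x : A n) :
  x \in normalized_sub A n -> f n x \in normalized_sub B n.
Proof.
case: n x => [//|n] x /normalizedP h; apply/normalizedP => i i0.
by rewrite /face -sl_nat [sm_map _ _ _]h // raddf0.
Qed.

Definition normalized_fun (f : simplicial_map A B) n
    (x : submod_type (normalized_sub A n)) : submod_type (normalized_sub B n) :=
  Sub (f n (val x)) (sl_normalized f (valP x)).

Lemma normalized_fun_linear f n : linear (@normalized_fun f n).
Proof. by move=> a x y; apply: val_inj; rewrite /= linearP. Qed.

Lemma normalized_fun_d f n (x : normalized_complex A n.+1) :
  linear_of (@normalized_fun_linear f n) (cc_d _ n x) =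
  cc_d (normalized_complex B) n (linear_of (@normalized_fun_linear f n.+1) x).
Proof. by apply: val_inj; rewrite /= /face -sl_nat. Qed.

Definition normalized_map (f : simplicial_map A B) :
    chain_map (normalized_complex A) (normalized_complex B) :=
  @ChainMap R (normalized_complex A) (normalized_complex B)
    (fun n => linear_of (@normalized_fun_linear f n)) (@normalized_fun_d f).

Section NormalizedHomotopy.
Variable D : forall n, simp n 1 -> {linear A n -> B n}.
Hypothesis D_nat : simplicial_homotopy D.
Hypothesis D0 : forall n (u : simp n 1) x, (forall i, u i = 0%N :> nat) -> D u x
  = 0 :> B n.

(** The classical prism operator: the i-th term belongs to the i-th nondegenerate top simplex of
    Delta^n x Delta^1, the pair of the degeneracy s_i and the map to [1] that jumps at i + 1. *)
Definition prism n (x : A n) : B n.+1 :=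
  \sum_(i < n.+1) (-1) ^+ i *: D (cut n.+1 i.+1) (sdeg A i x).

Lemma prism_linear n : linear (@prism n).
Proof.
move=> a x y; rewrite /prism scaler_sumr -big_split; apply: eq_bigr => i _ /=.
by rewrite 2!linearP /= scalerDr !scalerA mulrC.
Qed.

Lemma face_prism n (j : 'I_n.+2) (x : A n) (i : 'I_n.+1) :
  face B j (D (cut n.+1 i.+1) (sdeg A i x)) =
  D (cut n (if (j <= i)%N then i : nat else i.+1))
    (sm_map A (simp_comp (codegen i) (coface j)) x).
Proof.
rewrite [LHS]D_nat /sdeg -sm_comp.
by case: (leqP j i) => h; [rewrite cut_coface_le | rewrite cut_coface_gt].
Qed.

Lemma cut_big n (x : A n) k : (n < k)%N -> D (cut n k) x = 0.
Proof.
by move=> nk; apply: D0 => i; rewrite cutE; have := ltn_ord i; case: leqP => /=;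
  lia.
Qed.

(** Terms with i other than j - 1 and j contain a positive face of [x] and vanish; these two have
    the same value with opposite signs. For j = n + 1 only i = j - 1 occurs, and its value is [D] at
    the constant 0 simplex, hence zero. *)
Lemma face_prism_gt0 n (x : A n) (j : 'I_n.+2) :
  x \in normalized_sub A n -> (0 < j)%N -> face B j (prism x) = 0.
Proof.
move=> xN j0; rewrite raddf_sum /=.
have termE (i : 'I_n.+1) : face B j ((-1) ^+ i *: D (cut n.+1 i.+1) (sdeg A i x)) =
    (if i == j :> nat then (-1) ^+ j *: D (cut n j) x else 0) -
    (if i == j.-1 :> nat then (-1) ^+ j *: D (cut n j) x else 0).
  rewrite linearZ /= face_prism; have [ij|ij|ij] := ltngtP i j.
  - case: (eqVneq (i : nat) j.-1) => [ei|ni].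
      rewrite codegen_cofaceK ?sm_id; last by apply/orP; right; apply/eqP; lia.
      have -> : j = i.+1 :> nat by lia.
      by rewrite sub0r exprS mulN1r scaleNr opprK.
    rewrite subr0; case: n x xN j j0 i ij ni => [|n] x xN j j0 i ij ni.
      by have := ltn_ord j; have := ltn_ord i; lia.
    have jj : (j.-1 < n.+2)%N by have := ltn_ord j; lia.
    have ii : (i < n.+1)%N by have := ltn_ord j; lia.
    rewrite (@codegen_coface_gt _ i j (Ordinal ii) (Ordinal jj)) //=; try lia.
    rewrite sm_comp; have /normalizedP/(_ (Ordinal jj)) xN' := xN.
    by rewrite [sm_map _ (coface _) _]xN' ?raddf0 ?scaler0 //=; lia.
  - case: (eqVneq (i : nat) j.-1) => [ei|ni]; first by lia.
    rewrite subr0; case: n x xN j j0 i ij ni => [|n] x xN j j0 i ij ni.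
      by have := ltn_ord j; have := ltn_ord i; lia.
    have jj : (j < n.+2)%N by have := ltn_ord i; lia.
    have ii : (i.-1 < n.+1)%N by have := ltn_ord i; lia.
    rewrite (@codegen_coface_lt _ i j (Ordinal ii) (Ordinal jj)) //=; try lia.
    rewrite sm_comp; have /normalizedP/(_ (Ordinal jj)) xN' := xN.
    by rewrite [sm_map _ (coface _) _]xN' ?raddf0 ?scaler0 //=; lia.
  rewrite ifF; last by apply/eqP; lia.
  by rewrite subr0 codegen_cofaceK ?sm_id ij ?eqxx.
rewrite (eq_bigr _ (fun i _ => termE i)) sumrB -!big_mkcond /=.
have j1 : (j.-1 < n.+1)%N by have := ltn_ord j; lia.
rewrite [X in _ - X](big_pred1 (Ordinal j1)) //.
have [jn|jn] := ltnP j n.+1.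
  by rewrite (big_pred1 (Ordinal jn)) // subrr.
by rewrite cut_big // !scaler0 big1 ?subr0.
Qed.

(** The term i = 0 gives the far end of the homotopy; the others are, after a shift of the index,
    minus the prism of the 0-th face. As d_0 is the differential of the normalized complex, this is
    the homotopy relation. *)
Lemma face0_prism n (x : A n) :
  face B ord0 (prism x) = D (cut n 0) x -
    match n return A n -> B n with
    | 0 => fun=> 0
    | m.+1 => fun x => prism (face A ord0 x)
    end x.
Proof.
rewrite raddf_sum big_ord_recl /= expr0 scale1r face_prism /=.
rewrite codegen_cofaceK // sm_id; congr (_ + _).
case: n x => [|n] x; first by rewrite big_ord0 oppr0.
rewrite /prism -sumrN; apply: eq_bigr => i _.
rewrite linearZ /= face_prism /= (@codegen_coface_lt _ _ _ i ord0) //.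
by rewrite exprS mulN1r scaleNr sm_comp.
Qed.
End NormalizedHomotopy.

Lemma normalized_map_homotopic (f g : simplicial_map A B) :
  simplicially_homotopic f g -> homotopic (normalized_map f) (normalized_map g).
Proof.
move=> [H [Hn H0 H1]].
(* Subtracting [f] makes the homotopy vanish at the constant 0 simplex, which is what keeps the
   prism operator inside the normalized submodules. *)
pose D n (u : simp n 1) : {linear A n -> B n} := H n u \- f n.
have D_nat : simplicial_homotopy D.
  by move=> m n t u x; rewrite /D /= raddfB /= Hn sl_nat.
have D0 n (u : simp n 1) x : (forall i, u i = 0%N :> nat) -> D n u x = 0 :> B n.
  by move=> u0; rewrite /D /= H0 // subrr.
have Dcut0 n (x : A n) : D n (cut n 0) x = g n x - f n x.
  by rewrite /D /= H1 // => i; rewrite cutE.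
clearbody D.
have prismN n (x : submod_type (normalized_sub A n)) : prism D (val x) \in
  normalized_sub B n.+1.
  by apply/normalizedP => i i0; rewrite face_prism_gt0 // (valP x).
pose h n (x : normalized_complex A n) : normalized_complex B n.+1 := Sub (prism D
  (val x)) (prismN n x).
have hL n : linear (h n) by move=> a x y; apply: val_inj; apply: prism_linear.
exists (fun n => linear_of (hL n)); split=> [x|n x]; apply: val_inj.
  by rewrite /= (face0_prism D_nat) /= subr0 Dcut0.
by rewrite /= (face0_prism D_nat) /= Dcut0 subrK.
Qed.
End Normalization.

(** * Symmetric powers preserve simplicial homotopies *)

Section SymSimplicial.
Variables (R : comNzRingType) (d : nat) (A B : simplicial_module R).

Lemma Sym_mapK (U V W : lmodType R) (f : {linear U -> V}) (g : {linear V -> W})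
    (h : {linear U -> W}) : (forall x, h x = g (f x)) ->
  forall q : Sym d U, Sym_map (n := d) h q = Sym_map (n := d) g (Sym_map (n := d)
    f q).
Proof.
move=> hE; apply: (Sym_ext (g := Sym_map (n := d) h) (h := Sym_map (n := d) g \o
  Sym_map (n := d) f)) => x /=.
by rewrite !Sym_map_prod; congr (sym_prod _); apply/ffunP => i; rewrite !ffunE.
Qed.

Lemma Sym_map_eq (U V : lmodType R) (f g : {linear U -> V}) : f =1 g ->
  forall q : Sym d U, Sym_map (n := d) f q = Sym_map (n := d) g q.
Proof.
move=> fg; apply: (Sym_ext (g := Sym_map (n := d) f) (h := Sym_map (n := d) g))
  => x /=.
by rewrite !Sym_map_prod; congr (sym_prod _); apply/ffunP => i; rewrite !ffunE.
Qed.

Lemma Sym_map_id (U : lmodType R) (f : {linear U -> U}) : f =1 id ->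
  forall q : Sym d U, Sym_map f q = q.
Proof.
move=> fid; apply: (Sym_ext (g := Sym_map (n := d) f) (h := idfun)) => x /=.
by rewrite Sym_map_prod; congr (sym_prod _); apply/ffunP => i; rewrite ffunE.
Qed.

Lemma Sym_map_square (U V V' W : lmodType R) (f : {linear U -> V}) (g : {linear V
  -> W})
    (f' : {linear U -> V'}) (g' : {linear V' -> W}) :
  (forall x, g (f x) = g' (f' x)) ->
  forall q : Sym d U, Sym_map (n := d) g (Sym_map (n := d) f q) = Sym_map (n :=
    d) g' (Sym_map (n := d) f' q).
Proof.
move=> h q; rewrite -(@Sym_mapK _ _ _ f g (g \o f)) //.
by rewrite -(@Sym_mapK _ _ _ f' g' (g \o f)).
Qed.

Lemma Sym_sl_nat (f : simplicial_map A B) m n (t : simp m n)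
    (x : Sym_simplicial d A n) :
  Sym_map (n := d) (f m) (sm_map (Sym_simplicial d A) t x) =
  sm_map (Sym_simplicial d B) t (Sym_map (n := d) (f n) x).
Proof. by apply: Sym_map_square => y; rewrite sl_nat. Qed.

Definition Sym_simplicial_map (f : simplicial_map A B) :
    simplicial_map (Sym_simplicial d A) (Sym_simplicial d B) :=
  @SimplicialMap R (Sym_simplicial d A) (Sym_simplicial d B)
    (fun n => Sym_map (n := d) (f n)) (Sym_sl_nat f).

Lemma Sym_simplicially_homotopic (f g : simplicial_map A B) :
  simplicially_homotopic f g ->
  simplicially_homotopic (Sym_simplicial_map f) (Sym_simplicial_map g).
Proof.
move=> [H [Hn H0 H1]]; exists (fun n u => Sym_map (n := d) (H n u)); split.
- by move=> m n t u x /=; apply: Sym_map_square => y; rewrite Hn.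
- by move=> n u x u0 /=; apply: Sym_map_eq => y; apply: H0.
by move=> n u x u1 /=; apply: Sym_map_eq => y; apply: H1.
Qed.
End SymSimplicial.

(** * Functoriality of Gamma, and simplicial homotopies from chain homotopies *)

Section GammaFunctor.
Variables (R : comNzRingType) (C D : chain_complex R).

Section GammaMap.
Variable f : chain_map C D.

Lemma Gamma_cm_subproof n (c : Gamma_obj C n) :
  ((fun p s => f p (val c p s)) : simplex_family D n) \in Gamma_sub D n.
Proof.
have /asboolP[c0 cd] := valP c; apply/asboolP; split=> p s.
  by move=> ns; rewrite c0 // raddf0.
by rewrite -cm_d cd raddf_sum; apply: eq_bigr => i _; rewrite /= linearZ.
Qed.

Definition Gamma_cm n (c : Gamma_obj C n) : Gamma_obj D n :=
  exist (fun c => c \in Gamma_sub D n) _ (Gamma_cm_subproof c).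

Lemma Gamma_cm_linear n : linear (@Gamma_cm n).
Proof.
by move=> a x y; apply: val_inj; apply: familyP => p s; rewrite /= linearP.
Qed.

Lemma Gamma_cm_nat m n (t : simp m n) (x : Gamma C n) :
  linear_of (@Gamma_cm_linear m) (sm_map (Gamma C) t x) =
  sm_map (Gamma D) t (linear_of (@Gamma_cm_linear n) x).
Proof. by apply: val_inj; apply: familyP => p s. Qed.

Definition Gamma_simplicial_map : simplicial_map (Gamma C) (Gamma D) :=
  @SimplicialMap R (Gamma C) (Gamma D) (fun n => linear_of (@Gamma_cm_linear n))
    Gamma_cm_nat.
End GammaMap.

Section GammaHomotopy.
Variables (f g : chain_map C D) (h : forall n, {linear C n -> D n.+1}).
Hypothesis fg_h : homotopy f g h.

(* Pairing a simplex s of Delta^n with the simplex u s of Delta^1 and applying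
   the Alexander-Whitney map: only the splittings of u s with a back face of
   dimension 0 or 1 contribute. *)
Definition Gamma_homotopy_family n (u : simp n 1) (c : Gamma C n) :
    simplex_family D n := fun p s =>
  (if u (s ord_max) == 0%N :> nat then f p (val c p s) else g p (val c p s)) +
  match p return simp p n -> D p with
  | 0 => fun=> 0
  | q.+1 => fun s =>
      if (u (s (inord q)) == 0%N :> nat) && (u (s ord_max) == 1%N :> nat)
      then (-1) ^+ q *: h q (val c q (simp_comp s (coface ord_max))) else 0
  end s.

Lemma homotopyS n x :
  cc_d D n.+1 (h n.+1 x) = g n.+1 x - f n.+1 x - h n (cc_d C n x).
Proof. by rewrite (fg_h.2 n x) addrK. Qed.

Lemma simp1_cases n (u : simp n 1) i : u i = 0%N :> nat \/ u i = 1%N :> nat.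
Proof. by case: (u i) => [[|[|//]] ?]; [left|right]. Qed.

(** Only the last face of a simplex can change the value of [u] at the last vertex. The maps chosen
    by [u] therefore fail to commute with the differentials by a term on that face, which the
    homotopy relation cancels against the summand with [h]. *)
Lemma Gamma_homotopy_subproof n (u : simp n 1) (c : Gamma C n) :
  Gamma_homotopy_family u c \in Gamma_sub D n.
Proof.
have /asboolP[c0 cd] := valP c; apply/asboolP; split.
  move=> p s ns; rewrite /Gamma_homotopy_family c0 // !raddf0 if_same add0r.
  case: p s ns => [//|q] s ns; case: ifP => // /andP[/eqP uq /eqP um].
  (* As [u] separates the last two vertices of [s], the last vertex differs from all others; a
     repetition in [s] thus already occurs in its last face. *)
  rewrite c0 ?raddf0 ?scaler0 //; apply: contra ns => /injectiveP inj.
  have le_max (i : 'I_q.+2) : i != ord_max -> (i <= q)%N.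
    move=> ne; have := ltn_ord i; rewrite ltnS leq_eqVlt => /orP[/eqP e|//].
    by case/eqP: ne; apply: ord_inj.
  have sne i : i != ord_max -> s i = s ord_max -> False.
    move=> /le_max iq e; have ii : (i <= (inord q : 'I_q.+2))%N by rewrite inordK.
    by have := simp_mono u (simp_mono s ii); rewrite e uq um.
  have lift_max (i : 'I_q.+1) : fintype.lift ord_max i != ord_max.
    by rewrite eq_sym neq_lift.
  apply/injectiveP => i j; case: (unliftP ord_max i) => [i' ->|->];
    case: (unliftP ord_max j) => [j' ->|->] // e.
  - by congr (fintype.lift _ _); apply: inj; rewrite !simp_compE !cofaceE.
  - by case: (sne _ (lift_max i')).
  by case: (sne _ (lift_max j')).
move=> p s; rewrite /Gamma_homotopy_family.
set a := u (s (inord p)); set b := u (s ord_max);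
  set y := val c p (simp_comp s (coface ord_max)).
pose F (v : 'I_2) q z := if v == 0%N :> nat then f q z else g q z.
have FL v q z w : F v q (z + w) = F v q z + F v q w.
  by rewrite /F; case: ifP => _; rewrite raddfD.
have Fd v z : cc_d D p (F v p.+1 z) = F v p (cc_d C p z).
  by rewrite /F; case: ifP => _; rewrite cm_d.
have Fsum v (z : 'I_p.+2 -> C p) :
    F v p (\sum_(i < p.+2) (-1) ^+ i *: z i) = \sum_(i < p.+2) (-1) ^+ i *: F v p
      (z i).
  by rewrite /F; case: ifP => _; rewrite raddf_sum; apply: eq_bigr => i _;
    rewrite /= linearZ.
rewrite raddfD /= -/(F b _ _) Fd cd Fsum; under [RHS]eq_bigr do rewrite scalerDr.
rewrite big_split /= [X in X + _ = _]big_ord_recr [X in _ = X + _]big_ord_recr /=.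
have lastE (i : 'I_p.+1) : u (simp_comp s (coface (widen_ord (leqnSn p.+1) i))
  ord_max) = b.
  rewrite simp_compE cofaceE /b; congr (u (s _)); apply: ord_inj.
  by rewrite /= /bump; have := ltn_ord i; rewrite ltnS => ->.
have lastmax : u (simp_comp s (coface ord_max) ord_max) = a.
  rewrite simp_compE cofaceE /a; congr (u (s _)); apply: ord_inj.
  by rewrite /= /bump ltnn inordK.
have -> : \sum_(i < p.+1) (-1) ^+ i *:
      (if u (simp_comp s (coface (widen_ord (leqnSn p.+1) i)) ord_max) == 0%N :> nat
       then f p (val c p (simp_comp s (coface (widen_ord (leqnSn p.+1) i))))
       else g p (val c p (simp_comp s (coface (widen_ord (leqnSn p.+1) i))))) =
    \sum_(i < p.+1) (-1) ^+ i *: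
      F b p (val c p (simp_comp s (coface (widen_ord (leqnSn p.+1) i)))).
  by apply: eq_bigr => i _; rewrite lastE.
rewrite lastmax -!addrA; congr (_ + _).
rewrite -[sval c]/(val c) -/y -/(F a p y).
have ab : (a <= b)%N.
  by apply/simp_mono/simp_mono; rewrite inordK //= leqnSn.
case: p s @a @b @y @F FL Fd Fsum lastE lastmax ab => [|q] s a b y F _ _ _ lastE
  lastmax ab.
  rewrite big1 ?addr0 => [|i _]; last by rewrite scaler0.
  rewrite /F; case: (simp1_cases u (s (inord 0))) (simp1_cases u (s ord_max)) ab
    => a' [] b';
    rewrite /a /b a' b' //= ?raddf0 ?addr0 // => _.
  by rewrite expr0 scale1r -(fg_h.1 y) !scaleN1r addKr.
rewrite big_ord_recr big_ord_recr /=.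
have faces (i : 'I_q.+3) (j : 'I_q.+2) : (i <= q.+1)%N -> j = i :> nat ->
    simp_comp (simp_comp s (coface i)) (coface ord_max) =
    simp_comp (simp_comp s (coface ord_max)) (coface j).
  move=> iq ji; rewrite -!simp_compA; congr (simp_comp _ _).
  exact/esym/coface_comm.
pose z (j : 'I_q.+2) := h q (val c q (simp_comp (simp_comp s (coface ord_max))
  (coface j))).
have dy : h q (cc_d C q y) =
    \sum_(j < q.+1) (-1) ^+ j *: z (widen_ord (leqnSn q.+1) j) + (-1) ^+ q.+1 *:
      z ord_max.
  by rewrite /y cd raddf_sum big_ord_recr /= linearZ;
    under eq_bigr do rewrite linearZ.
have penultE (i : 'I_q.+1) :
    u (simp_comp s (coface (widen_ord (leqnSn q.+2) (widen_ord (leqnSn q.+1) i)))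
      (inord q)) = a.
  rewrite simp_compE cofaceE /a; congr (u (s _)); apply: ord_inj.
  by rewrite /= /bump !inordK //; have := ltn_ord i; case: leqP; lia.
have penult2 (i : 'I_q.+3) : (q < i)%N ->
    u (simp_comp s (coface i) (inord q)) = u (s (inord q)).
  move=> qi; rewrite simp_compE cofaceE; congr (u (s _)); apply: ord_inj.
  by rewrite /= /bump !inordK //; [case: leqP; lia | lia].
have a'a : (u (s (inord q)) <= a)%N.
  by apply/simp_mono/simp_mono; rewrite !inordK //; lia.
rewrite [X in _ = _ + (X + _ + _)](eq_bigr (fun i : 'I_q.+1 => (-1) ^+ i *:
  if (a == 0%N :> nat) && (b == 1%N :> nat)
  then (-1) ^+ q *: z (widen_ord (leqnSn q.+1) i) else 0)); last first.
  move=> i _; rewrite penultE lastE (faces _ (widen_ord (leqnSn q.+1) i)) //=.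
  by have := ltn_ord i; lia.
rewrite lastE lastmax !penult2 ?(faces _ ord_max) //= -/(z ord_max).
(* The values of [u] at the last two vertices decide. For 0, 0 no term with [h] is left; for 0, 1
   the homotopy relation applies; for 1, 1 the faces q + 1 and q + 2 contribute the same term with
   opposite signs. *)
have [a0|a1] := simp1_cases u (s (inord q.+1));
  have [b0|b1] := simp1_cases u (s ord_max);
  move: ab a'a; rewrite /F /a /b ?a0 ?a1 ?b0 ?b1 //= => _.
- by rewrite !andbF raddf0 !scaler0 big1 ?addr0 // => i _; rewrite scaler0.
- rewrite leqn0 => ->; rewrite andbF scaler0 addr0 linearZ /= homotopyS dy.
  have -> : \sum_(i < q.+1) (-1) ^+ i *: ((-1) ^+ q *: z (widen_ord (leqnSn q.+1)
    i)) +
      (-1) ^+ q.+1 *: ((-1) ^+ q *: z ord_max) = (-1) ^+ q *: h q (cc_d C q y).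
    rewrite dy scalerDr scaler_sumr !scalerA [_ * _ in RHS]mulrC.
    by congr (_ + _); apply: eq_bigr => i _; rewrite !scalerA mulrC.
  rewrite -dy 2!exprS !mulN1r opprK scaleNr -scalerBr -scalerDr.
  by rewrite -addrA -opprD subKr.
rewrite andbT raddf0 big1 ?add0r ?addr0 => [|i _]; last by rewrite scaler0.
move=> _; case: ifP => _; last by rewrite !scaler0 !addr0.
by rewrite -scalerDl [(-1) ^+ q.+2]exprS mulN1r subrr scale0r addr0.
Qed.

Definition Gamma_homotopy_fun n (u : simp n 1) (c : Gamma_obj C n) : Gamma_obj D
  n :=
  exist (fun c => c \in Gamma_sub D n) _ (Gamma_homotopy_subproof u c).

Lemma Gamma_homotopy_linear n u : linear (@Gamma_homotopy_fun n u).
Proof.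
move=> a x y; apply: val_inj; apply: familyP => p s /=.
rewrite [RHS]/= /Gamma_homotopy_family.
have -> (v w : simplex_family D n) : (a *: v + w) p s = a *: v p s + w p s by [].
rewrite scalerDr addrACA; congr (_ + _); first by case: ifP => _; rewrite linearP.
case: p s => [|q] s; first by rewrite scaler0 addr0.
case: ifP => _; last by rewrite scaler0 addr0.
by rewrite linearP scalerDr !scalerA mulrC.
Qed.

Definition Gamma_homotopy n u : {linear Gamma C n -> Gamma D n} :=
  linear_of (@Gamma_homotopy_linear n u).

Lemma Gamma_homotopy_nat : simplicial_homotopy Gamma_homotopy.
Proof.
move=> m n t u c; apply: val_inj; apply: familyP => p s /=.
rewrite /Gamma_homotopy_family !simp_compE /=; congr (_ + _).
by case: p s => [//|q] s; rewrite !simp_compE /= simp_compA.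
Qed.
End GammaHomotopy.

Lemma Gamma_simplicially_homotopic (f g : chain_map C D) : homotopic f g ->
  simplicially_homotopic (Gamma_simplicial_map f) (Gamma_simplicial_map g).
Proof.
move=> [h fg_h]; exists (Gamma_homotopy fg_h); split.
- exact: Gamma_homotopy_nat.
- move=> n u x u0; apply: val_inj; apply: familyP => p s /=.
  by rewrite /Gamma_homotopy_family; case: p s => [|q] s; rewrite !u0 /= addr0.
move=> n u x u1; apply: val_inj; apply: familyP => p s /=.
by rewrite /Gamma_homotopy_family; case: p s => [|q] s; rewrite !u1 /= addr0.
Qed.
End GammaFunctor.

Lemma derived_Sym_homotopy_equivalent (R : comNzRingType) (d : nat)
    (C D : chain_complex R) : homotopy_equivalent C D ->
  homotopy_equivalent (normalized_complex (Sym_simplicial d (Gamma C)))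
                      (normalized_complex (Sym_simplicial d (Gamma D))).
Proof.
pose F (A B : chain_complex R) (f : chain_map A B) :=
  normalized_map (Sym_simplicial_map d (Gamma_simplicial_map f)).
have F_htpy (A B : chain_complex R) (f g : chain_map A B) :
    homotopic f g -> homotopic (F _ _ f) (F _ _ g).
  by move=> fg;
    apply/normalized_map_homotopic/Sym_simplicially_homotopic/Gamma_simplicially_homotopic.
(* Functoriality of [F] is available pointwise, so homotopies are transported along pointwise
   equalities of chain maps. *)
have homotopicW (A B : chain_complex R) (f g f' g' : chain_map A B) :
    (forall n x, f n x = f' n x) -> (forall n x, g n x = g' n x) ->
    homotopic f g -> homotopic f' g'.
  move=> ff' gg' [h [h0 hS]]; exists h; split=> [x|n x];
    by rewrite -ff' -gg' ?h0 ?hS.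
have F_id (A : chain_complex R) n x : F A A (cm_id A) n x = x.
  apply: val_inj; apply: Sym_map_id => y.
  by apply: val_inj; apply: familyP => p s.
have F_comp (A B E : chain_complex R) (g : chain_map B E) (f : chain_map A B) n x :
    F _ _ (cm_comp g f) n x = F _ _ g n (F _ _ f n x).
  apply: val_inj; apply: Sym_mapK => y.
  by apply: val_inj; apply: familyP => p s.
move=> [f [g [gf fg]]]; exists (F _ _ f), (F _ _ g); split.
  by apply: homotopicW (F_htpy _ _ _ _ gf) => n x; [apply: F_id | apply: F_comp].
by apply: homotopicW (F_htpy _ _ _ _ fg) => n x; [apply: F_id | apply: F_comp].
Qed.

(** * The projection onto the normalized complex *)

Section NormalizingProjection.
Variables (R : comNzRingType) (A : simplicial_module R).

Lemma face_sdegK n (i : 'I_n.+1) (j : 'I_n.+2) (x : A n) :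
  (j == i :> nat) || (j == i.+1 :> nat) -> face A j (sdeg A i x) = x.
Proof. by move=> h; rewrite /face /sdeg -sm_comp codegen_cofaceK ?sm_id. Qed.

Lemma face_sdeg_lt n (i : 'I_n.+2) (j : 'I_n.+3) (i' : 'I_n.+1) (j' : 'I_n.+2) (x
  : A n.+1) :
  (j < i)%N -> i = i'.+1 :> nat -> j' = j :> nat ->
  face A j (sdeg A i x) = sdeg A i' (face A j' x).
Proof.
by move=> *; rewrite /face /sdeg -!sm_comp (@codegen_coface_lt _ i j i' j').
Qed.

Lemma face_sdeg_gt n (i : 'I_n.+2) (j : 'I_n.+3) (i' : 'I_n.+1) (j' : 'I_n.+2) (x
  : A n.+1) :
  (i.+1 < j)%N -> i' = i :> nat -> j = j'.+1 :> nat ->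
  face A j (sdeg A i x) = sdeg A i' (face A j' x).
Proof.
by move=> *; rewrite /face /sdeg -!sm_comp (@codegen_coface_gt _ i j i' j').
Qed.

Lemma codegen_codegen n (i : 'I_n.+1) (k : 'I_n.+1) (i' : 'I_n.+2) (k' : 'I_n.+2) :
  (i <= k)%N -> i' = i :> nat -> k' = k.+1 :> nat ->
  simp_comp (codegen i) (codegen k') = simp_comp (codegen k) (codegen i').
Proof.
move=> ik ei ek; apply: simpP => l; apply: ord_inj.
rewrite !simp_compE !codegenE ei ek.
by do 4!case: ltnP => ? /=; lia.
Qed.

Lemma sdeg_sdeg n (i : 'I_n.+1) (k : 'I_n.+1) (i' : 'I_n.+2) (k' : 'I_n.+2) (x :
  A n) :
  (i <= k)%N -> i' = i :> nat -> k' = k.+1 :> nat ->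
  sdeg A k' (sdeg A i x) = sdeg A i' (sdeg A k x).
Proof. by move=> *; rewrite /sdeg -!sm_comp (@codegen_codegen _ i k i' k'). Qed.

Definition strip n (k : nat) : {linear A n.+1 -> A n.+1} :=
  idfun \- (sdeg A (inord k) \o face A (inord k.+1)).

(** The composite (1 - s_0 d_1) ... (1 - s_{k-1} d_k), whose factor of highest index acts first; for
    k = n + 1 it is the projector onto the normalized submodule along the degenerate elements. *)
Fixpoint strips n (k : nat) : {linear A n.+1 -> A n.+1} :=
  if k is k'.+1 then strips n k' \o strip n k' else idfun.

Definition normalize n : {linear A n -> A n} :=
  match n with 0 => idfun | m.+1 => strips m m.+1 end.

Lemma stripE n k (x : A n.+1) :
  strip n k x = x - sdeg A (inord k) (face A (inord k.+1) x).
Proof. by []. Qed.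

(** After 1 - s_k d_{k+1} the face d_{k+1} vanishes, and the vanishing of the higher faces is kept;
    the range of vanishing faces grows downwards, which is why the factors act from the top. *)
Lemma strips_face n k (x : A n.+1) : (k <= n.+1)%N ->
  (forall j : 'I_n.+2, (k < j)%N -> face A j x = 0) ->
  forall j : 'I_n.+2, (0 < j)%N -> face A j (strips n k x) = 0.
Proof.
elim: k x => [|k IHk] x kn hx; first by move=> j j0; apply: hx.
apply: IHk => [|j kj]; first by lia.
rewrite stripE raddfB /=; have [jk|/eqP jk] := eqVneq (j : nat) k.+1.
  rewrite face_sdegK; last by rewrite inordK // jk eqxx orbT.
  by apply/eqP; rewrite subr_eq0; apply/eqP; congr (face A _ x); apply: ord_inj;
    rewrite inordK // jk.
rewrite (hx j) ?sub0r; last by lia.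
case: n x kn hx j kj jk => [|n] x kn hx j kj jk; first by have := ltn_ord j; lia.
have jj := ltn_ord j; have j1 : (j.-1 < n.+2)%N by lia.
rewrite (@face_sdeg_gt _ (inord k) j (inord k) (Ordinal j1)) ?inordK //=; try lia.
have k1 : (k.+1 < n.+2)%N by lia.
rewrite -[inord k.+1]/(inord (Ordinal k1)).
rewrite -(@face_face _ _ _ (Ordinal k1) (Ordinal j1) (Ordinal k1) j) //=; try lia.
by rewrite hx ?raddf0 ?oppr0 //; lia.
Qed.

Lemma strips_id n k (x : A n.+1) : (k <= n.+1)%N ->
  x \in normalized_sub A n.+1 -> strips n k x = x.
Proof.
move=> kn /normalizedP hx; elim: k kn => [//|k IHk] kn.
by rewrite /= hx ?inordK // raddf0 subr0 IHk // ltnW.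
Qed.

(** A factor 1 - s_k d_{k+1} with k > i maps the image of s_i to itself, and the factor with k = i
    kills it because d_{i+1} s_i = 1. *)
Lemma strips_sdeg n k (i : 'I_n.+1) (y : A n) : (i < k <= n.+1)%N ->
  strips n k (sdeg A i y) = 0.
Proof.
elim: k y => [//|k IHk] y /andP[ik kn].
have [e|/eqP ne] := eqVneq (i : nat) k.
  rewrite [LHS]/= face_sdegK ?inordK ?e ?eqxx ?orbT //.
  have -> : inord k = i by apply: ord_inj; rewrite inordK.
  by rewrite subrr raddf0.
have {ne}ik : (i < k)%N by lia.
case: n i y IHk ik kn => [|n] i y IHk ik kn; first by lia.
have i1 : (i < n.+1)%N by lia.
have k1 : (k.-1 < n.+1)%N by lia.
have k2 : (k < n.+2)%N by lia.
rewrite [LHS]/= (@face_sdeg_gt _ i (inord k.+1) (Ordinal i1) (Ordinal k2))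
  ?inordK //=; try lia.
rewrite (@sdeg_sdeg _ (Ordinal i1) (Ordinal k1) i) ?inordK //=; try lia.
by rewrite -raddfB IHk //; lia.
Qed.

Lemma strips_sub n k (x : A n.+1) : (k <= n.+1)%N ->
  exists y : 'I_n.+1 -> A n, x - strips n k x = \sum_i sdeg A i (y i).
Proof.
elim: k x => [|k IHk] x kn.
  by exists (fun=> 0); rewrite subrr big1 // => i _; rewrite raddf0.
have [y yE] := IHk (strip n k x) (ltnW kn).
exists (fun i => y i + (if i == inord k then face A (inord k.+1) x else 0)).
rewrite (eq_bigr _ (fun i _ => raddfD _ _ _)) big_split /= -yE.
rewrite [X in _ = _ + X](bigD1 (inord k)) //= eqxx big1 ?addr0 => [|i ni];
  last first.
  by rewrite (negPf ni) raddf0.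
by rewrite addrAC subrK.
Qed.

Lemma normalize_in n (x : A n) : normalize n x \in normalized_sub A n.
Proof.
case: n x => [//|n] x; apply/normalizedP; apply: strips_face => // j.
by have := ltn_ord j; lia.
Qed.

Lemma normalize_id n (x : A n) : x \in normalized_sub A n -> normalize n x = x.
Proof. by case: n x => [//|n] x xN; apply: strips_id. Qed.

Lemma normalize_sdeg n (i : 'I_n.+1) (y : A n) : normalize n.+1 (sdeg A i y) = 0.
Proof. by apply: strips_sdeg; rewrite ltn_ord /=. Qed.

Lemma normalize_sub n (x : A n.+1) :
  exists y : 'I_n.+1 -> A n, x = normalize n.+1 x + \sum_i sdeg A i (y i).
Proof.
by have [y yE] := strips_sub x (leqnn n.+1); exists y;
  rewrite -yE addrCA subrr addr0.
Qed.

Definition alternating n (x : A n.+1) : A n := \sum_(i < n.+2) (-1) ^+ i *: face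
  A i x.

Lemma alternating_linear n : linear (@alternating n).
Proof.
move=> a x y; rewrite /alternating scaler_sumr -big_split; apply: eq_bigr => i _ /=.
by rewrite linearP /= scalerDr !scalerA mulrC.
Qed.
HB.instance Definition _ n :=
  GRing.isLinear.Build R _ _ *:%R (@alternating n) (@alternating_linear n).

Lemma alternating_normalized n (x : A n.+1) : x \in normalized_sub A n.+1 ->
  alternating x = face A ord0 x.
Proof.
move=> /normalizedP xN; rewrite /alternating big_ord_recl expr0 scale1r big1
  ?addr0 //.
by move=> i _; rewrite xN // scaler0.
Qed.

Lemma normalize_alternating_sdeg n (i : 'I_n.+1) (y : A n) :
  normalize n (alternating (sdeg A i y)) = 0.
Proof.
rewrite /alternating raddf_sum /=.
rewrite (bigD1 (inord i)) //= (bigD1 (inord i.+1)) /=; last first.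
  by apply/eqP => /(congr1 val) /=; rewrite !inordK //; have := ltn_ord i; lia.
have ii := ltn_ord i.
rewrite !face_sdegK ?inordK ?eqxx ?orbT //; try lia.
rewrite big1 ?addr0.
  by rewrite !linearZ /= exprS mulN1r scaleNr subrr.
move=> j /andP[j1 j2]; rewrite linearZ /=.
have {}j1 : j <> i :> nat by move=> e; case/eqP: j1; apply: ord_inj;
  rewrite inordK //; lia.
have {}j2 : j <> i.+1 :> nat by move=> e; case/eqP: j2; apply: ord_inj;
  rewrite inordK //; lia.
have jj := ltn_ord j.
case: n i y ii j j1 j2 jj => [|n] i y ii j j1 j2 jj; first by lia.
have [ji|ji] := ltnP j i.
  have i1 : (i.-1 < n.+1)%N by lia.
  have j3 : (j < n.+2)%N by lia.
  rewrite (@face_sdeg_lt _ i j (Ordinal i1) (Ordinal j3)) //; try by rewrite /=;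
    lia.
  by rewrite normalize_sdeg scaler0.
have i1 : (i < n.+1)%N by lia.
have j3 : (j.-1 < n.+2)%N by lia.
rewrite (@face_sdeg_gt _ i j (Ordinal i1) (Ordinal j3)) //; try by rewrite /=; lia.
by rewrite normalize_sdeg scaler0.
Qed.

(** On s_i y the faces i and i + 1 cancel in the alternating sum and the others are degenerate. So
    d_0 on the normalized complex may be computed from all faces modulo degenerate elements. *)
Lemma normalize_alternating n (x : A n.+1) :
  normalize n (alternating x) = face A ord0 (normalize n.+1 x).
Proof.
have [y yE] := normalize_sub x; set z := normalize n.+1 x in yE *.
have zN : z \in normalized_sub A n.+1 by apply: normalize_in.
rewrite yE 2!raddfD [X in _ + X](_ : _ = 0); last first.
  rewrite (raddf_sum (@alternating n)) raddf_sum big1 // => i _;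
    apply: normalize_alternating_sdeg.
by rewrite addr0 /= alternating_normalized // normalize_id // normalized_face0.
Qed.
End NormalizingProjection.

(** * The Koszul complex *)

Section Koszul.
Variables (R : comNzRingType) (f g : R).

Definition koszul_rank (n : nat) : nat :=
  match n with 0 => 1 | 1 => 2 | 2 => 1 | _ => 0 end%N.

(** Chains are row vectors multiplied on the right. With X, Y in degree 1 and Z in degree 2, the
    differential is X -> f, Y -> g, Z -> g X - f Y. *)
Definition koszul_mx n : 'M[R]_(koszul_rank n.+1, koszul_rank n) :=
  match n with
  | 0 => \matrix_(i, j) (if i == 0%N :> nat then f else g)
  | 1 => \matrix_(i, j) (if j == 0%N :> nat then g else - f)
  | _ => 0
  end.

Lemma koszul_dd n (x : 'rV[R]_(koszul_rank n.+2)) :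
  mulmxr (koszul_mx n) (mulmxr (koszul_mx n.+1) x) = 0.
Proof.
case: n x => [|n] x /=; last by rewrite mulmx0 mul0mx.
rewrite -mulmxA [X in _ *m X](_ : _ = 0) ?mulmx0 //.
by apply/matrixP => i j; rewrite !mxE big_ord_recl big_ord1 !mxE /=; ring.
Qed.

Definition koszul : chain_complex R :=
  @ChainComplex R (fun n => 'rV[R]_(koszul_rank n))
    (fun n => mulmxr (koszul_mx n)) koszul_dd.

(** * A basis of Gamma of the Koszul complex *)

Definition vertex p n (s : simp p n) (k : nat) : nat := s (inord k).

Lemma vertex_coface p n (s : simp p.+1 n) (i : 'I_p.+2) k : (k <= p)%N ->
  vertex (simp_comp s (coface i)) k = vertex s (bump i k).
Proof.
move=> kp; rewrite /vertex simp_compE cofaceE; congr (nat_of_ord (s _)).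
apply: ord_inj; rewrite /= !inordK //.
by rewrite /bump; case: (i <= k)%N => /=; lia.
Qed.

Lemma vertex_le p n (s : simp p n) k : (vertex s k <= n)%N.
Proof. by rewrite -ltnS ltn_ord. Qed.

Lemma vertex_mono p n (s : simp p n) k l : (k <= l <= p)%N -> (vertex s k <=
  vertex s l)%N.
Proof. by move=> h; apply: simp_mono; rewrite !inordK //; lia. Qed.

Lemma vertex_inj p n (s : simp p n) :
  (forall k, (k < p)%N -> (vertex s k < vertex s k.+1)%N) -> injectiveb s.
Proof.
move=> hs; have lt_mono (i j : 'I_p.+1) : (i < j)%N -> (s i < s j)%N.
  move=> ij; have := hs i; have [? ?] := (ltn_ord i, ltn_ord j).
  move=> /(_ _)/leq_trans; rewrite /vertex inord_val; apply; first by lia.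
  by apply: simp_mono; rewrite inordK; lia.
apply/injectiveP => i j e; apply: ord_inj.
by have [/lt_mono|/lt_mono|//] := ltngtP i j; rewrite e ltnn.
Qed.

(* The label 0 stands for the constant basis element, 1 and 2 for the two
   generators in degree 1 pulled back along the surjection onto [1] whose second
   fibre starts at i, and 3 for the generator in degree 2 pulled back along the
   surjection onto [2] whose last two fibres start at i and j. *)
Definition gen := (nat * nat * nat)%type.

(** The [k]-th coordinate of the chain map on the simplex with vertices [v]. In the degree of the
    generator it detects simplices with one vertex in each fibre; one degree lower, the boundary of
    the generator is carried by the face opposite to the vertex 0 of [1] or [2]. *)
Definition gen_coef p (b : gen) (v : nat -> nat) (k : nat) : R :=
  let: (l, i, j) := b in
  match l, p with
  | 0, 0 => 1
  | 1, 0 => f * (i <= v 0)%N%:R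
  | 1, 1 => (k == 0%N)%:R * (v 0 < i <= v 1)%N%:R
  | 2, 0 => g * (i <= v 0)%N%:R
  | 2, 1 => (k == 1%N)%:R * (v 0 < i <= v 1)%N%:R
  | 3, 1 => (if k == 0%N then g else - f) * ((i <= v 0 < j) && (j <= v 1))%N%:R
  | 3, 2 => ((v 0 < i <= v 1) && (v 1 < j <= v 2))%N%:R
  | _, _ => 0
  end.

Definition gen_family n (b : gen) : simplex_family koszul n :=
  fun p s => \row_k gen_coef p b (vertex s) k.

Lemma gen_coef_ext p (b b' : gen) (v w : nat -> nat) k :
  b.1.1 = b'.1.1 ->
  (forall l, (l <= p)%N -> (b.1.2 <= v l)%N = (b'.1.2 <= w l)%N) ->
  (forall l, (l <= p)%N -> (b.2 <= v l)%N = (b'.2 <= w l)%N) ->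
  gen_coef p b v k = gen_coef p b' w k.
Proof.
case: b b' => [[l i] j] [[l' i'] j'] /= <- hi hj.
by case: l => [|[|[|[|l]]]] //; case: p hi hj => [|[|[|p]]] // hi hj;
  rewrite 4?ltnNge ?(hi 0%N) ?(hi 1%N) ?(hi 2%N) ?(hj 0%N) ?(hj 1%N) ?(hj 2%N).
Qed.

Lemma gen_family_subproof n (b : gen) : gen_family b \in Gamma_sub koszul n.
Proof.
apply/asboolP; split=> p s.
  move=> ns; apply/rowP => k; rewrite !mxE; case: b => [[l i] j] /=.
  have [m [mp nm]] : exists m, (m < p)%N /\ (vertex s m.+1 <= vertex s m)%N.
    apply: contrapT => nh; move/negP: ns; apply; apply: vertex_inj => m mp.
    by rewrite ltnNge; apply/negP => le; apply: nh; exists m.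
  case: l => [|[|[|[|l]]]] //; case: p s k ns m mp nm => [|[|[|p]]] // s k ns
    [|[|m]] // _ nm.
  - by rewrite (_ : (_ < _ <= _)%N = false) ?mulr0 //; lia.
  - by rewrite (_ : (_ < _ <= _)%N = false) ?mulr0 //; lia.
  - by rewrite (_ : _ && _ = false) ?mulr0 //; lia.
  - by rewrite (_ : _ && _ = false) //; lia.
  by rewrite (_ : _ && _ = false) //; lia.
apply/rowP => k; rewrite !mxE summxE.
have v01 := vertex_mono s (k := 0%N) (l := 1%N).
have v12 := vertex_mono s (k := 1%N) (l := 2%N).
have v23 := vertex_mono s (k := 2%N) (l := 3%N).
case: b => [[l i] j].
case: p s k v01 v12 v23 => [|[|[|p]]] s k v01 v12 v23.
- rewrite /koszul_mx /= !big_ord_recl !big_ord0 !mxE /= !vertex_coface // /bump /=.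
  have {}v01 := v01 isT; move: (vertex s 0) (vertex s 1) v01 => v w vw.
  by case: l => [|[|[|[|l]]]]; case: (leqP i v) => ?; case: (leqP i w) => ?;
    rewrite /=; try lia; ring.
- rewrite /koszul_mx /= !big_ord_recl !big_ord0 !mxE /= !vertex_coface // /bump /=.
  have {}v01 := v01 isT; have {}v12 := v12 isT.
  move: (vertex s 0) (vertex s 1) (vertex s 2) v01 v12 => u v w uv vw.
  case: l => [|[|[|[|l]]]]; case: (leqP i u) => ?; case: (leqP i v) => ?;
    case: (leqP i w) => ?; rewrite /=; try lia; try ring;
    case: (leqP j u) => ?; case: (leqP j v) => ?; case: (leqP j w) => ?;
      rewrite /=; try lia; try ring;
    by case: eqP; ring.
- rewrite /koszul_mx /= !big_ord_recl !big_ord0 !mxE /= !vertex_coface // /bump /=.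
  have {}v01 := v01 isT; have {}v12 := v12 isT; have {}v23 := v23 isT.
  move: (vertex s 0) (vertex s 1) (vertex s 2) (vertex s 3) v01 v12 v23 => t u v
    w tu uv vw.
  case: l => [|[|[|[|l]]]]; try ring.
  case: (leqP i t) => ?; case: (leqP i u) => ?; case: (leqP i v) => ?;
    case: (leqP i w) => ?;
    rewrite /=; try lia; try ring;
    case: (leqP j t) => ?; case: (leqP j u) => ?; case: (leqP j v) => ?;
      case: (leqP j w) => ?;
    rewrite /=; try lia; by ring.
by case: k.
Qed.

Definition gen_elt n (b : gen) : Gamma_obj koszul n :=
  exist (fun c => c \in Gamma_sub koszul n) _ (gen_family_subproof n b).

Lemma gen_elt_ext n (c c' : Gamma_obj koszul n) :
  (forall p (s : simp p n) k, val c p s 0 k = val c' p s 0 k) -> c = c'.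
Proof.
move=> h; apply: val_inj; apply: familyP => p s.
by apply/rowP => k; apply: h.
Qed.

Lemma gen_elt_map m n (t : simp m n) (b b' : gen) : b.1.1 = b'.1.1 ->
  (forall k, (b.1.2 <= t k)%N = (b'.1.2 <= k)%N) ->
  (forall k, (b.2 <= t k)%N = (b'.2 <= k)%N) ->
  Gamma_map t (gen_elt n b) = gen_elt m b'.
Proof.
move=> e1 e2 e3; apply: gen_elt_ext => p s k; rewrite !mxE;
  apply: gen_coef_ext => // l _.
  by rewrite /vertex simp_compE e2.
by rewrite /vertex simp_compE e3.
Qed.

Definition face_gen (c : nat) (b : gen) : gen :=
  let: (l, i, j) := b in (l, i - (c < i), j - (c < j))%N.

Definition sdeg_gen (c : nat) (b : gen) : gen :=
  let: (l, i, j) := b in (l, i + (c < i), j + (c < j))%N.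

Lemma face_gen_elt n (c : 'I_n.+2) (b : gen) :
  face (Gamma koszul) c (gen_elt n.+1 b) = gen_elt n (face_gen c b).
Proof.
case: b => [[l i] j]; apply: gen_elt_map => // k; rewrite cofaceE /= /bump.
  by case: (leqP c k) => ? /=; case: (ltnP c i) => ? /=; lia.
by case: (leqP c k) => ? /=; case: (ltnP c j) => ? /=; lia.
Qed.

Lemma sdeg_gen_elt n (c : 'I_n.+1) (b : gen) :
  sdeg (Gamma koszul) c (gen_elt n b) = gen_elt n.+1 (sdeg_gen c b).
Proof.
case: b => [[l i] j]; apply: gen_elt_map => // k; rewrite codegenE /=.
  by case: (ltnP c k) => ? /=; case: (ltnP c i) => ? /=; lia.
by case: (ltnP c k) => ? /=; case: (ltnP c j) => ? /=; lia.
Qed.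

(** With threshold 0 the map to [1] is constant at the vertex 1, where the chain map has the value
    [f]. *)
Lemma gen_elt_X0 n j : gen_elt n (1, 0, j)%N = f *: gen_elt n (0, 0, 0)%N.
Proof. by apply: gen_elt_ext => -[|[|p]] s k; rewrite !mxE /= ?mulr0. Qed.

Lemma gen_elt_Y0 n j : gen_elt n (2, 0, j)%N = g *: gen_elt n (0, 0, 0)%N.
Proof. by apply: gen_elt_ext => -[|[|p]] s k; rewrite !mxE /= ?mulr0. Qed.

(** With first threshold 0 the map to [2] misses the vertex 0 and factors through the opposite face,
    which carries the boundary of the generator of degree 2. *)
Lemma gen_elt_Z0 n j :
  gen_elt n (3, 0, j)%N = g *: gen_elt n (1, j, 0)%N - f *: gen_elt n (2, j, 0)%N.
Proof.
apply: gen_elt_ext => -[|[|[|p]]] s k; rewrite !mxE /= ?mulr0; try ring.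
by case: k => [[|[|//]]] ? /=; ring.
Qed.

Lemma gen_elt_big n l i j : (0 < l < 3)%N -> (n < i)%N -> gen_elt n (l, i, j) = 0.
Proof.
move=> l3 ni; apply: gen_elt_ext => p s k; rewrite !mxE /gen_coef.
have v0 := vertex_le s 0; have v1 := vertex_le s 1.
have h0 : (i <= vertex s 0)%N = false by lia.
have h1 : (i <= vertex s 1)%N = false by lia.
by case: l l3 => [|[|[|[|l]]]] // _;
  case: p s k v0 v1 h0 h1 => [|[|p]] // s k _ _ h0 h1; rewrite ?h0 ?h1 ?andbF mulr0.
Qed.

Lemma gen_elt_Zbig n i j : (n < j)%N || (j <= i)%N -> gen_elt n (3, i, j)%N = 0.
Proof.
move=> nj; apply: gen_elt_ext => p s k; rewrite !mxE /gen_coef.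
have v0 := vertex_le s 0; have v1 := vertex_le s 1; have v2 := vertex_le s 2.
case: p s k v0 v1 v2 => [|[|[|p]]] s k v0 v1 v2; rewrite ?mulr0 //.
  by rewrite (_ : _ && _ = false) ?mulr0 //; lia.
by rewrite (_ : _ && _ = false) //; lia.
Qed.

(** The thresholds run over the surjections from [n], giving the rank 1 + 2n + n(n-1)/2 of
    Gamma(K)_n. *)
Definition gens n : seq gen :=
  [:: (0, 0, 0)%N] ++ [seq (1, i, 0)%N | i <- iota 1 n] ++ [seq (2, i, 0)%N | i
    <- iota 1 n]
  ++ [seq (3, i, j)%N | i <- iota 1 n, j <- iota i.+1 (n - i)].

Lemma mem_gens n l i j : ((l, i, j) \in gens n) =
  match l with
  | 0 => (i == 0) && (j == 0)
  | 1 | 2 => (0 < i <= n) && (j == 0)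
  | 3 => (0 < i < j) && (j <= n)
  | _ => false
  end%N.
Proof.
rewrite !mem_cat mem_seq1.
have mem1 (l' : nat) : ((l, i, j) \in [seq (l', i, 0)%N | i <- iota 1 n]) =
    [&& l == l', (0 < i <= n)%N & j == 0%N].
  apply/mapP/and3P => [[k kn [-> -> ->]]|[/eqP-> hi /eqP->]].
    by split=> //; move: kn; rewrite mem_iota; lia.
  by exists i => //; rewrite mem_iota; lia.
rewrite !mem1 (_ : (_ \in [seq _ | i <- _, j <- _]) = [&& l == 3, (0 < i < j) &
  (j <= n)]%N).
  by case: l {mem1} => [|[|[|[|l]]]]; rewrite ?xpair_eqE /= ?orbF.
apply/allpairsPdep/and3P => [[a [b [ha hb [-> -> ->]]]]|[/eqP-> hi hj]].
  by move: ha hb; rewrite !mem_iota => ha hb; split=> //; lia.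
by exists i, j; rewrite !mem_iota; split=> //; lia.
Qed.

Lemma simplex_of_subproof p n (v : nat -> nat) (i j : 'I_p.+1) : (i <= j)%N ->
  ((inord (minn n (\max_(k < i.+1) v k)) : 'I_n.+1) <=
   (inord (minn n (\max_(k < j.+1) v k)) : 'I_n.+1))%N.
Proof.
move=> ij; rewrite !inordK ?ltnS ?geq_minl //.
rewrite leq_min geq_minl /= (leq_trans (geq_minr _ _)) //.
apply/bigmax_leqP => k _; have k1 : (k < j.+1)%N by have := ltn_ord k; lia.
exact: (leq_bigmax (F := fun k : 'I_j.+1 => v k) (Ordinal k1)).
Qed.

(** The running maximum capped at [n] yields a simplex for every [v], so no monotonicity proof has
    to be carried along in terms. *)
Definition simplex_of p n (v : nat -> nat) : simp p n :=
  mk_simp (@simplex_of_subproof p n v).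

Lemma vertex_simplex_of p n (v : nat -> nat) k :
  (forall l, (l < p)%N -> (v l <= v l.+1)%N) -> (v p <= n)%N -> (k <= p)%N ->
  vertex (simplex_of p n v) k = v k.
Proof.
move=> v_mono vn kp; rewrite /vertex mk_simpE.
have le_v l m : (l <= m <= p)%N -> (v l <= v m)%N.
  elim: m => [|m IHm]; first by rewrite leqn0 => /andP[/eqP->].
  rewrite leq_eqVlt => /andP[/orP[/eqP->//|lm] mp].
  by apply: leq_trans (IHm _) (v_mono _ mp); lia.
rewrite [\max_(_ < _) _](_ : _ = v k).
  have kn := leq_trans (le_v k p _) vn;
    rewrite (minn_idPr _) ?kn ?kp ?leqnn // inordK // ltnS.
  by rewrite kn // kp leqnn.
rewrite inordK //; apply/eqP; rewrite eqn_leq; apply/andP; split.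
  by apply/bigmax_leqP => i _; apply: le_v; have := ltn_ord i; lia.
exact: (leq_bigmax (F := fun i : 'I_k.+1 => v i) ord_max).
Qed.

Lemma simp_vertexP p n (s t : simp p n) :
  (forall k, (k <= p)%N -> vertex s k = vertex t k) -> s = t.
Proof.
move=> h; apply: simpP => i; apply: ord_inj.
by have := h i (ltn_ord i); rewrite /vertex inord_val.
Qed.

Definition val0 n (c : Gamma_obj koszul n) (a : nat) : R :=
  val c 0%N (simplex_of 0 n (nth 0%N [:: a])) 0 ord0.
Definition val1 n (c : Gamma_obj koszul n) (k : 'I_2) (a b : nat) : R :=
  val c 1%N (simplex_of 1 n (nth 0%N [:: a; b])) 0 k.
Definition val2 n (c : Gamma_obj koszul n) (a b d : nat) : R :=
  val c 2%N (simplex_of 2 n (nth 0%N [:: a; b; d])) 0 ord0.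

(* A chain map on the simplex is determined by its values on the faces through
   the vertex 0, and these values are arbitrary; taking differences of them
   gives the basis dual to gen_elt. *)
Definition gen_coord n (b : gen) (c : Gamma_obj koszul n) : R :=
  let: (l, i, j) := b in
  match l with
  | 0 => val0 c 0
  | 1 => val1 c ord0 0 i - val1 c ord0 0 i.-1
  | 2 => val1 c ord_max 0 i - val1 c ord_max 0 i.-1
  | 3 => val2 c 0 i j - val2 c 0 i.-1 j - val2 c 0 i j.-1 + val2 c 0 i.-1 j.-1
  | _ => 0
  end.

Lemma coordP n (b : gen) (a : R) (x y : Gamma_obj koszul n) :
  gen_coord b (a *: x + y) = a * gen_coord b x + gen_coord b y.
Proof.
case: b => [[l i] j].
have L p (s : simp p n) k : val (a *: x + y) p s 0 k = a * val x p s 0 k + val y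
  p s 0 k.
  by rewrite [LHS]mxE [X in X + _ = _]mxE.
rewrite /gen_coord /val0 /val1 /val2.
by case: l => [|[|[|[|l]]]]; rewrite ?L; try ring; rewrite mulr0 addr0.
Qed.

Lemma coord_gen n b b' : b \in gens n -> b' \in gens n ->
  gen_coord b (gen_elt n b') = (b == b')%:R.
Proof.
case: b b' => [[l i] j] [[l' i'] j']; rewrite !mem_gens !xpair_eqE /= => hb hb'.
have v0 : forall k, (k <= 0)%N -> vertex (simplex_of 0 n (nth 0%N [:: 0%N])) k =
  0%N.
  by move=> k; rewrite leqn0 => /eqP->; rewrite vertex_simplex_of.
have v1 a k : (a <= n)%N -> (k <= 1)%N ->
    vertex (simplex_of 1 n (nth 0%N [:: 0; a]%N)) k = nth 0%N [:: 0; a]%N k.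
  by move=> an k1; rewrite vertex_simplex_of // => -[|m] //.
have v2 a b k : (a <= b <= n)%N -> (k <= 2)%N ->
    vertex (simplex_of 2 n (nth 0%N [:: 0; a; b]%N)) k = nth 0%N [:: 0; a; b]%N k.
  by move=> ab k2; rewrite vertex_simplex_of //=; [case=> [|[|]] //= _; lia|lia].
rewrite /val0 /val1 /val2 !mxE.
case: l hb => [|[|[|[|l]]]] // hb; case: l' hb' => [|[|[|[|l']]]] // hb';
  rewrite /= ?v0 ?v1 ?v2 /= ?subrr //; try lia; try ring.
- by rewrite (_ : _ && _ = true) //; lia.
- by rewrite (_ : (_ <= _)%N = false) ?mulr0 //; lia.
- by rewrite (_ : (_ <= _)%N = false) ?mulr0 //; lia.
- have -> : (0 < i' <= i = (0 < i' <= i.-1) + ((i == i') && (j == j')) :> nat)%N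
  by lia.
  by rewrite natrD; ring.
- by rewrite (_ : (i' <= 0)%N = false) ?mulr0 ?subrr //; lia.
- have -> : (0 < i' <= i = (0 < i' <= i.-1) + ((i == i') && (j == j')) :> nat)%N
  by lia.
  by rewrite natrD; ring.
- by rewrite (_ : (i' <= 0)%N = false) ?mulr0 ?subrr //; lia.
(* The mixed second difference of the indicators singles out one pair of thresholds; moving the
   negative terms across turns it into an identity of natural numbers. *)
set A := (X in X - _ - _ + _); set B := (X in _ - X - _ + _).
set C := (X in _ - X + _); set D := (X in _ - _ + X).
have H : A + D = ((i == i') && (j == j'))%:R + B + C.
  by rewrite /A /B /C /D -!natrD; congr (_%:R); lia.
by apply: (addIr (B + C)); rewrite [RHS]addrA -H; ring.
Qed.

Lemma Gamma_koszul_rel n (c : Gamma_obj koszul n) p (s : simp p.+1 n) k :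
  \sum_(j < koszul_rank p.+1) val c p.+1 s 0 j * koszul_mx p j k =
  \sum_(i < p.+2) (-1) ^+ i * val c p (simp_comp s (coface i)) 0 k.
Proof.
have /asboolP[_ cd] := valP c; have /matrixP/(_ 0 k) := cd p s.
by rewrite mxE summxE => ->; apply: eq_bigr => i _; rewrite mxE.
Qed.

Lemma Gamma_koszul_degenerate n (c : Gamma_obj koszul n) p (s : simp p n) k :
  (k < p)%N -> vertex s k = vertex s k.+1 -> val c p s = 0.
Proof.
move=> kp e; have /asboolP[c0 _] := valP c; apply: c0;
  apply/negP => /injectiveP inj.
have := inj (inord k) (inord k.+1) (ord_inj e) => /(congr1 (@nat_of_ord _)).
by rewrite !inordK //; lia.
Qed.

(** The differential expresses every value through those on simplices containing the vertex 0, and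
    the latter vanish by telescoping the coordinates, starting from degenerate simplices. *)
Lemma coord_eq0 n (c : Gamma_obj koszul n) :
  (forall b, b \in gens n -> gen_coord b c = 0) -> c = 0.
Proof.
move=> c0.
have V1 a b k : (a <= b <= n)%N -> (k <= 1)%N ->
    vertex (simplex_of 1 n (nth 0%N [:: a; b])) k = nth 0%N [:: a; b] k.
  by move=> ab k1; rewrite vertex_simplex_of /= //; [case=> //= _; lia|lia].
have V2 a b d k : (a <= b)%N -> (b <= d <= n)%N -> (k <= 2)%N ->
    vertex (simplex_of 2 n (nth 0%N [:: a; b; d])) k = nth 0%N [:: a; b; d] k.
  by move=> ab bd k2; rewrite vertex_simplex_of /= //; [case=> [|[|]] //= _;
    lia|lia].
have V3 a b d e k : (a <= b)%N -> (b <= d)%N -> (d <= e <= n)%N -> (k <= 3)%N ->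
    vertex (simplex_of 3 n (nth 0%N [:: a; b; d; e])) k = nth 0%N [:: a; b; d; e] k.
  by move=> ab bd de k2; rewrite vertex_simplex_of /= //;
    [case=> [|[|[|]]] //= _; lia|lia].
have val2_eq a b d (s : simp 2 n) k : (a <= b)%N -> (b <= d <= n)%N ->
    vertex s 0 = a -> vertex s 1 = b -> vertex s 2 = d -> val c 2 s 0 k = val2 c
      a b d.
  move=> ab bd s0 s1 s2; rewrite /val2 (ord1 k); congr (val c 2 _ 0 _);
    apply: simp_vertexP => l l2.
  by rewrite V2 //; case: l l2 => [|[|[|]]].
have val1_eq a b (s : simp 1 n) k : (a <= b <= n)%N ->
    vertex s 0 = a -> vertex s 1 = b -> val c 1 s 0 k = val1 c k a b.
  move=> ab s0 s1; rewrite /val1; congr (val c 1 _ 0 _);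
    apply: simp_vertexP => l l2.
  by rewrite V1 //; case: l l2 => [|[|]].
have val0_eq a (s : simp 0 n) k : (a <= n)%N -> vertex s 0 = a -> val c 0%N s 0 k
  = val0 c a.
  move=> an s0; rewrite /val0 (ord1 k); congr (val c 0%N _ 0 _);
    apply: simp_vertexP => l.
  by rewrite leqn0 => /eqP->; rewrite vertex_simplex_of.
(* The Koszul complex is zero in degree 3, so the alternating sum over the faces of a 3-simplex
   vanishes. *)
have R2 a b d e : (a <= b)%N -> (b <= d)%N -> (d <= e <= n)%N ->
    val2 c b d e = val2 c a d e - val2 c a b e + val2 c a b d.
  move=> ab bd de.
  have := Gamma_koszul_rel c (simplex_of 3 n (nth 0%N [:: a; b; d; e])) ord0.
  rewrite !big_ord_recl !big_ord0 /=.
  rewrite (@val2_eq b d e) 1?(@val2_eq a d e) 1?(@val2_eq a b e) 1?(@val2_eq a b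
    d) ?vertex_coface ?V3 //=; try lia.
  rewrite /bump /= => H; apply/eqP; rewrite -subr_eq0; apply/eqP.
  by rewrite [RHS](H : 0 = _); ring.
have R1 k a b d : (a <= b)%N -> (b <= d <= n)%N ->
    val1 c k b d = val1 c k a d - val1 c k a b + val2 c a b d * koszul_mx 1 ord0 k.
  move=> ab bd.
  have := Gamma_koszul_rel c (simplex_of 2 n (nth 0%N [:: a; b; d])) k.
  rewrite !big_ord_recl !big_ord0 /=.
  rewrite (@val2_eq a b d) 1?(@val1_eq b d) 1?(@val1_eq a d) 1?(@val1_eq a b)
    ?vertex_coface ?V2 //=; try lia.
  by rewrite addr0 => ->; ring.
have R0 a b : (a <= b <= n)%N ->
    val0 c b = val0 c a + val1 c ord0 a b * f + val1 c ord_max a b * g.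
  move=> ab.
  have := Gamma_koszul_rel c (simplex_of 1 n (nth 0%N [:: a; b])) ord0.
  rewrite !big_ord_recl !big_ord0 /= !(@val1_eq a b) 1?(@val0_eq b) 1?(@val0_eq
    a) ?vertex_coface ?V1 //=; try lia.
  rewrite !mxE /= addr0 (_ : fintype.lift ord0 ord0 = ord_max); last exact: ord_inj.
  by move=> H; rewrite -addrA H; ring.
have D2 a d : (a <= d <= n)%N -> val2 c a a d = 0 /\ val2 c a d d = 0.
  by move=> ad; split; rewrite /val2;
    [rewrite (@Gamma_koszul_degenerate _ _ _ _ 0%N) | rewrite
    (@Gamma_koszul_degenerate _ _ _ _ 1%N)];
    rewrite ?mxE // !V2 //=; lia.
have D1 k a : (a <= n)%N -> val1 c k a a = 0.
  by move=> an; rewrite /val1 (@Gamma_koszul_degenerate _ _ _ _ 0%N) ?mxE // !V1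
    //=; lia.
have W1 k i : (i <= n)%N -> val1 c k 0 i = 0.
  elim: i => [|i IHi] ni; first exact: D1.
  have k01 : k = ord0 \/ k = ord_max.
    by case: k {IHi} => [[|[|//]] ?]; [left|right]; apply: ord_inj.
  have h l : (0 < l < 3)%N -> (l, i.+1, 0)%N \in gens n.
    by rewrite mem_gens; case: l => [|[|[|l]]]; lia.
  case: k01 IHi => -> IHi.
    by have := c0 _ (h 1%N isT); rewrite /= IHi ?subr0 //; lia.
  by have := c0 _ (h 2%N isT); rewrite /= IHi ?subr0 //; lia.
have W2 i j : (i <= j <= n)%N -> val2 c 0 i j = 0.
  elim: i j => [|i IHi] j; first by case/D2.
  elim: j => [//|j IHj] ij; have [e|/eqP ne] := eqVneq i j.
    by rewrite e; case: (@D2 0%N j.+1); [lia|].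
  have h : (3, i.+1, j.+1)%N \in gens n by rewrite mem_gens; lia.
  have := c0 _ h; rewrite /= !IHi ?IHj; try lia.
  by rewrite !subr0 addr0.
have T : val0 c 0 = 0 by apply: (c0 (0, 0, 0)%N).
have W0 a : (a <= n)%N -> val0 c a = 0.
  by move=> an; rewrite (@R0 0%N a) // T !W1 // !mul0r !addr0.
have U2 a b d : (a <= b)%N -> (b <= d <= n)%N -> val2 c a b d = 0.
  by move=> ab bd; rewrite (@R2 0%N a b d) // !W2 ?subrr ?addr0 //; lia.
have U1 k a b : (a <= b <= n)%N -> val1 c k a b = 0.
  by move=> ab; rewrite (@R1 k 0%N a b) // !W1 ?W2 ?mul0r ?subrr ?addr0 //; lia.
apply: gen_elt_ext => p s k; rewrite [RHS]mxE.
have v01 := vertex_mono s (k := 0%N) (l := 1%N).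
have v12 := vertex_mono s (k := 1%N) (l := 2%N).
case: p s k v01 v12 => [|[|[|p]]] s k v01 v12.
- by rewrite (val0_eq (vertex s 0)) ?W0 ?vertex_le.
- by rewrite (val1_eq (vertex s 0) (vertex s 1)) ?U1 ?v01 ?vertex_le.
- by rewrite (val2_eq (vertex s 0) (vertex s 1) (vertex s 2)) ?U2 ?v01 ?v12
  ?vertex_le.
by case: k.
Qed.

(** Both sides have the same coordinates by [coord_gen], and [coord_eq0] concludes; so the
    generators in [gens n] form a basis. *)
Lemma coord_sum n (x : Gamma_obj koszul n) :
  x = \sum_(b : seq_sub (gens n)) gen_coord (val b) x *: gen_elt n (val b).
Proof.
apply/eqP; rewrite -subr_eq0; apply/eqP/coord_eq0 => b bn.
have coord0 : gen_coord b (0 : Gamma_obj koszul n) = 0.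
  case: b {bn} => [[l i] j]; rewrite /gen_coord /val0 /val1 /val2.
  by case: l => [|[|[|[|l]]]]; rewrite ?mxE ?subrr ?addr0.
have coordZ a y : gen_coord b (a *: y : Gamma_obj koszul n) = a * gen_coord b y.
  by have := coordP b a y 0; rewrite !addr0 coord0 addr0.
have coordD y z : gen_coord b (y + z : Gamma_obj koszul n) = gen_coord b y +
  gen_coord b z.
  by have := coordP b 1 y z; rewrite scale1r mul1r.
rewrite coordD -scaleN1r coordZ (big_morph _ coordD coord0).
rewrite (bigD1 (SeqSub bn)) //= coordZ coord_gen // eqxx mulr1 big1 ?addr0.
  by rewrite mulN1r subrr.
move=> b' nb; rewrite coordZ coord_gen ?(valP b') //.
by rewrite eq_sym (negPf (_ : val b' != b)) ?mulr0 //;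
  apply: contra nb => /eqP e; apply/eqP/val_inj.
Qed.
End Koszul.

(** * Symmetric powers of modules with a basis *)

Section FreegLift.
Variables (R : comNzRingType) (K : choiceType) (W : lmodType R) (h : K -> W).

Lemma fglift_linear : linear (fglift h : {freeg K / R} -> W).
Proof.
have hB : zmod_morphism (fglift h : {freeg K / R} -> W).
  by move=> u v; apply: lift_is_additive.
pose F : {additive _ -> _} :=
  HB.pack (fglift h : {freeg K / R} -> W) (GRing.isZmodMorphism.Build _ _ _ hB).
have FZ a (t : {freeg K / R}) : F (a *: t) = a *: F t.
  rewrite -[t]freeg_sumE scaler_sumr !raddf_sum.
  apply: eq_bigr => x _.
  have -> : a *: << coeff x t *g x >> = << a * coeff x t *g x >>.
    by apply/eqP/freeg_eqP => y; rewrite coeffZ !coeffU mulrA.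
  by rewrite /= !liftU scalerA.
by move=> a u v; rewrite -[fglift h]/(F : _ -> _) raddfD FZ.
Qed.
End FreegLift.

Section SymLift.
Variables (R : comNzRingType) (n : nat) (M W : lmodType R).

Definition multilinear (psi : {ffun 'I_n -> M} -> W) : Prop := forall x i a u v,
  psi (subst_at x i (a *: u + v)) = a *: psi (subst_at x i u) + psi (subst_at x i
    v).

Section Lift.
Variable psi : {ffun 'I_n -> M} -> W.
Hypotheses (psi_lin : multilinear psi).
Hypothesis (psi_sym : forall (x : {ffun 'I_n -> M}) (s : 'S_n), psi [ffun j => x
  (s j)] = psi x).

Definition tensor_lift : {linear {freeg {ffun 'I_n -> M} / R} -> W} :=
  linear_of (fglift_linear psi).

Lemma tensor_lift_gen x : tensor_lift (@tensor_gen R n M x) = psi x.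
Proof. by rewrite /tensor_lift /= liftU scale1r. Qed.

Lemma tensor_lift_span t : t \in span (@Sym_relation R n M) -> tensor_lift t = 0.
Proof.
move: tensor_lift tensor_lift_gen => F FE /asboolP[r [hr ->]].
rewrite raddf_sum big_seq big1 // => -[c t'] /hr /= hp; rewrite linearZ_LR /=.
case: hp => [x i a u v|x s]; last by rewrite raddfB /= !FE psi_sym subrr scaler0.
by rewrite raddfB /= linearP /= !FE psi_lin subrr scaler0.
Qed.

Definition Sym_lift_fun (q : Sym n M) : W := tensor_lift (repr (q : quot_mod _)).

Lemma Sym_lift_pi t : Sym_lift_fun (quot_pi (span (@Sym_relation R n M)) t) =
  tensor_lift t.
Proof.
apply/eqP; rewrite -subr_eq0 -raddfB; apply/eqP/tensor_lift_span.
by apply/quot_pi_eq; rewrite quot_piK.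
Qed.

Lemma Sym_lift_linear : linear Sym_lift_fun.
Proof.
move=> a p q; rewrite -[p]quot_piK -[q]quot_piK -linearP !Sym_lift_pi.
by rewrite linearP.
Qed.

Definition Sym_lift : {linear Sym n M -> W} := linear_of Sym_lift_linear.

Lemma Sym_lift_prod x : Sym_lift (sym_prod x) = psi x.
Proof. by rewrite [LHS]Sym_lift_pi tensor_lift_gen. Qed.
End Lift.
End SymLift.

Section SymProd.
Variables (R : comNzRingType) (n : nat) (M : lmodType R).

Lemma sym_prod_multilinear : multilinear (@sym_prod R n M).
Proof.
move=> x i a u v; rewrite -linearP; apply/quot_pi_eq/asboolP.
exists [:: (1, @tensor_gen R n M (subst_at x i (a *: u + v))
               - (a *: @tensor_gen R n M (subst_at x i u) + @tensor_gen R n M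
                 (subst_at x i v)))].
split; last by rewrite big_seq1 scale1r.
by move=> p; rewrite mem_seq1 => /eqP-> /=; constructor.
Qed.

Lemma sym_prod_perm (x : {ffun 'I_n -> M}) (s : 'S_n) : sym_prod [ffun j => x (s
  j)] = sym_prod x :> Sym n M.
Proof.
apply/quot_pi_eq/asboolP.
exists [:: (1, @tensor_gen R n M [ffun j => x (s j)] - @tensor_gen R n M x)].
split; last by rewrite big_seq1 scale1r.
by move=> p; rewrite mem_seq1 => /eqP-> /=; constructor.
Qed.
End SymProd.

Section Basis.
Variables (R : comNzRingType) (n : nat) (M W : lmodType R) (B : finType).
Variables (e : B -> M) (phi : B -> M -> R).
Hypothesis phi_lin : forall b a x y, phi b (a *: x + y) = a * phi b x + phi b y.
Hypothesis e_gen : forall x, x = \sum_b phi b x *: e b.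
Hypothesis phi_e : forall b b', phi b (e b') = (b == b')%:R.

Lemma multilinear_sum (psi : {ffun 'I_n -> M} -> W) (psi_lin : multilinear psi)
    x i (I : Type) (r : seq I) (c : I -> R) (u : I -> M) :
  psi (subst_at x i (\sum_(k <- r) c k *: u k)) =
  \sum_(k <- r) c k *: psi (subst_at x i (u k)).
Proof.
pose f y : W := psi (subst_at x i y).
have fL : linear f by move=> a y z; apply: psi_lin.
rewrite -[LHS]/(linear_of fL _) raddf_sum; apply: eq_bigr => k _.
exact: (linearZ_LR (linear_of fL)).
Qed.

Lemma multilinear_ext (psi psi' : {ffun 'I_n -> M} -> W) :
  multilinear psi -> multilinear psi' ->
  (forall t : {ffun 'I_n -> B}, psi [ffun i => e (t i)] = psi' [ffun i => e (t
    i)]) ->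
  psi =1 psi'.
Proof.
move=> L L' h x.
(* Induction on the number [k] of slots still allowed to be arbitrary; the last of them is expanded
   in the basis. *)
suff H k : (k <= n)%N -> forall x : {ffun 'I_n -> M},
    (forall i : 'I_n, (k <= i)%N -> exists b, x i = e b) -> psi x = psi' x.
  by apply: (H n) => // i; rewrite leqNgt ltn_ord.
elim: k => [_ {}x hx|k IHk kn {}x hx].
  have [t tE] := choice (fun i => hx i isT).
  have -> : x = [ffun i => e ([ffun i => t i] i)].
    by apply/ffunP => i; rewrite !ffunE tE.
  exact: h.
pose i0 := Ordinal kn.
have -> : x = subst_at x i0 (\sum_b phi b (x i0) *: e b).
  by rewrite -e_gen; apply/ffunP => i; rewrite ffunE; case: eqP => [->|].
rewrite !multilinear_sum //; apply: eq_bigr => b _; congr (_ *: _).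
apply: IHk => [|i ki]; first exact: ltnW.
rewrite ffunE; case: eqP => [_|/eqP ne]; first by exists b.
by apply: hx; rewrite ltn_neqAle ki andbT; apply: contra ne => /eqP ki';
  apply/eqP/val_inj.
Qed.

Lemma Sym_ext_basis (F G : {linear Sym n M -> W}) :
  (forall t : {ffun 'I_n -> B}, F (sym_prod [ffun i => e (t i)]) = G (sym_prod
    [ffun i => e (t i)])) ->
  F =1 G.
Proof.
move=> h; apply: Sym_ext; apply: multilinear_ext => // x i a u v.
  by rewrite sym_prod_multilinear linearP.
by rewrite sym_prod_multilinear linearP.
Qed.

Section Form.
Variable U : {ffun 'I_n -> B} -> W.

(** The multilinear map with values [U] on tuples of basis elements; for symmetric [U] it defines a
    linear map out of the symmetric power by its values on monomials. *)
Definition basis_form (x : {ffun 'I_n -> M}) : W :=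
  \sum_(t : {ffun 'I_n -> B}) (\prod_i phi (t i) (x i)) *: U t.

Lemma basis_form_multilinear : multilinear basis_form.
Proof.
move=> x i a u v; rewrite /basis_form scaler_sumr -big_split;
  apply: eq_bigr => t _ /=.
rewrite scalerA -scalerDl; congr (_ *: _).
rewrite !(bigD1 i (P := predT)) //= !ffunE eqxx phi_lin.
have E w : \prod_(j | j != i) phi (t j) (subst_at x i w j) = \prod_(j | j != i)
  phi (t j) (x j).
  by apply: eq_bigr => j /negPf ji; rewrite ffunE ji.
by rewrite !E; ring.
Qed.

Lemma basis_form_sym (x : {ffun 'I_n -> M}) (s : 'S_n) :
  (forall (t : {ffun 'I_n -> B}) (s : 'S_n), U [ffun j => t (s j)] = U t) ->
  basis_form [ffun j => x (s j)] = basis_form x.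
Proof.
move=> Us; rewrite /basis_form (reindex (fun t : {ffun 'I_n -> B} => [ffun j => t
  (s j)])).
  apply: eq_bigr => t _; rewrite Us; congr (_ *: _).
  by rewrite [RHS](reindex_perm s); apply: eq_bigr => i _; rewrite !ffunE.
exists (fun t : {ffun 'I_n -> B} => [ffun j => t ((s^-1)%g j)]) => t _;
  by apply/ffunP => j; rewrite !ffunE ?permK ?permKV.
Qed.

Lemma basis_form_basis (t : {ffun 'I_n -> B}) : basis_form [ffun i => e (t i)] =
  U t.
Proof.
rewrite /basis_form (bigD1 t) //= [X in X *: _]big1 => [|i _];
  last by rewrite ffunE phi_e eqxx.
rewrite scale1r big1 ?addr0 // => t' /eqP nt.
have [i ti] : exists i, t' i != t i.
  by apply: contrapT => h; apply: nt; apply/ffunP => i;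
    apply/eqP/negPn/negP => ti; apply: h; exists i.
by rewrite (bigD1 i) //= ffunE phi_e (negPf ti) mul0r scale0r.
Qed.
End Form.
End Basis.

(** * Formal linear combinations over Z[f, g] *)

(* The term (c, a, b, k) stands for c f^a g^b k. *)
Definition lin (K : Type) := seq (int * nat * nat * K).

Section Lin.
Local Open Scope nat_scope.
Implicit Types (K L : Type).

Definition lin1 K (k : K) : lin K := [:: (Posz 1, 0, 0, k)].

Definition lin_map K L (h : K -> L) (u : lin K) : lin L :=
  [seq (t.1, h t.2) | t <- u].

(** The bare integer operations, here and in [lin_add], keep these functions suitable for
    [vm_compute]. Throughout, [Negz 0] is -1. *)
Definition lin_scale K (c : int) (a b : nat) (u : lin K) : lin K :=
  [seq (intRing.mulz c t.1.1.1, a + t.1.1.2, b + t.1.2, t.2) | t <- u].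

Definition lin_bind K L (h : K -> lin L) (u : lin K) : lin L :=
  flatten [seq lin_scale t.1.1.1 t.1.1.2 t.1.2 (h t.2) | t <- u].

Fixpoint lin_add (K : eqType) (t : int * nat * nat * K) (u : lin K) : lin K :=
  if u is t' :: u' then
    if (t.1.1.2 == t'.1.1.2) && (t.1.2 == t'.1.2) && (t.2 == t'.2)
    then (intZmod.addz t.1.1.1 t'.1.1.1, t.1.1.2, t.1.2, t.2) :: u'
    else t' :: lin_add t u'
  else [:: t].

Definition lin_norm (K : eqType) (u : lin K) : lin K :=
  [seq t <- foldr (@lin_add K) [::] u | t.1.1.1 != Posz 0].

Definition lin_sub K (u v : lin K) : lin K := u ++ lin_scale (Negz 0) 0 0 v.

Definition lin_eq (K : eqType) (u v : lin K) : bool := nilp (lin_norm (lin_sub u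
  v)).

Fixpoint lin_prod K (us : seq (lin K)) : lin (seq K) :=
  if us is u :: us' then lin_bind (fun k => lin_map (cons k) (lin_prod us')) u
  else lin1 [::].
End Lin.

Section Eval.
Variables (R : comNzRingType) (f g : R) (W : lmodType R).

Definition lin_eval (K : Type) (w : K -> W) (u : lin K) : W :=
  \sum_(t <- u) (t.1.1.1%:~R * f ^+ t.1.1.2 * g ^+ t.1.2) *: w t.2.

Lemma lin_eval1 K (w : K -> W) k : lin_eval w (lin1 k) = w k.
Proof. by rewrite /lin_eval big_seq1 !expr0 !mulr1 scale1r. Qed.

Lemma lin_eval_cat K (w : K -> W) u v :
  lin_eval w (u ++ v) = lin_eval w u + lin_eval w v.
Proof. exact: big_cat. Qed.

Lemma lin_eval_map K L (w : L -> W) (h : K -> L) u :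
  lin_eval w (lin_map h u) = lin_eval (w \o h) u.
Proof. exact: big_map. Qed.

Lemma lin_eval_scale K (w : K -> W) c a b u :
  lin_eval w (lin_scale c a b u) = (c%:~R * f ^+ a * g ^+ b) *: lin_eval w u.
Proof.
rewrite /lin_eval big_map scaler_sumr; apply: eq_bigr => t _ /=.
rewrite scalerA !exprD (_ : intRing.mulz c _ = c * t.1.1.1) // intrM.
by congr (_ *: _); ring.
Qed.

Lemma lin_eval_bind K L (w : L -> W) (h : K -> lin L) u :
  lin_eval w (lin_bind h u) = lin_eval (fun k => lin_eval w (h k)) u.
Proof.
rewrite /lin_eval /lin_bind big_flatten big_map; apply: eq_bigr => t _.
exact: lin_eval_scale.
Qed.

Lemma lin_eval_add (K : eqType) (w : K -> W) t u :
  lin_eval w (lin_add t u) = lin_eval w (t :: u).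
Proof.
elim: u => [//|t' u IHu] /=; case: ifP => [|_].
  move=> /andP[/andP[/eqP e1 /eqP e2] /eqP e3];
    rewrite /lin_eval !big_cons /= addrA.
  rewrite -e1 -e2 -e3 -scalerDl -!mulrDl (_ : intZmod.addz _ _ = t.1.1.1 +
    t'.1.1.1) //.
  by rewrite intrD.
by move: IHu; rewrite /lin_eval !big_cons => ->; rewrite addrCA.
Qed.

Lemma lin_eval_norm (K : eqType) (w : K -> W) u : lin_eval w (lin_norm u) =
  lin_eval w u.
Proof.
have -> : lin_eval w u = lin_eval w (foldr (@lin_add K) [::] u).
  by elim: u => [//|t u IHu]; rewrite [RHS]lin_eval_add /lin_eval !big_cons [X in
    _ + X]IHu.
rewrite /lin_eval big_filter big_mkcond; apply: eq_bigr => t _.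
by case: eqP => // ->; rewrite mul0r mul0r scale0r.
Qed.

Lemma lin_eval_sub K (w : K -> W) u v :
  lin_eval w (lin_sub u v) = lin_eval w u - lin_eval w v.
Proof. by rewrite lin_eval_cat lin_eval_scale !expr0 !mulr1 scaleN1r. Qed.

(** The bridge from computation to modules: an identity over Z[f, g], decided by normalization, is
    specialized to the given elements of R. *)
Lemma lin_eqP (K : eqType) (w : K -> W) u v : lin_eq u v -> lin_eval w u =
  lin_eval w v.
Proof.
move=> /nilP uv; apply/eqP; rewrite -subr_eq0 -lin_eval_sub -lin_eval_norm uv.
by rewrite /lin_eval big_nil.
Qed.

Lemma eq_lin_eval (K : eqType) (w w' : K -> W) u :
  (forall t, t \in u -> w t.2 = w' t.2) -> lin_eval w u = lin_eval w' u.
Proof. by move=> h; apply: eq_big_seq => t /h ->. Qed.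
End Eval.

Lemma lin_eval_linear (R : comNzRingType) (f g : R) (W W' : lmodType R) (F :
  {linear W -> W'})
    (K : Type) (w : K -> W) u :
  F (lin_eval f g w u) = lin_eval f g (F \o w) u.
Proof. by rewrite /lin_eval raddf_sum; apply: eq_bigr => t _;
  apply: (linearZ_LR F). Qed.

(** * The contraction onto a sum of shifted Koszul complexes *)

Section Contraction.
Local Open Scope nat_scope.

Definition gen_le (b b' : gen) : bool :=
  let: (l, i, j) := b in let: (l', i', j') := b' in
  (l < l') || ((l == l') && ((i < i') || ((i == i') && (j <= j')))).

Definition sort_gens : seq gen -> seq gen := sort gen_le.

Definition covers (k : nat) (b : gen) : bool := (b.1.2 == k) || (b.2 == k).

(* A monomial is degenerate along the k-th degeneracy if no factor has the
   threshold k.+1. *)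
Definition nondegenerate_gens n (m : seq gen) : bool :=
  all (fun k => has (covers k) m) (iota 1 n).

Fixpoint words (K : Type) k (u : seq K) : seq (seq K) :=
  if k is k'.+1 then [seq a :: m | a <- u, m <- words k' u] else [:: [::]].

Definition is_monomial n (m : seq gen) : bool :=
  [&& size m == 3, all (mem (gens n)) m, sorted gen_le m & nondegenerate_gens n m].

Definition monomials n : seq (seq gen) :=
  [seq m <- words 3 (gens n) | sorted gen_le m && nondegenerate_gens n m].

(** The computational form of [gen_elt_X0], [gen_elt_Y0], [gen_elt_Z0], [gen_elt_big] and
    [gen_elt_Zbig]. *)
Definition reduce_gen n (b : gen) : lin gen :=
  let: (l, i, j) := b in
  match l with
  | 0 => lin1 b
  | 1 => if i == 0 then [:: (Posz 1, 1, 0, (0, 0, 0))] else if n < i then [::]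
    else lin1 b
  | 2 => if i == 0 then [:: (Posz 1, 0, 1, (0, 0, 0))] else if n < i then [::]
    else lin1 b
  | _ => if (n < j) || (j <= i) then [::] else
         if i == 0 then [:: (Posz 1, 0, 1, (1, j, 0));
           (Negz 0, 1, 0, (2, j, 0))] else lin1 b
  end.

Definition face_monomial n k (m : seq gen) : lin (seq gen) :=
  lin_prod [seq reduce_gen n (face_gen k b) | b <- m].

(** From degree n + 1 to degree n. All faces are used and degenerate monomials dropped;
    [normalize_alternating] identifies the result with d_0 on the normalized complex. *)
Definition boundary n (m : seq gen) : lin (seq gen) :=
  lin_norm [seq t <- lin_map sort_gens
    (flatten [seq lin_scale (if odd k then Negz 0 else Posz 1) 0 0 (face_monomial
      n k m)
             | k <- iota 0 n.+2]) | nondegenerate_gens n t.2].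

Definition boundary_at n (m : seq gen) : lin (seq gen) := if n is n'.+1 then
  boundary n' m else [::].

(** The k-th face merges the thresholds k and k + 1 and so undoes the splitting; hence every
    splitting at [k] of a monomial has that monomial as its k-th face. *)
Definition split_gen k (c : bool) (b : gen) : gen :=
  let s i := if i == k then k + c else i + (k < i) in
  let: (l, i, j) := b in (l, s i, s j).

Definition splittings n (m : seq gen) : seq (seq gen) :=
  [seq sort_gens [seq split_gen p.1 q.1 q.2 | q <- zip p.2 m]
  | p <- [seq (k, c) | k <- rev (iota 1 n), c <- words 3 [:: false; true]]].

Definition unit_coef (m : seq gen) (u : lin (seq gen)) : int :=
  foldr (fun t c => if (t.1.1.2 == 0) && (t.1.2 == 0) && (t.2 == m) then t.1.1.1
    else c)
    (Posz 0) u.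

Definition is_unit (c : int) := (c == Posz 1) || (c == Negz 0).

(* Greedy acyclic matching: a monomial is matched with the first monomial,
   obtained by splitting one of its thresholds in two, which is still free and
   in whose boundary it has coefficient 1 or -1. *)
Definition match_level n (targets : seq (seq gen)) : seq (seq gen * (int * seq
  gen)) :=
  foldl (fun tab m =>
    if m \in targets then tab else
    let ok m' := [&& nondegenerate_gens n.+1 m', m' \notin [seq p.2.2 | p <- tab]
                   & is_unit (unit_coef m (boundary n m'))] in
    if [seq m' <- splittings n m | ok m'] is m' :: _
    then (m, (unit_coef m (boundary n m'), m')) :: tab else tab)
  [::] (monomials n).

Fixpoint match_levels n N targets :=
  if N is N'.+1 then
    let tab := match_level n targets in tab :: match_levels n.+1 N' [seq p.2.2 |
      p <- tab]
  else [::].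

Definition matching := Eval vm_compute in match_levels 0 6 [::].

Fixpoint assoc (K : eqType) L (d : L) (k : K) (tab : seq (K * L)) : L :=
  if tab is p :: tab' then if p.1 == k then p.2 else assoc d k tab' else d.

(** The discrete vector field V of the matching: the coefficient stored with a pair is 1 or -1,
    hence its own inverse. *)
Definition gradient n (u : lin (seq gen)) : lin (seq gen) :=
  lin_bind (fun m => if assoc None m [seq (p.1, Some p.2) | p <- nth [::]
    matching n] is Some (c, m')
    then [:: (c, 0, 0, m')] else [::]) u.

(* Iterating the flow id - dV - Vd of the matching V until it is stationary,
   and accumulating the values of V. *)
Fixpoint flow n N (h u : lin (seq gen)) : lin (seq gen) * lin (seq gen) :=
  if N is N'.+1 then
    let v := gradient n u in
    flow n N' (lin_norm (h ++ v))
      (lin_norm (lin_sub u (lin_bind (boundary n) v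
                ++ gradient n.-1 (lin_bind (boundary_at n) u))))
  else (h, u).

Local Notation T := (0, 0, 0).
Local Notation X i := (1, i, 0).
Local Notation Y i := (2, i, 0).
Local Notation Z i j := (3, i, j).

(* The monomials below are the unmatched ones.  In degrees 2 and 4 they are
   replaced by a basis whose first element ends one shifted Koszul complex and
   whose second element starts the next one. *)
Definition target_basis : seq (seq (lin (seq gen))) :=
  [:: [:: lin1 [:: T; T; T]];
      [:: lin1 [:: T; T; X 1]; lin1 [:: T; T; Y 1]];
      [:: lin1 [:: T; T; Z 1 2];
          lin_sub (lin1 [:: T; T; Z 1 2]) (lin1 [:: T; X 2; Y 1])];
      [:: lin1 [:: T; X 3; Z 1 2]; lin1 [:: T; Y 3; Z 1 2]];
      [:: lin1 [:: T; Z 1 4; Z 2 3];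
          lin_sub (lin1 [:: T; Z 1 4; Z 2 3]) (lin1 [:: X 4; Y 3; Z 1 2])];
      [:: lin1 [:: X 5; Z 1 4; Z 2 3]; lin1 [:: Y 5; Z 1 4; Z 2 3]];
      [:: lin1 [:: Z 1 6; Z 2 5; Z 3 4]]].

(** Inverse to [target_basis] on the unmatched monomials: in degrees 2 and 4, with basis b0, b1, the
    second unmatched monomial is b0 - b1. *)
Definition target_coord : seq (seq (seq gen * lin nat)) :=
  [:: [:: ([:: T; T; T], lin1 0)];
      [:: ([:: T; T; X 1], lin1 0); ([:: T; T; Y 1], lin1 1)];
      [:: ([:: T; T; Z 1 2], lin1 0); ([:: T; X 2;
        Y 1], lin_sub (lin1 0) (lin1 1))];
      [:: ([:: T; X 3; Z 1 2], lin1 0); ([:: T; Y 3; Z 1 2], lin1 1)];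
      [:: ([:: T; Z 1 4; Z 2 3], lin1 0);
          ([:: X 4; Y 3; Z 1 2], lin_sub (lin1 0) (lin1 1))];
      [:: ([:: X 5; Z 1 4; Z 2 3], lin1 0); ([:: Y 5; Z 1 4; Z 2 3], lin1 1)];
      [:: ([:: Z 1 6; Z 2 5; Z 3 4], lin1 0)]].

Definition target_rank n := nth 0 [:: 1; 2; 2; 2; 2; 2; 1] n.

(** From degree n + 1 to degree n of K + K[2] + K[4]. In degrees 2 and 4, index 0 is the top of one
    Koszul copy and index 1 the bottom of the next; degree 0 has only a bottom and degree 6 only a
    top, both of index 0. *)
Definition target_d n (k : nat) : lin nat :=
  if odd n then
    if k == 0 then [:: (Posz 1, 0, 1, 0); (Negz 0, 1, 0, 1)] else [::]
  else
    let l := if n == 0 then 0 else 1 in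
    if k == 0 then [:: (Posz 1, 1, 0, l)] else [:: (Posz 1, 0, 1, l)].

(** With Phi = 1 - dV - Vd and h the sum of V Phi^k over k < 8, telescoping gives 1 - Phi^8 = dh +
    hd. That eight rounds suffice is part of what [contractionP] verifies. *)
Definition homotopy_table := Eval vm_compute in
  [seq [seq (m, (flow n 8 [::] (lin1 m)).1) | m <- monomials n] | n <- iota 0 7].

Definition projection_table := Eval vm_compute in
  [seq [seq (m, lin_norm (lin_bind (fun m' => assoc [::] m' (nth [::]
    target_coord n))
                          (flow n 8 [::] (lin1 m)).2)) | m <- monomials n] | n <-
                            iota 0 7].

Definition inclusion_table := Eval vm_compute in
  [seq [seq (flow n 8 [::] u).2 | u <- nth [::] target_basis n] | n <- iota 0 7].

Definition contract n (m : seq gen) : lin (seq gen) := assoc [::] m (nth [::]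
  homotopy_table n).
Definition project n (m : seq gen) : lin nat := assoc [::] m (nth [::]
  projection_table n).
Definition include n (k : nat) : lin (seq gen) := nth [::] (nth [::]
  inclusion_table n) k.

Definition keys_ok n (u : lin (seq gen)) : bool := all (fun t => is_monomial n
  t.2) u.

Definition target_keys_ok n (u : lin nat) : bool := all (fun t => t.2 <
  target_rank n) u.

Definition contraction_ok n : bool :=
  [&& all (fun m => lin_eq (lin_sub (lin1 m) (lin_bind (include n) (project n m)))
              (lin_bind (boundary n) (contract n m)
               ++ lin_bind (contract n.-1) (boundary_at n m))) (monomials n),
      all (fun m => lin_eq (lin_bind (project n) (boundary n m))
              (lin_bind (target_d n) (project n.+1 m))) (monomials n.+1),
      all (fun k => lin_eq (lin_bind (boundary n) (include n.+1 k))
              (lin_bind (include n) (target_d n k))) (iota 0 (target_rank n.+1)),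
      all (fun k => lin_eq (lin_bind (project n) (include n k)) (lin1 k))
          (iota 0 (target_rank n)) &
      all (fun k => lin_eq (lin_bind (target_d n) (target_d n.+1 k)) [::])
          (iota 0 (target_rank n.+2))].

(** The evaluation of the tables in modules is known on basis monomials only, so every term that
    occurs is checked to be one. *)
Definition keys_all_ok n : bool :=
  [&& all (fun m => keys_ok n (boundary n m)) (monomials n.+1),
      all (fun m => keys_ok n.+1 (contract n m)) (monomials n),
      all (fun m => target_keys_ok n (project n m)) (monomials n),
      all (fun k => keys_ok n (include n k)) (iota 0 (target_rank n)) &
      all (fun k => target_keys_ok n (target_d n k)) (iota 0 (target_rank n.+1))].

(** The certificate of the contraction, a finite check on basis elements. Degrees above 6 are empty
    by [monomials_bound] and [target_rank_bound]. *)
Lemma contractionP : all (fun n => contraction_ok n && keys_all_ok n) (iota 0 7).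
Proof. by vm_compute. Qed.
End Contraction.

(** * Sorted monomials, degeneracy and the bound on the degree *)

Lemma mem_words (K : eqType) k (u : seq K) (m : seq K) :
  (m \in words k u) = (size m == k) && all (mem u) m.
Proof.
elim: k m => [|k IHk] m; first by rewrite mem_seq1; case: m.
apply/allpairsP/andP => [[[a m'] [/= ha hm ->]]|[]].
  by move: hm; rewrite IHk /= eqSS => /andP[-> ->]; rewrite ha.
case: m => [//|a m] /=; rewrite eqSS => hs /andP[ha hm].
by exists (a, m); rewrite IHk hs hm.
Qed.

Lemma mem_monomials n m : (m \in monomials n) = is_monomial n m.
Proof. by rewrite mem_filter mem_words /is_monomial andbC -!andbA. Qed.

Lemma gen_le_total : total gen_le.
Proof. by move=> [[l i] j] [[l' i'] j'] /=; lia. Qed.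
Lemma gen_le_trans : transitive gen_le.
Proof. by move=> [[l i] j] [[l' i'] j'] [[l2 i2] j2] /=; lia. Qed.
Lemma gen_le_anti : antisymmetric gen_le.
Proof.
move=> [[l i] j] [[l' i'] j'] /= h.
by have [-> [-> ->]] : l = l' /\ i = i' /\ j = j' by lia.
Qed.

Lemma sort_gens_perm m m' : perm_eq m m' -> sort_gens m = sort_gens m'.
Proof. by move/(perm_sortP gen_le_total gen_le_trans gen_le_anti). Qed.

Lemma nondegenerate_perm n m m' : perm_eq m m' -> nondegenerate_gens n m =
  nondegenerate_gens n m'.
Proof. by move=> mm'; apply: eq_all => k; apply: perm_has. Qed.

(** Each of the three factors has at most two thresholds, and together they must cover 1, ..., n. *)
Lemma nondegenerate_bound n m : size m = 3%N -> nondegenerate_gens n m -> (n < 7)%N.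
Proof.
move=> m3 /allP nd; rewrite ltnS.
have sub : {subset iota 1 n <= flatten [seq [:: b.1.2; b.2] | b <- m]}.
  move=> k /nd/hasP[b bm bk]; apply/flattenP; exists [:: b.1.2; b.2].
    by apply/mapP; exists b.
  by move: bk; rewrite !inE eq_sym [_ == b.2]eq_sym.
have := uniq_leq_size (iota_uniq 1 n) sub; rewrite size_iota => /leq_trans; apply.
by move: m3; case: m {nd sub} => [|? [|? [|? []]]].
Qed.

Lemma monomials_bound n m : m \in monomials n -> (n < 7)%N.
Proof.
by rewrite mem_monomials => /and4P[/eqP m3 _ _]; apply: nondegenerate_bound.
Qed.

Lemma sdeg_gen_gens c n b : (c <= n)%N -> b \in gens n -> sdeg_gen c b \in gens
  n.+1.
Proof.
case: b => [[l i] j] cn; rewrite !mem_gens.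
by case: l => [|[|[|[|]]]] // ; case: (ltnP c i) => ? /=;
  case: (ltnP c j) => ? /=; lia.
Qed.

Lemma degenerate_sdeg_gen c n m : (c <= n)%N -> ~~ nondegenerate_gens n.+1 (map
  (sdeg_gen c) m).
Proof.
move=> cn; apply/allPn; exists c.+1; first by rewrite mem_iota; lia.
rewrite has_map; apply/hasPn => -[[l i] j] _ /=; rewrite /covers /=.
by case: (ltnP c i) => ? /=; case: (ltnP c j) => ? /=; lia.
Qed.

(** * A basis of the normalized complex of Sym^3 Gamma(K) *)

Section MonomialModule.
Variables (R : comNzRingType) (f g : R).
Local Notation K := (koszul f g).
Local Notation A := (Gamma K).
Local Notation S := (Sym_simplicial 3 A).
Local Notation ev := (lin_eval f g).

Definition monomial n (m : seq gen) : S n :=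
  sym_prod [ffun i : 'I_3 => gen_elt f g n (nth (0, 0, 0)%N m i)].

Lemma monomial_perm n m m' : size m = 3%N -> perm_eq m m' -> monomial n m =
  monomial n m'.
Proof.
move=> m3 mm'; have m3' : size m' = 3%N by rewrite -(perm_size mm').
have /tuple_permP[p pE] : perm_eq (Tuple (introT eqP m3)) (Tuple (introT eqP
  m3')) by [].
rewrite /monomial -[RHS](sym_prod_perm _ p); congr (sym_prod _); apply/ffunP => i.
rewrite !ffunE; congr (gen_elt _ _ _ _).
rewrite -[m]/(tval (Tuple (introT eqP m3))) pE (nth_map i) ?size_enum_ord //
  nth_ord_enum.
by rewrite (tnth_nth (0, 0, 0)%N).
Qed.

Lemma monomial_sort n m : size m = 3%N -> monomial n (sort_gens m) = monomial n m.
Proof. by move=> m3; apply: monomial_perm; rewrite ?size_sort ?perm_sort. Qed.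

Lemma reduce_genE n (b : gen) : (b.1.1 < 4)%N ->
  gen_elt f g n b = ev (gen_elt f g n) (reduce_gen n b).
Proof.
case: b => [[l i] j]; case: l => [|[|[|[|//]]]] _; rewrite /reduce_gen.
- by rewrite lin_eval1.
- case: eqP => [->|_]; first by rewrite gen_elt_X0 /lin_eval big_seq1 expr1 expr0
  mulr1 mul1r.
  case: ltnP => ni; last by rewrite lin_eval1.
  by rewrite gen_elt_big // /lin_eval big_nil.
- case: eqP => [->|_]; first by rewrite gen_elt_Y0 /lin_eval big_seq1 expr1 expr0
  mulr1 mul1r.
  case: ltnP => ni; last by rewrite lin_eval1.
  by rewrite gen_elt_big // /lin_eval big_nil.
case: ifP => h; first by rewrite gen_elt_Zbig // /lin_eval big_nil.
case: eqP => [->|_]; last by rewrite lin_eval1.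
rewrite gen_elt_Z0 /lin_eval !big_cons big_nil addr0 /= !expr1 !expr0 !mulr1 !mul1r.
by rewrite mulN1r scaleNr.
Qed.

Lemma monomial_prod n (us : seq (lin gen)) : size us = 3%N ->
  sym_prod [ffun i : 'I_3 => ev (gen_elt f g n) (nth [::] us i)] = ev (monomial
    n) (lin_prod us).
Proof.
case: us => [|u0 [|u1 [|u2 []]]] // _.
pose tri (a b c : Gamma_obj K n) : {ffun 'I_3 -> Gamma_obj K n} := [ffun i : 'I_3
  => nth a [:: a; b; c] i].
pose i0 : 'I_3 := ord0; pose i1 : 'I_3 := inord 1; pose i2 : 'I_3 := ord_max.
have s0 a b c x : subst_at (tri a b c) i0 x = tri x b c.
  by apply/ffunP => -[[|[|[|//]]] ?]; rewrite !ffunE -!val_eqE /=.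
have s1 a b c x : subst_at (tri a b c) i1 x = tri a x c.
  by apply/ffunP => -[[|[|[|//]]] ?]; rewrite !ffunE -!val_eqE /= inordK.
have s2 a b c x : subst_at (tri a b c) i2 x = tri a b x.
  by apply/ffunP => -[[|[|[|//]]] ?]; rewrite !ffunE -!val_eqE /=.
have -> : [ffun i : 'I_3 => ev (gen_elt f g n) (nth [::] [:: u0; u1; u2] i)] =
    tri (ev (gen_elt f g n) u0) (ev (gen_elt f g n) u1) (ev (gen_elt f g n) u2).
  by apply/ffunP => -[[|[|[|//]]] ?]; rewrite !ffunE.
have L := @sym_prod_multilinear R 3 (Gamma_obj K n).
rewrite -(s0 0) multilinear_sum // /lin_prod lin_eval_bind;
  apply: eq_bigr => t0 _; congr (_ *: _).
rewrite s0 -(s1 _ 0) multilinear_sum // lin_eval_map lin_eval_bind;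
  apply: eq_bigr => t1 _; congr (_ *: _).
rewrite s1 -(s2 _ _ 0) multilinear_sum // lin_eval_map lin_eval_bind;
  apply: eq_bigr => t2 _; congr (_ *: _).
rewrite s2 lin_eval_map lin_eval1; congr (sym_prod _).
by apply/ffunP => -[[|[|[|//]]] ?]; rewrite !ffunE.
Qed.

Lemma face_monomialE n (k : 'I_n.+2) m : size m = 3%N -> all (fun b => b.1.1 <
  4)%N m ->
  face S k (monomial n.+1 m) = ev (monomial n) (face_monomial n k m).
Proof.
move=> m3 m4; rewrite -monomial_prod ?size_map // [LHS]Sym_map_prod;
  congr (sym_prod _).
apply/ffunP => i; rewrite !ffunE (nth_map (0, 0, 0)%N) ?m3 //.
rewrite [LHS]face_gen_elt reduce_genE //.
have im : (i < size m)%N by rewrite m3.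
by have := allP m4 _ (mem_nth (0, 0, 0)%N im); case: nth => [[]].
Qed.

Definition nmonomial n (m : seq gen) : S n := normalize S n (monomial n m).

(** If no threshold equals k, every factor is s_{k-1} of its face k - 1; the product is then
    degenerate and [normalize] kills it. *)
Lemma nmonomial_degenerate n m : size m = 3%N -> ~~ nondegenerate_gens n m ->
  nmonomial n m = 0.
Proof.
move=> m3 /allPn[k]; rewrite mem_iota => kn nk.
case: n kn => [|n] kn; first by lia.
have kn' : (k.-1 < n.+1)%N by lia.
rewrite /nmonomial (_ : monomial n.+1 m =
  sdeg S (Ordinal kn') (monomial n (map (face_gen k.-1) m)));
    first exact: normalize_sdeg.
rewrite [RHS]Sym_map_prod; congr (sym_prod _).
apply/ffunP => i; rewrite !ffunE (nth_map (0, 0, 0)%N) ?m3 // [RHS]sdeg_gen_elt;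
  congr (gen_elt _ _ _ _).
have /hasPn/(_ (nth (0, 0, 0)%N m i)) := nk.
rewrite mem_nth ?m3 // => /(_ isT); case: nth => [[l a] b];
  rewrite /covers /= => ab.
have ea : (a - (k.-1 < a) + (k.-1 < a - (k.-1 < a)) = a)%N.
  by case: (ltnP k.-1 a) => ? /=; case: ltnP => ? /=; lia.
have eb : (b - (k.-1 < b) + (k.-1 < b - (k.-1 < b)) = b)%N.
  by case: (ltnP k.-1 b) => ? /=; case: ltnP => ? /=; lia.
by rewrite ea eb.
Qed.

Lemma boundaryE n m : size m = 3%N -> all (fun b => b.1.1 < 4)%N m ->
  face S ord0 (nmonomial n.+1 m) = ev (nmonomial n) (boundary n m).
Proof.
move=> m3 m4; rewrite -normalize_alternating /boundary lin_eval_norm.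
set u := flatten _; have -> : alternating (monomial n.+1 m) = ev (monomial n) u.
  rewrite /alternating /u /lin_eval big_flatten big_map -[iota _ _]/(index_iota 0
    n.+2) big_mkord.
  apply: eq_bigr => k _; rewrite face_monomialE // -[RHS]/(lin_eval f g _ _)
    lin_eval_scale.
  by rewrite !expr0 !mulr1 -signr_odd; case: odd; rewrite ?expr0 ?expr1.
have u3 t : t \in u -> size t.2 = 3%N.
  have size_prod : forall (us : seq (lin gen)) t, t \in lin_prod us -> size t.2 =
    size us.
    elim=> [|v us IHus] t'; first by rewrite mem_seq1 => /eqP->.
    move=> /flattenP[_ /mapP[t1 _ ->] /mapP[_ /mapP[t2 /IHus h ->] ->]].
    by rewrite /= h.
  move=> /flattenP[_ /mapP[k _ ->] /mapP[t' /size_prod + ->]].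
  by rewrite size_map m3.
rewrite lin_eval_linear /lin_eval big_filter big_map [RHS]big_mkcond.
apply: eq_big_seq => t /u3 t3 /=;
  rewrite /nmonomial monomial_sort // -/(nmonomial n t.2).
case: ifP => // /negbT nd; rewrite nmonomial_degenerate ?scaler0 //.
by rewrite (nondegenerate_perm _ (_ : perm_eq t.2 (sort_gens t.2))) // perm_sym;
  apply/permPl/perm_sort.
Qed.

Section BasisLift.
Variables (n : nat) (W : lmodType R) (u : seq gen -> W).

(** Sorting makes the value symmetric in the factors; the value 0 on degenerate monomials lets the
    induced map factor through the quotient by degenerate elements. *)
Definition gens_value (t : {ffun 'I_3 -> seq_sub (gens n)}) : W :=
  let m := sort_gens [seq val (t i) | i <- enum 'I_3] in
  if nondegenerate_gens n m then u m else 0.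

Lemma gens_value_sym (t : {ffun 'I_3 -> seq_sub (gens n)}) (s : 'S_3) :
  gens_value [ffun j => t (s j)] = gens_value t.
Proof.
rewrite /gens_value (_ : sort_gens _ = sort_gens [seq val (t i) | i <- enum
  'I_3]) //.
apply: sort_gens_perm; under eq_map do rewrite ffunE.
rewrite (map_comp (fun i => val (t i)) s); apply: perm_map.
apply: uniq_perm; [by rewrite map_inj_uniq ?enum_uniq //;
  apply: perm_inj|exact: enum_uniq|].
move=> i; rewrite mem_enum; apply/mapP; exists ((s^-1)%g i);
  first by rewrite mem_enum.
by rewrite permKV.
Qed.

Definition basis_lift : {linear S n -> W} :=
  Sym_lift (basis_form_multilinear (fun b => @coordP R f g n (val b)) gens_value)
    (fun x s => basis_form_sym (fun b => gen_coord (val b)) x s gens_value_sym).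

Lemma basis_lift_gens m : size m = 3%N -> all (mem (gens n)) m ->
  basis_lift (monomial n m) =
  if nondegenerate_gens n (sort_gens m) then u (sort_gens m) else 0.
Proof.
move=> m3 /allP mg.
have mi (i : 'I_3) : nth (0, 0, 0)%N m i \in gens n by apply/mg/mem_nth; rewrite m3.
pose t := [ffun i : 'I_3 => SeqSub (mi i)].
have -> : monomial n m = sym_prod [ffun i => gen_elt f g n (val (t i))].
  by congr (sym_prod _); apply/ffunP => i; rewrite !ffunE.
rewrite [LHS]Sym_lift_prod (@basis_form_basis _ _ _ _ _ (fun b => gen_elt f g n
  (val b))); last first.
  by move=> b b'; rewrite coord_gen ?(valP b) ?(valP b').
rewrite /gens_value (_ : [seq _ | i <- _] = m) //.
apply: (@eq_from_nth _ (0, 0, 0)%N); first by rewrite size_map size_enum_ord m3.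
move=> i; rewrite size_map size_enum_ord => i3.
by rewrite (nth_map ord0) ?size_enum_ord // ffunE /= nth_enum_ord.
Qed.
End BasisLift.

Lemma Sym_gens_ext n (W : lmodType R) (F G : {linear S n -> W}) :
  (forall m, size m = 3%N -> all (mem (gens n)) m -> F (monomial n m) = G
    (monomial n m)) ->
  F =1 G.
Proof.
move=> FG; apply: (@Sym_ext_basis R 3 (Gamma_obj K n) W (seq_sub (gens n))
  (fun b => gen_elt f g n (val b)) (fun b => gen_coord (val b)));
    first exact: coord_sum.
move=> t; pose m := [seq val (t i) | i <- enum 'I_3].
have -> : sym_prod [ffun i => gen_elt f g n (val (t i))] = monomial n m.
  congr (sym_prod _); apply/ffunP => i;
    rewrite !ffunE (nth_map ord0) ?size_enum_ord //.
  by rewrite nth_ord_enum.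
apply: FG; first by rewrite size_map size_enum_ord.
by apply/allP => b /mapP[i _ ->]; apply: (valP (t i)).
Qed.

(** Degeneracies send basis monomials to degenerate basis monomials, where the map is 0, and
    [normalize] changes its argument by degenerate elements. *)
Lemma basis_lift_normalize n (W : lmodType R) (u : seq gen -> W) x :
  basis_lift n u (normalize S n x) = basis_lift n u x.
Proof.
case: n x => [//|n] x; have [y {2}->] := normalize_sub x.
rewrite raddfD raddf_sum /= big1 ?addr0 // => i _.
pose F := basis_lift n.+1 u \o sdeg S i.
have F0 : F =1 (\0 : {linear S n -> W}).
  apply: Sym_gens_ext => m m3 mg;
    rewrite -[LHS]/(basis_lift n.+1 u (sdeg S i (monomial n m))).
  have -> : sdeg S i (monomial n m) = monomial n.+1 (map (sdeg_gen i) m).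
    rewrite [LHS]Sym_map_prod; congr (sym_prod _); apply/ffunP => j.
    by rewrite !ffunE [LHS]sdeg_gen_elt (nth_map (0, 0, 0)%N) // m3.
  have ii := ltn_ord i.
  rewrite basis_lift_gens ?size_map //.
    rewrite (nondegenerate_perm _ (_ : perm_eq (sort_gens _) (map (sdeg_gen i)
      m))) ?perm_sort //.
    by rewrite (negPf (degenerate_sdeg_gen _ _)).
  by rewrite all_map; apply/allP => b bm; apply: sdeg_gen_gens;
    [lia|apply: (allP mg)].
exact: F0.
Qed.

Lemma sort_monomial n m : is_monomial n m -> sort_gens m = m.
Proof. by move=> /and4P[_ _ ms _]; apply: (sorted_sort gen_le_trans). Qed.

Lemma basis_lift_nmonomial n (W : lmodType R) (u : seq gen -> W) m : is_monomial
  n m ->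
  basis_lift n u (nmonomial n m) = u m.
Proof.
move=> mm; rewrite basis_lift_normalize; have /and4P[/eqP m3 mg _ nd] := mm.
by rewrite basis_lift_gens // (sort_monomial mm) nd.
Qed.

(** The normalized submodule is the image of [normalize], which kills degenerate monomials; so the
    normalized nondegenerate ones span it. By [basis_lift_nmonomial] they are also independent. *)
Lemma normalized_ext n (W : lmodType R) (F G : {linear S n -> W}) :
  (forall m, m \in monomials n -> F (nmonomial n m) = G (nmonomial n m)) ->
  forall x, x \in normalized_sub S n -> F x = G x.
Proof.
move=> FG x xN; rewrite -(normalize_id xN).
apply: (@Sym_gens_ext n W (F \o normalize S n) (G \o normalize S n)) => m m3 mg /=.
rewrite -(monomial_sort n m3).
have m3' : size (sort_gens m) = 3%N by rewrite size_sort.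
have [nd|nd] := boolP (nondegenerate_gens n (sort_gens m)).
  apply: FG; rewrite mem_monomials /is_monomial m3' nd (sort_sorted gen_le_total)
    !andbT /=.
  by rewrite (perm_all _ (_ : perm_eq _ m)) // perm_sort.
by rewrite -[normalize S n _]/(nmonomial n _) nmonomial_degenerate // !raddf0.
Qed.
End MonomialModule.

Lemma contraction_at n : (n < 7)%N -> contraction_ok n && keys_all_ok n.
Proof. by move=> n7; apply: (allP contractionP); rewrite mem_iota. Qed.

Lemma target_rank_bound n k : (k < target_rank n)%N -> (n < 7)%N.
Proof. by case: n => [|[|[|[|[|[|[|n]]]]]]] //;
  rewrite /target_rank /= nth_nil. Qed.

(** * The complex K + K[2] + K[4] and the contraction as linear maps *)

Section Target.
Variables (R : comNzRingType) (f g : R).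
Local Notation K := (koszul f g).
Local Notation S := (Sym_simplicial 3 (Gamma K)).
Local Notation ev := (lin_eval f g).

Definition target_gen n (k : nat) : 'rV[R]_(target_rank n) := \row_j (j == k :>
  nat)%:R.

Lemma row_sum n (x : 'rV[R]_(target_rank n)) : x = \sum_k x 0 k *: target_gen n k.
Proof.
apply/rowP => j; rewrite summxE (bigD1 j) //= !mxE eqxx mulr1 big1 ?addr0 // => k
  kj.
by rewrite !mxE eq_sym [_ == _ :> nat](negPf kj) mulr0.
Qed.

Lemma target_ext n (W : lmodType R) (F G : {linear 'rV[R]_(target_rank n) -> W}) :
  (forall k, (k < target_rank n)%N -> F (target_gen n k) = G (target_gen n k)) ->
    F =1 G.
Proof.
move=> FG x; rewrite (row_sum x) !raddf_sum; apply: eq_bigr => k _.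
by rewrite [LHS]linearZ_LR [RHS]linearZ_LR FG.
Qed.

Definition target_mx n : 'M[R]_(target_rank n.+1, target_rank n) :=
  \matrix_(i, j) ev (target_gen n) (target_d n i) 0 j.

Lemma target_mxE n k : (k < target_rank n.+1)%N ->
  mulmxr (target_mx n) (target_gen n.+1 k) = ev (target_gen n) (target_d n k).
Proof.
move=> kn; apply/rowP => j; rewrite !mxE (bigD1 (Ordinal kn)) //= !mxE eqxx mul1r.
rewrite big1 ?addr0 // => i ni; rewrite !mxE.
by rewrite (_ : (i == k :> nat) = false) ?mul0r //; apply: negPf ni.
Qed.

Lemma target_mx_eval n u : target_keys_ok n.+1 u ->
  mulmxr (target_mx n) (ev (target_gen n.+1) u) = ev (target_gen n) (lin_bind
    (target_d n) u).
Proof.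
move=> /allP uk; rewrite lin_eval_linear lin_eval_bind; apply: eq_lin_eval => t /uk.
exact: target_mxE.
Qed.

Lemma target_dd n (x : 'rV[R]_(target_rank n.+2)) :
  mulmxr (target_mx n) (mulmxr (target_mx n.+1) x) = 0.
Proof.
pose F : {linear 'rV[R]_(target_rank n.+2) -> 'rV[R]_(target_rank n)} :=
  mulmxr (target_mx n) \o mulmxr (target_mx n.+1).
suff F0 : F =1 (\0 : {linear 'rV[R]_(target_rank n.+2) -> 'rV[R]_(target_rank
  n)}) by exact: F0 x.
apply: target_ext => k kn.
have n7 := target_rank_bound kn;
  have /andP[/and5P[_ _ _ _ ok] _] := contraction_at (ltnW (ltnW n7)).
have /andP[_ /and5P[_ _ _ _ keys]] := contraction_at (ltnW n7).
have kk : k \in iota 0 (target_rank n.+2) by rewrite mem_iota.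
rewrite /F [LHS]/= -[X in X *m _]/(mulmxr (target_mx n.+1) _) target_mxE //.
rewrite -[LHS]/(mulmxr (target_mx n) _) target_mx_eval ?(allP keys) //.
by rewrite (lin_eqP _ _ _ (allP ok _ kk)) /lin_eval big_nil.
Qed.

Definition target : chain_complex R :=
  @ChainComplex R (fun n => 'rV[R]_(target_rank n)) (fun n => mulmxr (target_mx
    n)) target_dd.

Definition proj n : {linear S n -> target n} :=
  basis_lift f g n (fun m => ev (target_gen n) (project n m)).

Definition row_lift n (v : nat -> S n) (x : target n) : S n := \sum_k x 0 k *: v k.
Lemma row_lift_linear n v : linear (@row_lift n v).
Proof.
move=> a x y; rewrite /row_lift scaler_sumr -big_split; apply: eq_bigr => k _ /=.
by rewrite !mxE scalerDl scalerA.
Qed.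

Definition incl n : {linear target n -> S n} :=
  normalize S n \o linear_of (@row_lift_linear n (fun k => ev (monomial f g n)
    (include n k))).

Definition htpy n : {linear S n -> S n.+1} :=
  normalize S n.+1 \o basis_lift f g n (fun m => ev (monomial f g n.+1) (contract
    n m)).

Lemma proj_nmonomial n m : is_monomial n m ->
  proj n (nmonomial f g n m) = ev (target_gen n) (project n m).
Proof. exact: basis_lift_nmonomial. Qed.

Lemma htpy_nmonomial n m : is_monomial n m ->
  htpy n (nmonomial f g n m) = ev (nmonomial f g n.+1) (contract n m).
Proof.
move=> mm; rewrite -[LHS]/(normalize S n.+1 _) [X in normalize S n.+1
  X]basis_lift_nmonomial //.
exact: lin_eval_linear.
Qed.

Lemma incl_gen n k : (k < target_rank n)%N ->
  incl n (target_gen n k) = ev (nmonomial f g n) (include n k).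
Proof.
move=> kn; rewrite -[LHS]/(normalize S n (row_lift _ _)) /row_lift (bigD1
  (Ordinal kn)) //=.
rewrite big1 ?addr0 => [|i ni].
  by rewrite !mxE eqxx scale1r; apply: lin_eval_linear.
by rewrite !mxE (_ : (i == k :> nat) = false) ?scale0r //; apply: negPf ni.
Qed.

Lemma gens_label n b : b \in gens n -> (b.1.1 < 4)%N.
Proof. by case: b => [[l i] j]; rewrite mem_gens; case: l => [|[|[|[|]]]]. Qed.

Lemma face0_nmonomial n m : is_monomial n.+1 m ->
  face S ord0 (nmonomial f g n.+1 m) = ev (nmonomial f g n) (boundary n m).
Proof.
move=> /and4P[/eqP m3 mg _ _]; apply: boundaryE => //.
by apply: sub_all mg => b; apply: gens_label.
Qed.

Lemma face0_eval n u : keys_ok n.+1 u ->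
  face S ord0 (ev (nmonomial f g n.+1) u) = ev (nmonomial f g n) (lin_bind
    (boundary n) u).
Proof.
move=> /allP uk; rewrite lin_eval_linear lin_eval_bind; apply: eq_lin_eval => t /uk.
exact: face0_nmonomial.
Qed.

Lemma proj_eval n u : keys_ok n u ->
  proj n (ev (nmonomial f g n) u) = ev (target_gen n) (lin_bind (project n) u).
Proof.
move=> /allP uk; rewrite lin_eval_linear lin_eval_bind; apply: eq_lin_eval => t /uk.
exact: proj_nmonomial.
Qed.

Lemma htpy_eval n u : keys_ok n u ->
  htpy n (ev (nmonomial f g n) u) = ev (nmonomial f g n.+1) (lin_bind (contract
    n) u).
Proof.
move=> /allP uk; rewrite lin_eval_linear lin_eval_bind; apply: eq_lin_eval => t /uk.
exact: htpy_nmonomial.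
Qed.

Lemma incl_eval n u : target_keys_ok n u ->
  incl n (ev (target_gen n) u) = ev (nmonomial f g n) (lin_bind (include n) u).
Proof.
move=> /allP uk; rewrite lin_eval_linear lin_eval_bind; apply: eq_lin_eval => t /uk.
exact: incl_gen.
Qed.

Lemma proj_d n x : x \in normalized_sub S n.+1 ->
  proj n (face S ord0 x) = cc_d target n (proj n.+1 x).
Proof.
apply: (normalized_ext (F := proj n \o face S ord0) (G := cc_d target n \o proj
  n.+1)) => m mm.
have n7 := monomials_bound mm.
have /andP[/and5P[_ ok _ _ _] /and5P[keys _ _ _ _]] := contraction_at (ltnW n7).
have /andP[_ /and5P[_ _ keys' _ _]] := contraction_at n7.
have mm' : is_monomial n.+1 m by rewrite -mem_monomials.
rewrite -[LHS]/(proj n (face S ord0 _)) -[RHS]/(mulmxr (target_mx n) (proj n.+1 _)).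
rewrite face0_nmonomial // proj_eval ?(allP keys) // proj_nmonomial //
  target_mx_eval ?(allP keys') //.
exact: lin_eqP (allP ok _ mm).
Qed.

Lemma incl_d n x : incl n (cc_d target n x) = face S ord0 (incl n.+1 x).
Proof.
apply: (target_ext (F := incl n \o cc_d target n) (G := face S ord0 \o incl
  n.+1)) => k kn.
have n7 := target_rank_bound kn.
have /andP[/and5P[_ _ ok _ _] /and5P[_ _ _ _ keys]] := contraction_at (ltnW n7).
have /andP[_ /and5P[_ _ _ keys' _]] := contraction_at n7.
have kk : k \in iota 0 (target_rank n.+1) by rewrite mem_iota.
rewrite -[LHS]/(incl n (cc_d target n _)) -[RHS]/(face S ord0 (incl n.+1 _)).
rewrite [cc_d target n _]target_mxE // incl_eval ?(allP keys) // incl_gen //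
  face0_eval ?(allP keys') //.
exact/esym/lin_eqP/(allP ok _ kk).
Qed.

Lemma proj_incl n x : proj n (incl n x) = x.
Proof.
apply: (target_ext (F := proj n \o incl n) (G := idfun)) => k kn.
have /andP[/and5P[_ _ _ ok _] /and5P[_ _ _ keys _]] := contraction_at
  (target_rank_bound kn).
have kk : k \in iota 0 (target_rank n) by rewrite mem_iota.
rewrite -[LHS]/(proj n (incl n _)) incl_gen // proj_eval ?(allP keys) //.
by rewrite (lin_eqP _ _ _ (allP ok _ kk)) lin_eval1.
Qed.

Lemma htpy0 x : x \in normalized_sub S 0 -> x - incl 0 (proj 0 x) = face S ord0
  (htpy 0 x).
Proof.
apply: (normalized_ext (F := idfun \- (incl 0 \o proj 0)) (G := face S ord0 \o
  htpy 0)) => m mm.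
have /andP[/and5P[ok _ _ _ _] /and5P[_ keys keys' _ _]] := contraction_at
  (monomials_bound mm).
have mm' : is_monomial 0 m by rewrite -mem_monomials.
rewrite -[LHS]/(_ - incl 0 (proj 0 _)) -[RHS]/(face S ord0 (htpy 0 _)).
rewrite proj_nmonomial // incl_eval ?(allP keys') // htpy_nmonomial // face0_eval
  ?(allP keys) //.
have := lin_eqP f g (nmonomial f g 0) (allP ok _ mm).
rewrite lin_eval_sub lin_eval1 lin_eval_cat => ->.
by rewrite [X in _ + X](_ : _ = 0) ?addr0 //; apply: big_nil.
Qed.

Lemma htpyS n x : x \in normalized_sub S n.+1 ->
  x - incl n.+1 (proj n.+1 x) = face S ord0 (htpy n.+1 x) + htpy n (face S ord0 x).
Proof.
apply: (normalized_ext (F := idfun \- (incl n.+1 \o proj n.+1))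
  (G := (face S ord0 \o htpy n.+1) \+ (htpy n \o face S ord0))) => m mm.
have n7 := monomials_bound mm.
have /andP[/and5P[ok _ _ _ _] /and5P[_ keys keys' _ _]] := contraction_at n7.
have /andP[_ /and5P[keys2 _ _ _ _]] := contraction_at (ltnW n7).
have mm' : is_monomial n.+1 m by rewrite -mem_monomials.
rewrite -[LHS]/(_ - incl n.+1 (proj n.+1 _)).
rewrite -[RHS]/(face S ord0 (htpy n.+1 _) + htpy n (face S ord0 _)).
rewrite proj_nmonomial // incl_eval ?(allP keys') // htpy_nmonomial // face0_eval
  ?(allP keys) //.
rewrite face0_nmonomial // htpy_eval ?(allP keys2) //.
have := lin_eqP f g (nmonomial f g n.+1) (allP ok _ mm).
by rewrite lin_eval_sub lin_eval1 lin_eval_cat.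
Qed.

Lemma koszul_Sym3_target : homotopy_equivalent (normalized_complex S) target.
Proof.
pose p n (x : normalized_complex S n) : target n := proj n (val x).
have pL n : linear (p n) by move=> a x y;
  rewrite -[LHS]/(proj n (a *: val x + val y)) linearP.
have inN n x : incl n x \in normalized_sub S n by apply: normalize_in.
pose i n (x : target n) : normalized_complex S n := Sub (incl n x) (inN n x).
have iL n : linear (i n) by move=> a x y; apply: val_inj;
  rewrite -[LHS]/(incl n (a *: x + y)) linearP.
(* The tables satisfy 1 - ip = dh + hd, while the homotopy from the identity to ip requires ip - 1;
   hence the minus sign. *)
have hN n (x : normalized_complex S n) : - htpy n (val x) \in normalized_sub S n.+1.
  by rewrite rpredN; apply: normalize_in.
pose h n (x : normalized_complex S n) : normalized_complex S n.+1 := Sub (- htpy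
  n (val x)) (hN n x).
have hL n : linear (h n).
  by move=> a x y; apply: val_inj;
    rewrite -[LHS]/(- htpy n (a *: val x + val y)) linearP opprD -scalerN.
have pd n x : linear_of (pL n) (cc_d (normalized_complex S) n x) = cc_d target n
  (linear_of (pL n.+1) x).
  by apply: proj_d; apply: (valP x).
have id_ n x : linear_of (iL n) (cc_d target n x) = cc_d (normalized_complex S) n
  (linear_of (iL n.+1) x).
  by apply: val_inj; apply: incl_d.
exists (@ChainMap R (normalized_complex S) target (fun n => linear_of (pL n)) pd).
exists (@ChainMap R target (normalized_complex S) (fun n => linear_of (iL n))
  id_); split.
  exists (fun n => linear_of (hL n)); split=> [x|n x]; apply: val_inj.
    apply: oppr_inj; rewrite -[LHS]/(- (incl 0 (proj 0 (val x)) - val x)) opprB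
      htpy0 ?(valP x) //.
    by rewrite -[RHS]/(- face S ord0 (- htpy 0 (val x))) raddfN opprK.
  apply: oppr_inj; rewrite -[LHS]/(- (incl n.+1 (proj n.+1 (val x)) - val x))
    opprB htpyS ?(valP x) //.
  rewrite -[RHS]/(- (face S ord0 (- htpy n.+1 (val x)) + - htpy n (face S ord0
    (val x)))).
  by rewrite raddfN opprD !opprK.
exists (fun n => \0); split=> [x|n x].
  by rewrite -[LHS]/(proj 0 (incl 0 x) - x) proj_incl subrr [RHS]raddf0.
by rewrite -[LHS]/(proj n.+1 (incl n.+1 x) - x) proj_incl subrr [X in X +
  _]raddf0 addr0.
Qed.
End Target.

(** * Ideals generated by a regular sequence *)

Section Ideals.
Variable R : comNzRingType.
Implicit Types f g x : R.

Lemma ideal_gen0 x : x \in ideal_gen (R := R) [::] -> x = 0.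
Proof.
by move=> /asboolP[r [hr ->]]; rewrite big_seq big1 // => p /hr.
Qed.

Lemma ideal_gen1 f x : x \in ideal_gen [:: f] -> exists a, x = a * f.
Proof.
move=> /asboolP[r [hr ->]]; exists (\sum_(p <- r) p.1); rewrite mulr_suml.
by apply: eq_big_seq => p /hr; rewrite mem_seq1 => /eqP->.
Qed.

Lemma ideal_gen2P f g x : x \in ideal_gen [:: f;
  g] <-> exists a b, x = a * f + b * g.
Proof.
split=> [/asboolP[r [hr ->]]|[a [b ->]]]; last first.
  apply/asboolP; exists [:: (a, f); (b, g)]; rewrite !big_cons big_nil addr0;
    split=> //.
  by move=> p; rewrite !inE => /orP[]/eqP-> /=; rewrite eqxx ?orbT.
elim: r hr => [|p r IHr] hr; first by exists 0, 0; rewrite big_nil !mul0r addr0.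
have [|a [b E]] := IHr; first by move=> q qr; apply: hr; rewrite inE qr orbT.
rewrite big_cons E; have := hr p (mem_head _ _); rewrite !inE => /orP[]/eqP->.
  by exists (p.1 + a), b; rewrite mulrDl addrA.
by exists a, (p.1 + b); rewrite mulrDl addrCA.
Qed.

Lemma ideal_gen1_mul f a : a * f \in ideal_gen [:: f].
Proof.
apply/asboolP; exists [:: (a, f)]; rewrite big_seq1; split=> // p.
by rewrite mem_seq1 => /eqP->; rewrite inE.
Qed.

Lemma ideal_gen0_0 : 0 \in ideal_gen (R := R) [::].
Proof. by apply/asboolP; exists [::]; rewrite big_nil. Qed.
End Ideals.

Lemma row_projective (R : comNzRingType) n : projective 'rV[R]_n.
Proof.
move=> A B f g fsurj; have [a aE] := choice (fun i : 'I_n => fsurj (g (delta_mx 0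
  i))).
pose h (x : 'rV[R]_n) : A := \sum_i x 0 i *: a i.
have hL : linear h.
  move=> c x y; rewrite /h scaler_sumr -big_split; apply: eq_bigr => i _ /=.
  by rewrite !mxE scalerDl scalerA.
exists (linear_of hL) => x; rewrite -[LHS]/(f (h x)) [in RHS](row_sum_delta x)
  !raddf_sum.
by apply: eq_bigr => i _; rewrite [LHS]linearZ_LR [RHS]linearZ_LR aE.
Qed.

(** * The Koszul resolution and the homology of the target complex *)

Section RegularPair.
Variables (R : comNzRingType) (I : idealr R) (f g : R).
Hypothesis I_gen : forall x, x \in (I : {pred R}) <-> exists a b, x = a * f + b * g.
Hypothesis f_reg : forall x, f * x = 0 -> x = 0.
Hypothesis g_reg : forall x a, g * x = a * f -> exists b, x = b * f.

Local Notation Q := (ideal_quot_mod I).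

Definition quot_class (x : R) : Q := \pi_{ideal_quot I} x.

Lemma quot_class_linear : linear (quot_class : R^o -> Q).
Proof. by move=> a x y; rewrite /quot_class rmorphD rmorphM. Qed.

Lemma quot_class_eq0 x : quot_class x = 0 <-> x \in (I : {pred R}).
Proof.
rewrite -[0](rmorph0 \pi_{ideal_quot I}) -[x in x \in _]subr0 Quotient.idealrBE.
by split=> [/eqP|/eqP].
Qed.

(** Regularity of g modulo f gives b = c f, and then f can be cancelled in (a + c g) f = 0: all
    relations between f and g are Koszul relations. *)
Lemma regular_pair_syzygy a b : a * f + b * g = 0 -> exists c, a = c * g /\ b = -
  (c * f).
Proof.
move=> h; have [c cE] : exists c, b = c * f.
  by apply: (@g_reg _ (- a)); rewrite mulrC mulNr; apply/eqP;
    rewrite -addr_eq0 addrC h.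
exists (- c); rewrite !mulNr opprK; split=> //; apply/eqP;
  rewrite -subr_eq0 opprK; apply/eqP/f_reg.
by rewrite -h cE; ring.
Qed.

Definition koszul_augmentation (x : koszul f g 0) : Q := quot_class (x 0 ord0).

Lemma koszul_augmentation_linear : linear koszul_augmentation.
Proof. by move=> a x y; rewrite /koszul_augmentation !mxE;
  apply: quot_class_linear. Qed.

(** Exactness comes from [I_gen] in degree 0, from the syzygies of f and g in degree 1, and from f
    being a nonzerodivisor in degree 2. *)
Lemma koszul_resolution : projective_resolution (linear_of
  koszul_augmentation_linear).
Proof.
split=> [n|v|x|n x].
- exact: row_projective.
- exists (\row_i (repr (v : {ideal_quot I}))).
  by rewrite /= /koszul_augmentation mxE /quot_class reprK.
- rewrite [X in X <-> _](_ : _ = (quot_class (x 0 ord0) = 0)) // quot_class_eq0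
  I_gen.
  split=> [[a [b ab]]|[y <-]].
    exists (\row_i nth 0 [:: a; b] i); apply/rowP => i; rewrite ord1 !mxE.
    by rewrite !big_ord_recl big_ord0 !mxE /= addr0.
  by exists (y 0 ord0), (y 0 ord_max);
    rewrite !mxE !big_ord_recl big_ord0 !mxE /= addr0 (_ : fintype.lift _ _ =
    ord_max) //; apply: ord_inj.
split=> [|[y <-]]; last exact: koszul_dd.
case: n x => [|[|n]] x dx; last by exists 0; rewrite raddf0; apply/rowP => -[].
  have := congr1 (fun y : 'rV[R]_1 => y 0 ord0) dx.
  rewrite !mxE !big_ord_recl big_ord0 !mxE /= addr0 => /regular_pair_syzygy[c [c0
    c1]].
  exists (\row_i c); apply/rowP => i;
    rewrite !mxE big_ord_recl big_ord0 !mxE /= addr0.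
  case: i => [[|[|//]] i2] /=.
    by rewrite -c0; congr (x _ _); apply: ord_inj.
  by rewrite mulrN -c1; congr (x _ _); apply: ord_inj.
exists 0; rewrite raddf0; apply/rowP => i; rewrite ord1 mxE;
  apply/esym/f_reg/oppr_inj.
have := congr1 (fun y : 'rV[R]_2 => y 0 ord_max) dx.
by rewrite !mxE big_ord_recl big_ord0 !mxE /= addr0 oppr0 mulrN mulrC.
Qed.

(** Coordinates indexed by natural numbers and zero out of range, so that formulas for the target
    avoid ordinals whose bound depends on the degree. *)
Definition entry n (x : 'rV[R]_n) (k : nat) : R := \sum_i x 0 i * (i == k :>
  nat)%:R.

Lemma entryE n (x : 'rV[R]_n) (i : 'I_n) : entry x i = x 0 i.
Proof.
rewrite /entry (bigD1 i) //= eqxx mulr1 big1 ?addr0 // => j ji.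
by rewrite (_ : (j == i :> nat) = false) ?mulr0 //; apply: negPf ji.
Qed.

Lemma entry_row n (v : nat -> R) k : (k < n)%N -> entry (\row_(i < n) v i) k = v k.
Proof. by move=> kn; rewrite -[k]/(nat_of_ord (Ordinal kn)) entryE mxE. Qed.

Lemma entry_big n (x : 'rV[R]_n) k : (n <= k)%N -> entry x k = 0.
Proof.
move=> nk; rewrite /entry big1 // => i _.
by rewrite (_ : (i == k :> nat) = false) ?mulr0 //; have := ltn_ord i;
  case: eqP => // ->; lia.
Qed.

Lemma target_dE n (x : target f g n.+1) (k : 'I_(target_rank n)) :
  cc_d (target f g) n x 0 k =
  if odd n then entry x 0 * ((k == 0 :> nat)%:R * g - (k == 1 :> nat)%:R * f)
  else (entry x 0 * f + entry x 1 * g) * (k == (n != 0) :> nat)%:R.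
Proof.
rewrite mxE; have [n7|n7] := ltnP n 6.
  case: n x k n7 => [|[|[|[|[|[|//]]]]]] x k _;
    rewrite !big_ord_recl big_ord0 !mxE /lin_eval /=
    ?big_cons !big_nil !mxE /entry !big_ord_recl !big_ord0 /=; try ring.
have r0 : target_rank n.+1 = 0%N.
  by apply/eqP; rewrite -leqn0 leqNgt; apply/negP => /target_rank_bound; lia.
rewrite big1 => [|j _]; last by have := ltn_ord j; rewrite {2}r0.
by rewrite !entry_big ?r0 // !mul0r addr0 mul0r if_same.
Qed.

Definition target_class n (x : target f g n) : Q := quot_class (entry x (n != 0)%N).

Lemma entry_linear n (a : R) (x y : 'rV[R]_n) k :
  entry (a *: x + y) k = a * entry x k + entry y k.
Proof.
rewrite /entry mulr_sumr -big_split; apply: eq_bigr => i _ /=.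
by rewrite !mxE mulrDl mulrA.
Qed.

(** The component of index [n != 0] is the bottom of the Koszul copy starting in degree n and
    contributes R modulo (f, g). For n > 0 the other component is the top of the preceding copy,
    which vanishes on cycles because f is a nonzerodivisor. *)
Lemma target_homology_even n : (n < 6)%N -> ~~ odd n ->
  exists L : {linear homology (target f g) n -> Q}, bijective L.
Proof.
move=> n6 n_even.
have rank_n : ((n != 0%N) < target_rank n)%N by case: n n6 n_even =>
  [|[|[|[|[|[|]]]]]].
have rank_n1 : target_rank n.+1 = 2%N by case: n n6 n_even {rank_n} =>
  [|[|[|[|[|[|]]]]]].
have other k : (k < target_rank n)%N -> k <> (n != 0%N) -> k = 0%N /\ n != 0%N.
  by case: n n6 n_even {rank_n rank_n1} => [|[|[|[|[|[|]]]]]] // _ _;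
    case: k => [|[|k]].
have boundary_entry y k : (k < target_rank n)%N -> entry (cc_d (target f g) n y) k =
    (entry y 0 * f + entry y 1 * g) * (k == (n != 0))%:R.
  by move=> kn; rewrite -[k]/(nat_of_ord (Ordinal kn)) entryE target_dE (negPf
    n_even).
pose F (x : target f g n) (xc : x \in cycles (target f g) n) : Q := target_class x.
have F_lin a x y xc yc c : F (a *: x + y) c = a *: F x xc + F y yc.
  by rewrite /F /target_class entry_linear; apply: quot_class_linear.
have F_bd x xc : (exists y, cc_d (target f g) n y = x) -> F x xc = 0.
  move=> [y yE]; rewrite /F -yE; apply/quot_class_eq0/I_gen;
    exists (entry y 0), (entry y 1).
  by rewrite boundary_entry // eqxx mulr1.
exists (linear_of (homology_lift_linear F_lin F_bd)).
have LE (x : target f g n) (xc : x \in cycles (target f g) n) : linear_of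
  (homology_lift_linear F_lin F_bd) (hclass xc) = target_class x.
  exact: (homology_liftE F_lin F_bd xc).
have cycle_entry0 (x : target f g n) : x \in cycles (target f g) n -> n != 0%N ->
  entry x 0 = 0.
  case: n n6 n_even {rank_n rank_n1 other boundary_entry F F_lin F_bd LE} x =>
    [//|n] n6 n_even x.
  have n_odd : odd n by exact: (negbNE n_even).
  rewrite cycleS => /eqP dx _.
  have rn : (1 < target_rank n)%N by case: n n6 n_even {x dx n_odd} =>
    [|[|[|[|[|]]]]].
  have := target_dE x (Ordinal rn); rewrite dx mxE n_odd /= mul0r mul1r sub0r mulrN.
  by move/eqP; rewrite eq_sym oppr_eq0 mulrC => /eqP/f_reg.
have bound (w : target f g n) : w \in cycles (target f g) n -> quot_class (entry
  w (n != 0)%N) = 0 ->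
    exists z, cc_d (target f g) n z = w.
  move=> wc /quot_class_eq0/I_gen[a [b ab]].
  exists (\row_i nth 0 [:: a; b] i); apply/rowP => k;
    rewrite -!entryE boundary_entry //.
  rewrite !entry_row ?rank_n1 //= -ab;
    have [->|/eqP kn] := eqVneq (k : nat) (n != 0%N); rewrite ?mulr1 // mulr0.
  by have [-> n0] := other k (ltn_ord k) kn; rewrite cycle_entry0.
(* The inverse map: multiples of the bottom generator are cycles and represent all classes. *)
pose c (r : R) : target f g n := r *: target_gen R n (n != 0)%N.
have c_entry r k : (k < target_rank n)%N -> entry (c r) k = r * (k == (n != 0))%:R.
  by move=> kn; rewrite -[k]/(nat_of_ord (Ordinal kn)) entryE !mxE.
have cc r : c r \in cycles (target f g) n.
  case: n n6 n_even {rank_n rank_n1 other boundary_entry F F_lin F_bd LE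
    cycle_entry0 bound} c c_entry => [//|n] n6 n_even c c_entry.
  have n_odd : odd n by exact: (negbNE n_even).
  rewrite cycleS; apply/eqP/rowP => k;
    rewrite target_dE n_odd c_entry ?mulr0 ?mul0r ?mxE //.
  by case: n n6 {n_even n_odd c c_entry k} => [|[|[|[|[|]]]]].
exists (fun q : Q => hclass (cc (repr (q : {ideal_quot I})))).
  move=> q; have [x [xc ->]] := hclass_repr q; rewrite LE; apply/hclass_eq/bound;
    first exact: rpredB.
  rewrite -[_ - x]addrC -scaleN1r entry_linear c_entry // eqxx mulr1 mulN1r addrC.
  rewrite [LHS](raddfB \pi_{ideal_quot I}) /= reprK; exact: subrr.
move=> q; rewrite LE /target_class c_entry // eqxx mulr1; exact: reprK.
Qed.

(** In degrees 1, 3, 5 a cycle is a syzygy of f and g, hence a Koszul boundary; in degree 6 only the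
    top of the last copy is left, where f can be cancelled; above that the complex is zero. *)
Lemma target_homology_trivial n : n \notin [:: 0; 2; 4]%N ->
  forall q : homology (target f g) n, q = 0.
Proof.
move=> n024 q; have [x [xc ->]] := hclass_repr q.
have c0 : 0 \in cycles (target f g) n by apply: rpred0.
have -> : (0 : homology (target f g) n) = hclass c0.
  by rewrite -[LHS](raddf0 (quot_pi (boundaries (target f g) n)));
    congr (quot_pi _ _); apply: val_inj.
apply/hclass_eq; rewrite subr0.
have zero : (forall k : 'I_(target_rank n), x 0 k = 0) -> exists z, cc_d (target
  f g) n z = x.
  by move=> x0; exists 0; rewrite raddf0; apply/rowP => k; rewrite x0 mxE.
have [n7|n7] := ltnP n 7; last first.
  by apply: zero => -[k kn]; have := target_rank_bound kn; lia.
case: n n7 n024 q x xc {c0} zero => [//|n] n7 n024 q x xc zero.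
move: xc; rewrite cycleS => /eqP dx.
case: (boolP (odd n)) => n_odd.
  (* The degree is now n + 1, so this is the top degree 6. *)
  have n5 : n = 5%N by case: n n7 n024 n_odd {q x zero dx} => [|[|[|[|[|[|[|]]]]]]].
  move: q x zero dx; rewrite n5 => _ x zero dx; apply: zero => k.
  have := target_dE x (Ordinal (isT : (1 < target_rank 5)%N));
    rewrite dx mxE /= mul0r mul1r sub0r mulrN.
  move/eqP; rewrite eq_sym oppr_eq0 mulrC => /eqP/f_reg.
  by rewrite -(entryE x k); case: k => [[|]].
have n_lt : (n < 5)%N by case: n n7 n024 n_odd {q x zero dx} =>
  [|[|[|[|[|[|[|]]]]]]].
have ranks : ((n != 0%N) < target_rank n)%N /\ (0 < target_rank n.+2)%N.
  by case: n n_lt n_odd {q x zero dx n7 n024} => [|[|[|[|[|]]]]].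
have := target_dE x (Ordinal ranks.1);
  rewrite dx mxE (negPf n_odd) /= eqxx mulr1 => /esym.
move=> /regular_pair_syzygy[c [c0 c1]].
(* The syzygy is the boundary of [c] times the generator of index 0, the top of the same Koszul
   copy. *)
exists (\row_i (if i == 0%N :> nat then c else 0)); apply/rowP => k.
rewrite target_dE /= n_odd (@entry_row _ (fun i => if i == 0%N then c else 0))
  ?ranks.2 //=.
rewrite -(entryE x k) mulrBr; have k2 : (k < 2)%N.
  by have := ltn_ord k; case: n n_lt n_odd {q x zero dx n7 n024 ranks c0 c1} k =>
    [|[|[|[|[|]]]]].
by case: k k2 => [[|[|//]] /= ?] _;
  rewrite ?c0 ?c1 ?mul1r ?mul0r ?mulr0 ?subr0 ?sub0r ?mulr1.
Qed.
End RegularPair.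

(** * Passage to modules over the quotient ring *)

Section FreeOverQuotient.
Variables (R : comNzRingType) (I : idealr R) (M : lmodType R).

(** The ideal kills R/I, and injectivity of [L] carries this over to [M]; since scalars of the
    quotient ring act through representatives, [L] is linear over that ring too. *)
Lemma free_rank1_over_quot (L : {linear M -> ideal_quot_mod I}) : bijective L ->
  exists IM : annihilated I M, free_of_rank (over_quot IM : lmodType {ideal_quot
    I}) 1.
Proof.
move=> L_bij; have IM : annihilated I M.
  move=> a x aI; apply: (bij_inj L_bij); rewrite linearZ raddf0.
  rewrite -[LHS]/(\pi_{ideal_quot I} a * (L x : {ideal_quot I})).
  have -> : \pi_{ideal_quot I} a = 0 := (quot_class_eq0 I a).2 aI.
  exact: mul0r.
exists IM; pose F (x : over_quot IM) : 'rV[{ideal_quot I}]_1 := const_mx (L x :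
  {ideal_quot I}).
have FL : linear F.
  move=> q x y; apply/rowP => i; rewrite !mxE.
  rewrite -[LHS]/(L (repr q *: (x : M) + y)) linearP.
  by rewrite -[LHS]/(\pi_{ideal_quot I} (repr q) * (L x : {ideal_quot I}) + (L y
    : {ideal_quot I})) reprK.
have [G LG GL] := L_bij.
exists (linear_of FL); exists (fun r : 'rV_1 => G (r 0 0)) => [x|r].
  by rewrite -[RHS]LG; congr (G _); rewrite mxE.
by apply/rowP => i; rewrite !mxE ord1; apply: GL.
Qed.

Lemma free_rank0_over_quot : (forall x : M, x = 0) ->
  exists IM : annihilated I M, free_of_rank (over_quot IM : lmodType {ideal_quot
    I}) 0.
Proof.
move=> M0; have IM : annihilated I M by move=> a x _; apply: M0.
exists IM, \0; exists (fun=> 0) => x; last by apply/rowP => -[].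
by rewrite [RHS](M0 x).
Qed.
End FreeOverQuotient.

Theorem theorem5p5 (R : comNzRingType) (R_noetherian : noetherian R)
    (I : idealr R) (s : seq R) (s_size : size s = 2%N)
    (s_regular : regular_sequence s) (I_gen : (I : {pred R}) =i ideal_gen s)
    (P : chain_complex R) (e : {linear P 0%N -> ideal_quot_mod I})
    (P_resolution : projective_resolution e) (k : nat) :
  exists IG : annihilated I (derived_Sym3 P k),
    free_of_rank (over_quot IG : lmodType {ideal_quot I})
      (if k \in [:: 0; 2; 4]%N then 1 else 0)%N.
Proof.
case: s s_size s_regular I_gen => [|f [|g []]] // _ [reg _] I_gen.
have I_fg x : x \in (I : {pred R}) <-> exists a b, x = a * f + b * g.
  by rewrite I_gen; apply: ideal_gen2P.
(* The two conditions of regularity: f modulo the zero ideal of the empty prefix, then g modulo the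
   ideal generated by f. *)
have f_reg x : f * x = 0 -> x = 0.
  move=> fx; apply/ideal_gen0/(reg 0%N isT); rewrite /= fx; exact: ideal_gen0_0.
have g_reg x a : g * x = a * f -> exists b, x = b * f.
  by move=> gx; apply/ideal_gen1/(reg 1%N isT); rewrite /= gx;
    apply: ideal_gen1_mul.
(* [F] passes from P to the Koszul resolution, and [F'] below from there to K + K[2] + K[4]. *)
have [F F_bij] := homotopy_equivalent_homology k (derived_Sym_homotopy_equivalent 3
  (resolution_homotopy_equivalent P_resolution (koszul_resolution I_fg f_reg
    g_reg))).
have [F' F'_bij] := homotopy_equivalent_homology k (koszul_Sym3_target f g).
case: ifP => [k024|/negbT k024].
  have [k6 k_even] : (k < 6)%N /\ ~~ odd k.
    by move: k024; rewrite !inE => /or3P[] /eqP->.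
  have [L L_bij] := target_homology_even I_fg f_reg k6 k_even.
  apply: (free_rank1_over_quot (L := L \o (F' \o F))).
  exact: bij_comp L_bij (bij_comp F'_bij F_bij).
apply: free_rank0_over_quot => x; apply: (bij_inj F_bij); apply: (bij_inj F'_bij).
rewrite !raddf0; exact: target_homology_trivial.
Qed.
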